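(* Let $n\ge 1$ be an integer and let $p\in\mathbb{C}$ be arbitrary. The linear map $\pi: U_q[sl(n+1)]\rightarrow W(n)$ defined on the generators by $$\pi(h_1)=p-N-N_1,\qquad \pi(h_i)=N_{i-1}-N_i,\quad i=2,3,\ldots,n,$$ $$\pi(e_1)=\sqrt{\frac{[N_1+1]}{N_1+1}[p-N]}\;a_1^-,\qquad \pi(e_i)=\sqrt{\frac{[N_{i-1}]}{N_{i-1}}\,\frac{[N_i+1]}{N_i+1}}\;a_i^-a_{i-1}^+,\quad i=2,3,\ldots,n,$$ $$\pi(f_1)=\sqrt{\frac{[N_1]}{N_1}[p-N+1]}\;a_1^+,\qquad \pi(f_i)=\sqrt{\frac{[N_{i-1}+1]}{N_{i-1}+1}\,\frac{[N_i]}{N_i}}\;a_i^+a_{i-1}^-,\quad i=2,3,\ldots,n,$$ is a morphism (of associative unital algebras) of $U_q[sl(n+1)]$ into $W(n)$. If $p$ is a positive integer, then, for the resulting representation of $U_q[sl(n+1)]$ in the Fock space $\mathcal{F}(n)$, the subspaces $$\mathcal{F}_0(p;n)=\mathrm{span}\{|l_1,\ldots,l_n\rangle : l_1+\cdots+l_n\le p\},\qquad \mathcal{F}_1(p;n)=\mathrm{span}\{|l_1,\ldots,l_n\rangle : l_1+\cdots+l_n> p\}$$ are invariant subspaces; $\mathcal{F}_0(p;n)$ carries a finite-dimensional irreducible representation of $U_q[sl(n+1)]$; and this representation is unitarizable, with respect to the anti-involution $\omega$ given by $\omega(h_i)=h_i$, $\omega(e_i)=f_i$ ($i=1,\ldots,n$)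 and the metric for which the vectors $|l_1,\ldots,l_n\rangle$ are orthonormal, provided $q>0$.
   Context: Notation: $[a,b]=ab-ba$, $[a,b]_x=ab-x\,ba$, $\bar q=q^{-1}$. Let $\mathbb{C}[[h]]$ be the algebra of formal power series in the indeterminate $h$, and $q=e^{h/2}\in\mathbb{C}[[h]]$; accordingly $q^x=e^{hx/2}$. Put $[x]=\dfrac{q^x-\bar q^{\,x}}{q-\bar q}$ (square brackets with a single argument); $[x]/x$ is understood as the corresponding power series in $x$ (removable singularity at $x=0$). The quantum algebra $U_q[sl(n+1)]$ is the topologically free $\mathbb{C}[[h]]$-module (complete in the $h$-adic topology) and associative unital algebra generated by $h_i,e_i,f_i$, $i=1,\ldots,n$, subject to the following relations (the remaining Hopf algebra structure plays no role here). Cartan relations: $$[h_i,h_j]=0,\quad [h_i,e_j]=(2\delta_{ij}-\delta_{i,j-1}-\delta_{i-1,j})e_j,\quad [h_i,f_j]=-(2\delta_{ij}-\delta_{i,j-1}-\delta_{i-1,j})f_j,\quad [e_i,f_j]=\delta_{ij}\frac{q^{h_i}-\bar q^{\,h_i}}{q-\bar q}.$$ Serre relations: $$[e_i,e_j]=0,\quad [f_i,f_j]=0\quad\text{for } |i-j|\ne 1,$$ $$[e_i,[e_i,e_{i\pm1}]_{\bar q}]_q=[e_i,[e_i,e_{i\pm1}]_q]_{\bar q}=0,\qquad [f_i,[f_i,f_{i\pm1}]_{\bar q}]_q=[f_i,[f_i,f_{i\pm1}]_q]_{\bar q}=0$$ (whenever the indices lie in $\{1,\ldots,n\}$). The Weyl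 algebra $W(n)$ is the topologically free $\mathbb{C}[[h]]$-module (complete in the $h$-adic topology) and associative unital algebra generated by $a_1^\pm,\ldots,a_n^\pm$ with relations $$[a_i^-,a_j^+]=\delta_{ij},\qquad [a_i^+,a_j^+]=[a_i^-,a_j^-]=0,\qquad i,j=1,\ldots,n.$$ The number operators are $N_i=a_i^+a_i^-$ and $N=N_1+\cdots+N_n$. Convention: the functions $f(N_1,\ldots,N_n)$ of the number operators appearing in the claim (including the square roots) are regarded as elements of $W(n)$; they commute with each other and satisfy $f(N_1,\ldots,N_n)\,a_j^\pm=a_j^\pm f(N_1\pm\delta_{1j},\ldots,N_n\pm\delta_{nj})$. Numerical $q$: one may also take $h$ and $q=e^{h/2}$ to be complex numbers with $q$ not a root of $1$ (factorizing $U_q[sl(n+1)]$ and $W(n)$ by the ideals generated by the relation $q=\text{number}$); the claim is understood in this setting too, and the condition $q>0$ refers to it. The Fock space $\mathcal{F}(n)$ is the representation space of $W(n)$ with vacuum $|0\rangle$, $a_i^-|0\rangle=0$, and orthonormal basis $$|l_1,\ldots,l_n\rangle=\frac{(a_1^+)^{l_1}\cdots(a_n^+)^{l_n}}{\sqrt{l_1!\cdots l_n!}}|0\rangle,\qquad l_1,\ldots,l_n=0,1,2,\ldots,$$ so $N_i|l_1,\ldots,l_n\rangle=l_i|l_1,\ldots,l_n\rangle$ and a function $f(N_1,\ldots,N_n)$ acts by the scalar $f(l_1,\ldots,l_n)$ on this vector. $U_q[sl(n+1)]$ acts on $\mathcal{F}(n)$ through $\pi$. The map $\omega$ is an antilinear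 anti-involution of $U_q[sl(n+1)]$. Unitarizability of the representation on $\mathcal{F}_0(p;n)$ with respect to $\omega$ and the scalar product $(\cdot,\cdot)$ means $(\pi(h_i)x,y)=(x,\pi(h_i)y)$ and $(\pi(e_i)x,y)=(x,\pi(f_i)y)$ for all $x,y\in\mathcal{F}_0(p;n)$ and $i=1,\ldots,n$.
   Formalization: Over C[[h]] ''irreducible'' is taken up to torsion (literally it fails: hF_0 is a proper submodule); the square root of a product is the product of fixed roots of [x]/x and [x]; for numerical q the elements q^{±h_i} are adjoined to U_q as generators. *)

(* Defs.v *)
From HB Require Import structures.
From mathcomp Require Import all_boot all_order all_algebra.
From mathcomp Require Import boolp classical_sets reals sequences exp trigo.
From mathcomp Require Import generic_quotient ring_quotient complex.
(* [finmap] and [monalg] share notation symbols with the analysis libraries: only their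
   definitions and canonical instances are imported. *)
From mathcomp Require Import -(notations) finmap monalg.

Set Implicit Arguments.
Unset Strict Implicit.
Unset Printing Implicit Defensive.

Import Order.TTheory GRing.Theory Num.Theory.
Local Open Scope classical_set_scope.
Local Open Scope quotient_scope.
Local Open Scope ring_scope.

(* [fps V] is the h-adically complete module V[[h]]; a ring if V is one, and a
  module (algebra) over K[[h]] if V is a module (algebra) over K. *)

Record fps (V : Type) : Type := Fps { fps_coef :> nat -> V }.

Lemma fpsP V (s t : fps V) : (forall m, s m = t m) -> s = t.
Proof. by case: s t => [s] [t] /= /funext->. Qed.

HB.instance Definition _ (V : Type) := gen_eqMixin (fps V).
HB.instance Definition _ (V : Type) := gen_choiceMixin (fps V).

Section FpsZmod.
Variable V : zmodType.
Implicit Types s t : fps V.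

Definition fps_zero : fps V := Fps (fun=> 0).
Definition fps_opp s : fps V := Fps (fun m => - s m).
Definition fps_add s t : fps V := Fps (fun m => s m + t m).

Fact fps_addA : associative fps_add.
Proof. by move=> s t u; apply: fpsP => m /=; rewrite addrA. Qed.
Fact fps_addC : commutative fps_add.
Proof. by move=> s t; apply: fpsP => m /=; rewrite addrC. Qed.
Fact fps_add0 : left_id fps_zero fps_add.
Proof. by move=> s; apply: fpsP => m /=; rewrite add0r. Qed.
Fact fps_addN : left_inverse fps_zero fps_opp fps_add.
Proof. by move=> s; apply: fpsP => m /=; rewrite addNr. Qed.

HB.instance Definition _ :=
  GRing.isZmodule.Build (fps V) fps_addA fps_addC fps_add0 fps_addN.

Definition fpsC (v : V) : fps V := Fps (fun m => if m == 0%N then v else 0).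

(* division by h, for a series with zero constant term *)
Definition divh (s : fps V) : fps V := Fps (fun m => s m.+1).

Lemma fps0E m : (0 : fps V) m = 0. Proof. by []. Qed.
Lemma fpsDE s t m : (s + t) m = s m + t m. Proof. by []. Qed.
Lemma fpsNE s m : (- s) m = - s m. Proof. by []. Qed.

Lemma fps_sumE (I : Type) (r : seq I) (P : pred I) (F : I -> fps V) m :
  (\sum_(i <- r | P i) F i) m = \sum_(i <- r | P i) F i m.
Proof. by elim/big_rec2: _ => //= i x y _ <-. Qed.

End FpsZmod.

Section Cauchy.
Variables (U V W X Y Z : zmodType).
Variables (f : U -> Y -> Z) (g : V -> W -> Y) (f' : X -> W -> Z) (g' : U -> V -> X).
Hypothesis f0 : forall u, f u 0 = 0.
Hypothesis fD : forall u, {morph f u : y z / y + z}.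
Hypothesis f'0 : forall w, f' 0 w = 0.
Hypothesis f'D : forall w, {morph f'^~ w : y z / y + z}.
Hypothesis fgA : forall u v w, f u (g v w) = f' (g' u v) w.

Lemma cauchyA (a : nat -> U) (b : nat -> V) (c : nat -> W) m :
  \sum_(i < m.+1) f (a i) (\sum_(j < (m - i).+1) g (b j) (c (m - i - j)%N)) =
  \sum_(k < m.+1) f' (\sum_(i < k.+1) g' (a i) (b (k - i)%N)) (c (m - k)%N).
Proof.
pose F (i k : nat) := f (a i) (g (b (m - i - k)%N) (c k)).
transitivity (\sum_(i < m.+1) \sum_(k < m.+1 | (k <= m - i)%N) F i k).
  apply: eq_bigr => i _.
  rewrite (big_morph (f (a i)) (fD (a i)) (f0 (a i))).
  rewrite (reindex_inj rev_ord_inj) /= (big_ord_narrow_leq (leq_subr _ _)).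
  apply: eq_bigr => k _; rewrite /F /= subSS; congr f; congr g.
  by rewrite subKn // -ltnS.
rewrite (exchange_big_dep predT) //= [RHS](reindex_inj rev_ord_inj) /=.
apply: eq_bigr => k _; rewrite subSS subKn -1?ltnS //.
transitivity (\sum_(i < m.+1 | (i <= m - k)%N) F i k).
  apply: eq_bigl => i; rewrite -ltnS -(ltnS i) -!subSn ?leq_ord //.
  by rewrite -subn_gt0 -(subn_gt0 i) -!subnDA addnC.
rewrite (big_ord_narrow_leq (leq_subr _ _)) /=.
rewrite (big_morph (f'^~ (c k)) (f'D (c k)) (f'0 (c k))).
by apply: eq_bigr => i _; rewrite /F -fgA -!subnDA addnC.
Qed.

End Cauchy.

Section FpsRing.
Variable A : nzRingType.
Implicit Types s t : fps A.

Definition fps_mul s t : fps A :=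
  Fps (fun m => \sum_(i < m.+1) s i * t (m - i)%N).

Fact fps_mulA : associative fps_mul.
Proof.
move=> s t u; apply: fpsP => m /=.
apply: (cauchyA (f := *%R) (g := *%R) (f' := *%R) (g' := *%R)).
- exact: mulr0.
- by move=> x y z; rewrite mulrDr.
- exact: mul0r.
- by move=> x y z; rewrite mulrDl.
- exact: mulrA.
Qed.

Fact fps_mul1 : left_id (fpsC 1) fps_mul.
Proof.
move=> s; apply: fpsP => m /=.
by rewrite big_ord_recl big1 /= ?mul1r ?addr0 ?subn0 // => i _; rewrite mul0r.
Qed.

Fact fps_mulr1 : right_id (fpsC 1) fps_mul.
Proof.
move=> s; apply: fpsP => m /=; rewrite big_ord_recr big1 /=.
  by rewrite subnn mulr1 add0r.
by move=> i _; rewrite subn_eq0 leqNgt ltn_ord mulr0.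
Qed.

Fact fps_mulDl : left_distributive fps_mul +%R.
Proof.
move=> s t u; apply: fpsP => m /=; rewrite -big_split /=.
by apply: eq_bigr => i _; rewrite mulrDl.
Qed.

Fact fps_mulDr : right_distributive fps_mul +%R.
Proof.
move=> s t u; apply: fpsP => m /=; rewrite -big_split /=.
by apply: eq_bigr => i _; rewrite mulrDr.
Qed.

Fact fps_1neq0 : fpsC 1 != 0 :> fps A.
Proof.
by apply/eqP => /(congr1 (fun s : fps A => s 0%N)) /eqP; rewrite /= oner_eq0.
Qed.

HB.instance Definition _ := GRing.Zmodule_isNzRing.Build (fps A)
  fps_mulA fps_mul1 fps_mulr1 fps_mulDl fps_mulDr fps_1neq0.

Lemma fpsME s t m : (s * t) m = \sum_(i < m.+1) s i * t (m - i)%N.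
Proof. by []. Qed.

End FpsRing.

Section FpsComRing.
Variable A : comNzRingType.

Fact fps_mulC : commutative (@fps_mul A).
Proof.
move=> s t; apply: fpsP => m /=; rewrite (reindex_inj rev_ord_inj) /=.
by apply: eq_bigr => i _; rewrite mulrC subSS subKn // -ltnS.
Qed.

HB.instance Definition _ := GRing.PzRing_hasCommutativeMul.Build (fps A) fps_mulC.

End FpsComRing.

Section FpsLmod.
Variables (K : nzRingType) (V : lmodType K).

Definition fps_scale (c : fps K) (s : fps V) : fps V :=
  Fps (fun m => \sum_(i < m.+1) c i *: s (m - i)%N).

Fact fps_scaleA a b s : fps_scale a (fps_scale b s) = fps_scale (a * b) s.
Proof.
apply: fpsP => m /=.
apply: (cauchyA (f := *:%R) (g := *:%R) (f' := *:%R) (g' := *%R)).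
- exact: scaler0.
- by move=> x y z; rewrite scalerDr.
- exact: scale0r.
- by move=> x y z; rewrite scalerDl.
- exact: scalerA.
Qed.

Fact fps_scale1 : left_id 1 fps_scale.
Proof.
move=> s; apply: fpsP => m /=.
rewrite big_ord_recl big1 /= ?scale1r ?addr0 ?subn0 // => i _.
by rewrite scale0r.
Qed.

Fact fps_scaleDr : right_distributive fps_scale +%R.
Proof.
move=> c s t; apply: fpsP => m /=; rewrite -big_split /=.
by apply: eq_bigr => i _; rewrite scalerDr.
Qed.

Fact fps_scaleDl s : {morph fps_scale^~ s : a b / a + b}.
Proof.
move=> a b; apply: fpsP => m /=; rewrite -big_split /=.
by apply: eq_bigr => i _; rewrite scalerDl.
Qed.

HB.instance Definition _ := GRing.Zmodule_isLmodule.Build (fps K) (fps V)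
  fps_scaleA fps_scale1 fps_scaleDr fps_scaleDl.

End FpsLmod.

Section FpsLalg.
Variables (K : nzRingType) (A : lalgType K).

Fact fps_scaleAl (c : fps K) (s t : fps A) : c *: (s * t) = (c *: s) * t.
Proof.
apply: fpsP => m /=.
apply: (cauchyA (f := *:%R) (g := *%R) (f' := *%R) (g' := *:%R)).
- exact: scaler0.
- by move=> x y z; rewrite scalerDr.
- exact: mul0r.
- by move=> x y z; rewrite mulrDl.
- exact: scalerAl.
Qed.

HB.instance Definition _ := GRing.Lmodule_isLalgebra.Build (fps K) (fps A) fps_scaleAl.

End FpsLalg.

Definition free_alg (K : nzRingType) (X : choiceType) : Type := malg (fmonom X) K.

HB.instance Definition _ (K : nzRingType) (X : choiceType) :=
  GRing.Lalgebra.on (free_alg K X).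

Definition gen {K : nzRingType} {X : choiceType} (x : X) : free_alg K X :=
  mkmalgU (fmu x) 1.

(* Two-sided ideal; it is automatically stable under scalars, as the latter act
   through a *: x = (a *: 1) * x. *)
Definition is_ideal (A : nzRingType) (I : set A) : Prop :=
  [/\ I 0, forall x y, I x -> I y -> I (x - y) &
      forall a x, I x -> I (a * x) /\ I (x * a)].

Record ideal (A : nzRingType) :=
  Ideal { ideal_set :> A -> Prop; idealP : is_ideal ideal_set }.

(* closed for the h-adic topology *)
Definition h_closed (A : nzRingType) (S : set (fps A)) : Prop :=
  forall x : fps A, (forall m, exists2 y : fps A, S y & forall k, (k < m)%N -> x k = y k) -> S x.

Definition ideal_gen_set (A : nzRingType) (r : set A) : set A :=
  [set x | forall I, is_ideal I -> r `<=` I -> I x].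

Definition closed_ideal_gen_set (A : nzRingType) (r : set (fps A)) : set (fps A) :=
  [set x | forall I, is_ideal I -> h_closed I -> r `<=` I -> I x].

Lemma ideal_gen_ideal (A : nzRingType) (r : set A) : is_ideal (ideal_gen_set r).
Proof.
split=> [I [] //|x y rx ry I II rI|a x rx].
  by case: (II) => _ + _; apply; [apply: rx|apply: ry].
by split=> I II rI; case: (II) => _ _ /(_ a x (rx I II rI)) [].
Qed.

Lemma closed_ideal_gen_ideal (A : nzRingType) (r : set (fps A)) :
  is_ideal (closed_ideal_gen_set r).
Proof.
split=> [I [] //|x y rx ry I II cI rI|a x rx].
  by case: (II) => _ + _; apply; [apply: rx|apply: ry].
by split=> I II cI rI; case: (II) => _ _ /(_ a x (rx I II cI rI)) [].
Qed.

Definition ideal_gen (A : nzRingType) (r : set A) : ideal A :=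
  Ideal (ideal_gen_ideal r).

Definition closed_ideal_gen (A : nzRingType) (r : set (fps A)) : ideal (fps A) :=
  Ideal (closed_ideal_gen_ideal r).

Definition ideal_pred (A : nzRingType) (I : ideal A) : {pred A} :=
  fun x => `[< I x >].

Lemma ideal_predE (A : nzRingType) (I : ideal A) x : (x \in ideal_pred I) = `[< I x >].
Proof. by []. Qed.

Fact ideal_pred_zmod_closed (A : nzRingType) (I : ideal A) : zmod_closed (ideal_pred I).
Proof.
case: I => I [I0 IB IM]; split; rewrite ?ideal_predE; first exact/asboolP.
by move=> x y; rewrite !ideal_predE => /asboolP Ix /asboolP Iy; apply/asboolP/IB.
Qed.

HB.instance Definition _ (A : nzRingType) (I : ideal A) :=
  GRing.isZmodClosed.Build A (ideal_pred I) (ideal_pred_zmod_closed I).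

(* The quotient A / I, as a (possibly zero) ring and a K-module. *)
Definition quot_alg (K : nzRingType) (A : lalgType K) (I : ideal A) : Type :=
  Quotient.quot (ideal_pred I).

Section QuotAlg.
Variables (K : nzRingType) (A : lalgType K) (I : ideal A).
Local Notation Q := (quot_alg I).

HB.instance Definition _ := GRing.Zmodule.on Q.

Definition cl (x : A) : Q := \pi_(Quotient.quot (ideal_pred I)) x.
Local Notation rep x := (repr (x : Quotient.quot (ideal_pred I)) : A).

Lemma clP x y : reflect (cl x = cl y) `[< I (x - y) >].
Proof. by rewrite -ideal_predE Quotient.idealrBE; apply: eqP. Qed.

Lemma cl_repr (q : Q) : cl (rep q) = q.
Proof. exact: reprK. Qed.

Lemma cl_ind (P : Q -> Prop) : (forall x, P (cl x)) -> forall q, P q.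
Proof. by move=> Pcl q; rewrite -[q]cl_repr. Qed.

Fact cl_is_additive : additive cl.
Proof. by move=> x y; rewrite /cl raddfB. Qed.

HB.instance Definition _ := GRing.isAdditive.Build A Q cl cl_is_additive.

Definition quot_mul (x y : Q) : Q := cl (rep x * rep y).
Definition quot_scale (a : K) (x : Q) : Q := cl (a *: rep x).

Lemma cl_mul x y : quot_mul (cl x) (cl y) = cl (x * y).
Proof.
have I_repr z : I (rep (cl z) - z) by apply/asboolP/clP; rewrite cl_repr.
have [J0 JB JM] := idealP I.
apply/clP/asboolP; rewrite /=.
set x' := rep _; set y' := rep _.
have -> : x' * y' - x * y = (x' - x) * y' - x * - (y' - y).
  by rewrite mulrBl mulrN opprK mulrBr addrA subrK.
apply: (JB); first exact: (JM _ _ (I_repr x)).2.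
by apply: (JM _ _ _).1; rewrite -sub0r; apply: JB; last exact: I_repr.
Qed.

Fact quot_mulA : associative quot_mul.
Proof.
by elim/cl_ind=> x; elim/cl_ind=> y; elim/cl_ind=> z; rewrite !cl_mul mulrA.
Qed.

Fact quot_mul1 : left_id (cl 1) quot_mul.
Proof. by elim/cl_ind=> x; rewrite cl_mul mul1r. Qed.

Fact quot_mulr1 : right_id (cl 1) quot_mul.
Proof. by elim/cl_ind=> x; rewrite cl_mul mulr1. Qed.

Fact quot_mulDl : left_distributive quot_mul +%R.
Proof.
elim/cl_ind=> x; elim/cl_ind=> y; elim/cl_ind=> z.
by rewrite -raddfD !cl_mul mulrDl raddfD.
Qed.

Fact quot_mulDr : right_distributive quot_mul +%R.
Proof.
elim/cl_ind=> x; elim/cl_ind=> y; elim/cl_ind=> z.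
by rewrite -raddfD !cl_mul mulrDr raddfD.
Qed.

HB.instance Definition _ := GRing.Zmodule_isPzRing.Build Q
  quot_mulA quot_mul1 quot_mulr1 quot_mulDl quot_mulDr.

Lemma cl_scale a x : quot_scale a (cl x) = cl (a *: x).
Proof.
have [_ _ JM] := idealP I; apply/clP/asboolP; rewrite -scalerBr.
rewrite -[_ - _]mul1r scalerAl; apply: (JM _ _ _).1.
by apply/asboolP/clP; rewrite cl_repr.
Qed.

Fact quot_scaleA a b q : quot_scale a (quot_scale b q) = quot_scale (a * b) q.
Proof. by elim/cl_ind: q => x; rewrite !cl_scale scalerA. Qed.

Fact quot_scale1 : left_id 1 quot_scale.
Proof. by elim/cl_ind=> x; rewrite cl_scale scale1r. Qed.

Fact quot_scaleDr : right_distributive quot_scale +%R.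
Proof.
move=> a; elim/cl_ind=> x; elim/cl_ind=> y.
by rewrite -raddfD !cl_scale scalerDr raddfD.
Qed.

Fact quot_scaleDl q : {morph quot_scale^~ q : a b / a + b}.
Proof. by elim/cl_ind: q => x a b; rewrite !cl_scale scalerDl raddfD. Qed.

HB.instance Definition _ := GRing.Zmodule_isLmodule.Build K Q
  quot_scaleA quot_scale1 quot_scaleDr quot_scaleDl.

End QuotAlg.

Arguments cl {K A} I x.

(* Indices run over 'I_n: the generator with index i in the usual numbering
  1, ..., n is the one with index i - 1 here. *)

Section QuantumRelations.
Variables (K : nzRingType) (n : nat) (T : lalgType K).

Definition cartan (i j : 'I_n) : int :=
  2 * (i == j)%:Z - (i.+1 == j :> nat)%:Z - (j.+1 == i :> nat)%:Z.

Definition adjacent (i j : 'I_n) : bool :=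
  (i.+1 == j :> nat) || (j.+1 == i :> nat).

Definition comm (x y : T) : T := x * y - y * x.
Definition qcomm (c : K) (x y : T) : T := x * y - c *: (y * x).

Variables (q qV : K) (h e f : 'I_n -> T).

(* [br i] stands for (q^{h_i} - q^{-h_i}) / (q - q^{-1}). *)
Variable br : 'I_n -> T.

Inductive Uq_rel : T -> Prop :=
| Uq_hh i j : Uq_rel (comm (h i) (h j))
| Uq_he i j : Uq_rel (comm (h i) (e j) - e j *~ cartan i j)
| Uq_hf i j : Uq_rel (comm (h i) (f j) + f j *~ cartan i j)
| Uq_ef i j : Uq_rel (comm (e i) (f j) - br i *+ (i == j))
| Uq_ee i j : ~~ adjacent i j -> Uq_rel (comm (e i) (e j))
| Uq_ff i j : ~~ adjacent i j -> Uq_rel (comm (f i) (f j))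
| Uq_eee i j : adjacent i j -> Uq_rel (qcomm q (e i) (qcomm qV (e i) (e j)))
| Uq_eee' i j : adjacent i j -> Uq_rel (qcomm qV (e i) (qcomm q (e i) (e j)))
| Uq_fff i j : adjacent i j -> Uq_rel (qcomm q (f i) (qcomm qV (f i) (f j)))
| Uq_fff' i j : adjacent i j -> Uq_rel (qcomm qV (f i) (qcomm q (f i) (f j))).

End QuantumRelations.

Section FormalQ.
Variable R : realType.
Local Notation C := R[i].

(* q^x = exp (h x / 2) *)
Definition h_qpow (A : lalgType C) (x : A) : fps A :=
  Fps (fun m => (2 ^- m / m`!%:R) *: x ^+ m).

Definition h_q : fps C := h_qpow (1 : C^o).
Definition h_qV : fps C := h_qpow (-1 : C^o).

(* Inverse of a series with nonzero constant term, as a geometric series. *)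
Definition fps_inv (s : fps C) : fps C :=
  fpsC (s 0%N)^-1 *
  Fps (fun m => (\sum_(k < m.+1) (1 - fpsC (s 0%N)^-1 * s) ^+ k) m).

(* h / (q - q^{-1}) *)
Definition h_over_qq : fps C := fps_inv (divh (h_q - h_qV)).

(* [x] = (q^x - q^{-x}) / (q - q^{-1}), dividing numerator and denominator by h *)
Definition h_bracket (A : lalgType C) (x : A) : fps A :=
  h_over_qq *: divh (h_qpow x - h_qpow (- x)).

Definition h_qint (x : C) : fps C := h_bracket (x : C^o).

(* the power series [x]/x, whose value at x = 0 is h / (q - q^{-1}) *)
Definition h_qratio (x : C) : fps C :=
  if x == 0 then h_over_qq else fpsC x^-1 * h_qint x.

End FormalQ.

(* [h_bracketP] justifies the formula for [x], and [h_branches_exist] gives the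
   square roots of [x]/x and [x] in C[[h]]. *)
Section FormalQTheory.
Variable R : realType.
Local Notation C := R[i].

Let fps1E m : (1 : fps C) m = (m == 0%N)%:R.
Proof. by rewrite /GRing.one /=; case: eqP. Qed.

Lemma fpsCMl (V : lalgType C) (c : C) (s : fps V) m : (fpsC c *: s) m = c *: s m.
Proof.
rewrite /GRing.scale /= big_ord_recl big1 /= ?addr0 ?subn0 // => i _.
by rewrite scale0r.
Qed.

Lemma fpsC_mulE (c : C) (s : fps C) m : (fpsC c * s) m = c * s m.
Proof. by rewrite fpsME big_ord_recl big1 /= ?addr0 ?subn0 // => i _; rewrite mul0r. Qed.

Lemma fps_exp_low (u : fps C) : u 0%N = 0 -> forall k j, (j < k)%N -> (u ^+ k) j = 0.
Proof.
move=> u0; elim=> // k IH j jk; rewrite exprS fpsME big_ord_recl u0 mul0r add0r.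
rewrite big1 // => i _ /=; rewrite IH ?mulr0 //.
move: jk; rewrite ltnS => jk; case: j jk i => [|j] jk [i /= hi] //.
by rewrite /bump /= add1n subSS (leq_ltn_trans (leq_subr _ _)).
Qed.

Lemma fps_mulV (s : fps C) : s 0%N != 0 -> s * fps_inv s = 1.
Proof.
move=> s0; pose u := 1 - fpsC (s 0%N)^-1 * s.
have u0 : u 0%N = 0.
  by rewrite /u fpsDE fpsNE fps1E fpsC_mulE mulVf // subrr.
pose S m := \sum_(k < m.+1) u ^+ k.
rewrite /fps_inv mulrA [s * _]mulrC.
rewrite [X in X * _](_ : _ = 1 - u); last by rewrite /u opprB addrC subrK.
apply: fpsP => m.
have SE j : (j <= m)%N -> S j j = S m j.
  move=> jm; rewrite /S !fps_sumE (big_ord_widen _ (fun k => (u ^+ k) j) (jm : (j.+1 <= m.+1)%N)).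
  rewrite [RHS](bigID (fun k : 'I_m.+1 => (k < j.+1)%N)) /=.
  rewrite [X in _ + X]big1 ?addr0 // => k; rewrite -leqNgt => jk.
  exact: fps_exp_low.
have -> : ((1 - u) * Fps (fun m => S m m)) m = ((1 - u) * S m) m.
  by rewrite !fpsME; apply: eq_bigr => i _ /=; rewrite SE // leq_subr.
have -> : (1 - u) * S m = 1 - u ^+ m.+1.
  rewrite /S -[X in _ = X - _](expr1n _ m.+1) subrXX; congr (_ * _).
  by apply: eq_bigr => k _; rewrite expr1n mul1r.
by rewrite fpsDE fpsNE (fps_exp_low u0) // subr0.
Qed.

Lemma divh_qpow0 (A : lalgType C) (x : A) :
  divh (h_qpow x - h_qpow (- x)) 0%N = x.
Proof.
pose c : C := 2 ^- 1 / 1`!%:R.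
rewrite -[LHS]/(c *: x ^+ 1 - c *: (- x) ^+ 1) !expr1 scalerN opprK -scalerDl.
by rewrite /c expr1 divr1 -mulr2n -(mulr_natl 2^-1) mulfV ?pnatr_eq0 // scale1r.
Qed.

Let qq_neq0 : divh (h_q R - h_qV R) 0%N != 0.
Proof. by rewrite (@divh_qpow0 C^o 1) oner_eq0. Qed.

Let X : fps C := Fps (fun m => (m == 1%N)%:R).

Let divhK (V : lmodType C) (s : fps V) : s 0%N = 0 -> X *: divh s = s.
Proof.
move=> s0; apply: fpsP => -[|m]; rewrite /GRing.scale /= big_ord_recl /= scale0r add0r.
  by rewrite big_ord0.
by rewrite big_ord_recl /= scale1r subn1 /= big1 ?addr0 // => i _; rewrite scale0r.
Qed.

Lemma h_bracketP (A : lalgType C) (x : A) :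
  (h_q R - h_qV R) *: h_bracket x = h_qpow x - h_qpow (- x).
Proof.
have sub0 (B : lalgType C) (y : B) : (h_qpow y - h_qpow (- y)) 0%N = 0.
  by rewrite /= !expr0 subrr.
have E : h_q R - h_qV R = X * divh (h_q R - h_qV R).
  exact: (esym (@divhK C^o _ (sub0 C^o 1))).
by rewrite {1}E /h_bracket scalerA -mulrA (fps_mulV qq_neq0) mulr1 (divhK (sub0 A x)).
Qed.

Lemma h_qintE (x : C) : h_qint x = fpsC x * h_qratio x.
Proof.
rewrite /h_qratio; case: eqVneq => [->|x0]; last first.
  by apply: fpsP => m; rewrite !fpsC_mulE mulrA mulfV // mul1r.
rewrite /h_qint /h_bracket oppr0 subrr.
have -> : divh 0 = 0 :> fps C^o by apply: fpsP.
by rewrite scaler0; apply: fpsP => m; rewrite fpsC_mulE mul0r.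
Qed.

Lemma h_qratio0 (x : C) : h_qratio x 0%N != 0.
Proof.
have qq1 : h_over_qq R 0%N = 1.
  have /(congr1 (fun s : fps C => s 0%N)) := fps_mulV qq_neq0.
  by rewrite fpsME big_ord1 (@divh_qpow0 C^o 1) mul1r.
rewrite /h_qratio; case: (eqVneq x 0) => [_|x0]; first by rewrite qq1 oner_eq0.
rewrite fpsC_mulE mulf_neq0 ?invr_eq0 //.
have -> : h_qint x 0%N = \sum_(i < 1) h_over_qq R i * divh (h_qpow (x : C^o) - h_qpow (- x : C^o)) (0 - i)%N by [].
by rewrite big_ord1 qq1 mul1r (@divh_qpow0 C^o x).
Qed.

Lemma fps_sqrt (a : fps C) : a 0%N != 0 -> exists s, s ^+ 2 = a.
Proof.
move=> a0; pose c0 := sqrtC (a 0%N).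
have c0_neq0 : c0 *+ 2 != 0 by rewrite mulrn_eq0 /= sqrtC_eq0.
pose next (l : seq C) m :=
  if m == 0%N then c0 else
  (a m - \sum_(1 <= i < m) l`_i * l`_(m - i)) / (c0 *+ 2).
pose fix L m := if m is m'.+1 then rcons (L m') (next (L m') m') else [::].
have szL m : size (L m) = m by elim: m => //= m IH; rewrite size_rcons IH.
pose s := Fps (fun m => (L m.+1)`_m).
have LE m i : (i < m)%N -> (L m)`_i = s i.
  elim: m => // m IH; rewrite ltnS leq_eqVlt => /predU1P[->//|im].
  by rewrite /= nth_rcons szL im IH.
have sE m : s m = next (L m) m by rewrite /= nth_rcons szL ltnn eqxx.
exists s; clearbody s; apply: fpsP => -[|m]; rewrite expr2 fpsME.
  by rewrite big_ord1 sE /next /= -expr2 sqrtCK.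
have s0 : s 0%N = c0 by rewrite sE.
rewrite -(big_mkord xpredT (fun i => s i * s (m.+1 - i)%N)).
rewrite big_nat_recr //= big_ltn // subn0 subnn s0.
have -> : \sum_(1 <= i < m.+1) s i * s (m.+1 - i)%N =
          \sum_(1 <= i < m.+1) (L m.+1)`_i * (L m.+1)`_(m.+1 - i).
  rewrite !big_nat; apply: eq_bigr => i /andP[i0 im].
  by rewrite !LE // ltn_subrL i0.
rewrite [X in _ + X + _ = _](_ : _ = a m.+1 - s m.+1 * (c0 *+ 2)); last first.
  by rewrite sE /next /= divfK // opprB addrC subrK.
by rewrite addrAC mulrnAr [c0 * _]mulrC -mulr2n addrC subrK.
Qed.

Lemma h_branches_exist : exists alpha beta : C -> fps C,
  (forall x, alpha x ^+ 2 = h_qratio x) /\ (forall x, beta x ^+ 2 = h_qint x).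
Proof.
have /choice[alpha alphaP] : forall x : C, exists s : fps C, s ^+ 2 = h_qratio x.
  by move=> x; apply/fps_sqrt/h_qratio0.
exists alpha, (fun x => fpsC (sqrtC x) * alpha x); split=> // x.
rewrite exprMn alphaP h_qintE; congr (_ * _); apply: fpsP => m.
by rewrite expr2 fpsC_mulE /=; case: eqP => _; rewrite ?mulr0 // -expr2 sqrtCK.
Qed.

End FormalQTheory.

Inductive Ugen (n : nat) : Type := GenH of 'I_n | GenE of 'I_n | GenF of 'I_n.
Arguments GenH {n}. Arguments GenE {n}. Arguments GenF {n}.
HB.instance Definition _ n := gen_eqMixin (Ugen n).
HB.instance Definition _ n := gen_choiceMixin (Ugen n).

Section FormalUq.
Variables (R : realType) (n : nat).
Local Notation C := R[i].
Local Notation T := (fps (free_alg C (Ugen n))).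

Definition hU_rel : set T :=
  Uq_rel (h_q R) (h_qV R) (fun i => fpsC (gen (GenH i)))
    (fun i => fpsC (gen (GenE i))) (fun i => fpsC (gen (GenF i)))
    (fun i => h_bracket (gen (GenH i))).

Definition hU_ideal : ideal T := closed_ideal_gen hU_rel.

Definition hU : Type := quot_alg hU_ideal.
HB.instance Definition _ := GRing.PzRing.on hU.
HB.instance Definition _ := GRing.Lmodule.on hU.

Definition hU_h (i : 'I_n) : hU := cl hU_ideal (fpsC (gen (GenH i))).
Definition hU_e (i : 'I_n) : hU := cl hU_ideal (fpsC (gen (GenE i))).
Definition hU_f (i : 'I_n) : hU := cl hU_ideal (fpsC (gen (GenF i))).

End FormalUq.

Section NumericQ.
Variable R : realType.
Local Notation C := R[i].

Definition cexp (z : C) : C :=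
  (expR (complex.Re z))%:C%C * (cos (complex.Im z) +i* sin (complex.Im z))%C.

Variable h : C.

Definition n_qpow (x : C) : C := cexp (h * x / 2).
Definition n_q : C := n_qpow 1.
Definition n_qint (x : C) : C := (n_qpow x - n_qpow (- x)) / (n_q - n_q^-1).
Definition n_qratio (x : C) : C :=
  if x == 0 then h / (n_q - n_q^-1) else n_qint x / x.

End NumericQ.

(* For a complex number q the series q^{h_i} is no longer available: the
   elements q^{h_i} and q^{-h_i} are adjoined as generators [GenK], [GenKV]. *)
Inductive nUgen (n : nat) : Type :=
  GenU of Ugen n | GenK of 'I_n | GenKV of 'I_n.
Arguments GenU {n}. Arguments GenK {n}. Arguments GenKV {n}.
HB.instance Definition _ n := gen_eqMixin (nUgen n).
HB.instance Definition _ n := gen_choiceMixin (nUgen n).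

Section NumericUq.
Variables (R : realType) (n : nat).
Local Notation C := R[i].
Local Notation T := (free_alg C (nUgen n)).
Variable q : C.

Let h i : T := gen (GenU (GenH i)).
Let e i : T := gen (GenU (GenE i)).
Let f i : T := gen (GenU (GenF i)).
Let k i : T := gen (GenK i).
Let kV i : T := gen (GenKV i).

Inductive nU_rel : T -> Prop :=
| nU_Uq x :
    Uq_rel q q^-1 h e f (fun i => (q - q^-1)^-1 *: (k i - kV i)) x -> nU_rel x
| nU_kkV i : nU_rel (k i * kV i - 1)
| nU_kVk i : nU_rel (kV i * k i - 1)
| nU_kk i j : nU_rel (comm (k i) (k j))
| nU_kh i j : nU_rel (comm (k i) (h j))
| nU_ke i j : nU_rel (k i * e j - (q ^ cartan i j) *: (e j * k i))
| nU_kf i j : nU_rel (k i * f j - (q ^ (- cartan i j)) *: (f j * k i)).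

Definition nU_ideal : ideal T := ideal_gen nU_rel.

Definition nU : Type := quot_alg nU_ideal.
HB.instance Definition _ := GRing.PzRing.on nU.
HB.instance Definition _ := GRing.Lmodule.on nU.

Definition nU_h (i : 'I_n) : nU := cl nU_ideal (h i).
Definition nU_e (i : 'I_n) : nU := cl nU_ideal (e i).
Definition nU_f (i : 'I_n) : nU := cl nU_ideal (f i).
Definition nU_k (i : 'I_n) : nU := cl nU_ideal (k i).
Definition nU_kV (i : 'I_n) : nU := cl nU_ideal (kV i).

End NumericUq.

(* A square root such as sqrt [p - N] is not a polynomial or a power series in
  a_i^+, a_i^-: functions of (N_1, ..., N_n) are adjoined as further generators
  [GenFn F], for all functions F on C^n with values in the scalars K (where
  K = C[[h]] or K = C), with their pointwise operations, with N_i = a_i^+ a_i^-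
  as coordinate functions, and with the shift rule
  F(N) a_j^± = a_j^± F(N_1 ± delta_1j, ..., N_n ± delta_nj). *)

Inductive Wgen (n : nat) (C K : Type) : Type :=
  GenAp of 'I_n | GenAm of 'I_n | GenFn of (('I_n -> C) -> K).
Arguments GenAp {n C K}. Arguments GenAm {n C K}. Arguments GenFn {n C K}.
HB.instance Definition _ n C K := gen_eqMixin (Wgen n C K).
HB.instance Definition _ n C K := gen_choiceMixin (Wgen n C K).

Section WeylRelations.
Variables (C K : nzRingType) (iota : C -> K) (n : nat) (T : lalgType K).
Variables (ap am : 'I_n -> T) (fn : (('I_n -> C) -> K) -> T).

Definition shift (j : 'I_n) (c : C) (x : 'I_n -> C) : 'I_n -> C :=
  fun i => x i + c *+ (i == j).

(* [iota] embeds the complex constants into K. *)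
Inductive Weyl_rel : T -> Prop :=
| W_mp i j : Weyl_rel (comm (am i) (ap j) - 1 *+ (i == j))
| W_pp i j : Weyl_rel (comm (ap i) (ap j))
| W_mm i j : Weyl_rel (comm (am i) (am j))
| W_const c : Weyl_rel (fn (fun=> c) - c%:A)
| W_add F G : Weyl_rel (fn (fun x => F x + G x) - (fn F + fn G))
| W_mul F G : Weyl_rel (fn (fun x => F x * G x) - fn F * fn G)
| W_num i : Weyl_rel (fn (fun x => iota (x i)) - ap i * am i)
| W_fp F j : Weyl_rel (fn F * ap j - ap j * fn (fun x => F (shift j 1 x)))
| W_fm F j : Weyl_rel (fn F * am j - am j * fn (fun x => F (shift j (-1) x))).

End WeylRelations.

Section FormalWeyl.
Variables (R : realType) (n : nat).
Local Notation C := R[i].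
Local Notation T := (fps (free_alg C (Wgen n C (fps C)))).

Definition hW_rel : set T :=
  Weyl_rel (@fpsC C) (fun i => fpsC (gen (GenAp i)))
    (fun i => fpsC (gen (GenAm i))) (fun F => fpsC (gen (GenFn F))).

Definition hW_ideal : ideal T := closed_ideal_gen hW_rel.

Definition hW : Type := quot_alg hW_ideal.
HB.instance Definition _ := GRing.PzRing.on hW.
HB.instance Definition _ := GRing.Lmodule.on hW.

Definition hW_ap (i : 'I_n) : hW := cl hW_ideal (fpsC (gen (GenAp i))).
Definition hW_am (i : 'I_n) : hW := cl hW_ideal (fpsC (gen (GenAm i))).
Definition hW_fn (F : ('I_n -> C) -> fps C) : hW :=
  cl hW_ideal (fpsC (gen (GenFn F))).

End FormalWeyl.

Section NumericWeyl.
Variables (R : realType) (n : nat).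
Local Notation C := R[i].
Local Notation T := (free_alg C (Wgen n C C)).

Definition nW_rel : set T :=
  Weyl_rel id (fun i => gen (GenAp i)) (fun i => gen (GenAm i))
    (fun F => gen (GenFn F)).

Definition nW_ideal : ideal T := ideal_gen nW_rel.

Definition nW : Type := quot_alg nW_ideal.
HB.instance Definition _ := GRing.PzRing.on nW.
HB.instance Definition _ := GRing.Lmodule.on nW.

Definition nW_ap (i : 'I_n) : nW := cl nW_ideal (gen (GenAp i)).
Definition nW_am (i : 'I_n) : nW := cl nW_ideal (gen (GenAm i)).
Definition nW_fn (F : ('I_n -> C) -> C) : nW := cl nW_ideal (gen (GenFn F)).

End NumericWeyl.

Definition alg_morphism (K : nzRingType) (A B : lalgType K) (I : ideal A) (J : ideal B)
    (pi : quot_alg I -> quot_alg J) : Prop :=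
  linear pi /\ monoid_morphism pi.

(* [alpha] and [beta] are the functions x |-> sqrt ([x]/x) and x |-> sqrt [x].
   The square root of a product is the product of the square roots: with
   independent branches for the products, the relations would only hold up to
   signs. *)
Definition HP_on_generators (C K : nzRingType) (n : nat) (U : Type) (W : pzRingType)
    (h e f : 'I_n -> U) (ap am : 'I_n -> W) (fn : (('I_n -> C) -> K) -> W)
    (p : C) (pW : W) (alpha beta : C -> K) (pi : U -> W) : Prop :=
  let N i := ap i * am i in
  [/\ forall i : 'I_n, i = 0 :> nat -> pi (h i) = pW - \sum_j N j - N i,
      forall i j : 'I_n, i = j.+1 :> nat -> pi (h i) = N j - N i &
   [/\ forall i : 'I_n, i = 0 :> nat ->
         pi (e i) = fn (fun x => alpha (x i + 1) * beta (p - \sum_j x j)) * am i,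
       forall i j : 'I_n, i = j.+1 :> nat ->
         pi (e i) = fn (fun x => alpha (x j) * alpha (x i + 1)) * (am i * ap j),
       forall i : 'I_n, i = 0 :> nat ->
         pi (f i) = fn (fun x => alpha (x i) * beta (p - \sum_j x j + 1)) * ap i &
       forall i j : 'I_n, i = j.+1 :> nat ->
         pi (f i) = fn (fun x => alpha (x j + 1) * alpha (x i)) * (ap i * am j)]].

Definition hHP (R : realType) (n : nat) (p : R[i]) (alpha beta : R[i] -> fps R[i])
    (pi : hU R n -> hW R n) : Prop :=
  alg_morphism pi /\
  HP_on_generators (@hU_h R n) (@hU_e R n) (@hU_f R n)
    (@hW_ap R n) (@hW_am R n) (@hW_fn R n) p (fpsC p *: (1 : hW R n)) alpha beta pi.

Definition nHP (R : realType) (n : nat) (h : R[i]) (p : R[i]) (alpha beta : R[i] -> R[i])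
    (pi : nU n (n_q h) -> nW R n) : Prop :=
  [/\ alg_morphism pi,
      HP_on_generators (nU_h (n_q h)) (nU_e (n_q h)) (nU_f (n_q h))
        (@nW_ap R n) (@nW_am R n) (@nW_fn R n) p (p *: (1 : nW R n)) alpha beta pi,
      forall i : 'I_n, i = 0 :> nat ->
        pi (nU_k (n_q h) i) = nW_fn (fun x => n_qpow h (p - \sum_j x j - x i)) /\
        pi (nU_kV (n_q h) i) = nW_fn (fun x => n_qpow h (- (p - \sum_j x j - x i))) &
      forall i j : 'I_n, i = j.+1 :> nat ->
        pi (nU_k (n_q h) i) = nW_fn (fun x => n_qpow h (x j - x i)) /\
        pi (nU_kV (n_q h) i) = nW_fn (fun x => n_qpow h (- (x j - x i)))].

Definition representation (K : nzRingType) (A : lalgType K) (I : ideal A)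
    (V : lmodType K) (act : quot_alg I -> V -> V) : Prop :=
  [/\ forall v, linear (act^~ v), forall a, linear (act a), act 1 =1 id &
      forall a b v, act (a * b) v = act a (act b v)].

Section Submodules.
Variables (K : nzRingType) (V : lmodType K).

Definition submodule (M : set V) : Prop :=
  M 0 /\ forall (c : K) x y, M x -> M y -> M (c *: x + y).

Definition span (B : set V) : set V :=
  [set v | forall M, submodule M -> B `<=` M -> M v].

Definition finitely_spanned (M : set V) : Prop :=
  exists s : seq V, M = span [set` s].

Definition is_invariant (U : Type) (act : U -> V -> V) (M : set V) : Prop :=
  forall u v, M v -> M (act u v).

Definition is_irreducible (U : Type) (act : U -> V -> V) (S : set V) : Prop :=
  (exists2 v, S v & v != 0) /\
  forall M, submodule M -> M `<=` S -> is_invariant act M -> M = [set 0] \/ M = S.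

End Submodules.

(* Over C[[h]], a nonzero invariant submodule S always contains the proper one
   h S. Irreducibility is understood up to C[[h]]-torsion, i.e., over the field
   of fractions C((h)): only the submodules M such that S / M is torsion-free
   are considered. *)
Definition h_irreducible (R : realType) (V : lmodType R[i]) (U : Type)
    (act : U -> fps V -> fps V) (S : set (fps V)) : Prop :=
  (exists2 v, S v & v != 0) /\
  forall M, submodule M -> M `<=` S -> is_invariant act M ->
    (forall (c : fps R[i]) v, S v -> c != 0 -> M (c *: v) -> M v) ->
    M = [set 0] \/ M = S.

Definition occ (n : nat) : choiceType := {ffun 'I_n -> nat}.

Section Fock.
Variables (R : realType) (n : nat).
Local Notation C := R[i].

Definition fock : lmodType C := malg (occ n) C.

Definition ket (l : occ n) : fock := mkmalgU l 1.

(* antilinear in the first argument; the vectors [ket l] are orthonormal *)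
Definition fock_dot (x y : fock) : C :=
  \sum_(l <- msupp x) (mcoeff l x)^* * mcoeff l y.

Definition fock0 (P : nat) : set fock :=
  span [set v | exists2 l : occ n, (\sum_i l i <= P)%N & v = ket l].
Definition fock1 (P : nat) : set fock :=
  span [set v | exists2 l : occ n, (P < \sum_i l i)%N & v = ket l].

(* M[[h]], for a subspace M of the Fock space *)
Definition h_ext (M : set fock) : set (fps fock) := [set v | forall m, M (v m)].

Section FockRep.
Variables (K : nzRingType) (A : lalgType K) (I : ideal A) (V : lmodType K).
Variables (iota : C -> K) (vec : occ n -> V).
Variables (ap am : 'I_n -> quot_alg I) (fn : (('I_n -> C) -> K) -> quot_alg I).

Definition fock_representation (act : quot_alg I -> V -> V) : Prop :=
  [/\ representation act,
      forall i, act (am i) (vec [ffun=> 0%N]) = 0,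
      forall l, vec l =
        iota (sqrtC (\prod_i (l i)`!%:R))^-1 *:
          act (\prod_i ap i ^+ l i) (vec [ffun=> 0%N]) &
      forall F l, act (fn F) (vec l) = F (fun i => (l i)%:R) *: vec l].

End FockRep.

Definition h_fock_rep (act : hW R n -> fps fock -> fps fock) : Prop :=
  fock_representation (@fpsC C) (fun l => fpsC (ket l))
    (@hW_ap R n) (@hW_am R n) (@hW_fn R n) act.

Definition n_fock_rep (act : nW R n -> fock -> fock) : Prop :=
  fock_representation id ket (@nW_ap R n) (@nW_am R n) (@nW_fn R n) act.

Definition is_omega (q : C) (omega : nU n q -> nU n q) : Prop :=
  [/\ forall c u v, omega (c *: u + v) = c^* *: omega u + omega v,
      forall u v, omega (u * v) = omega v * omega u,
      omega 1 = 1,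
      involutive omega &
      forall i, [/\ omega (nU_h q i) = nU_h q i,
                    omega (nU_e q i) = nU_f q i,
                    omega (nU_k q i) = nU_k q i &
                    omega (nU_kV q i) = nU_kV q i]].

Definition unitarizable (q : C) (omega : nU n q -> nU n q)
    (act : nU n q -> fock -> fock) (S : set fock) : Prop :=
  forall u x y, S x -> S y -> fock_dot (act u x) y = fock_dot x (act (omega u) y).

End Fock.

(* Main.v *)
(* Put alpha(x)^2 = [x]/x and let b_i^- = alpha(N_i + 1) a_i^-, b_i^+ = alpha(N_i) a_i^+. These are
   q-bosons: b_i^- b_i^+ = [N_i + 1], b_i^+ b_i^- = [N_i], and operators with different indices
   commute. For i > 1 one has pi(e_i) = b_i^- b_{i-1}^+ and pi(f_i) = b_i^+ b_{i-1}^-, while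
   pi(e_1) = g b_1^- and pi(f_1) = b_1^+ g with g^2 = [p - N]. Moving the functions of the N_i to one
   side, the Serre relations become [x + 2] + [x] = (q + q^-1) [x + 1], and the relation for
   [e_i, f_i] becomes [a + 1] [b] - [a] [b + 1] = [b - a]. In the formal setting pi is first defined
   on series over the free algebra, where its kernel is a closed ideal because W(n) is a quotient by
   one; closedness also makes the series [pi(h_i)] a function of the N_i.

   On the Fock space e_i and f_i have the same matrix coefficient c_i(l) between the states l and
   e_i l. It contains [p - N + 1]^(1/2), which vanishes exactly between the levels P and P + 1 of N
   when p = P, so both subspaces are invariant. The weights separate the states, hence a nonzero
   submodule of F_0 contains a basis vector (or a multiple of it by a power series, in the formal
   setting); the e_i bring it down to the vacuum and the f_i lead from there to every other basis
   vector. For q > 0 the numbers [m] are nonnegative, so the c_i(l) are real and e_i, f_i are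
   adjoint. *)

From HB Require Import structures.
Require Import Defs.
From mathcomp Require Import all_boot all_order all_algebra.
From mathcomp Require Import boolp classical_sets reals exp trigo complex.
From mathcomp Require Import generic_quotient ring_quotient.
From mathcomp Require Import -(notations) finmap monalg.
From mathcomp Require Import ring.

Set Implicit Arguments.
Unset Strict Implicit.
Unset Printing Implicit Defensive.

Import Order.TTheory GRing.Theory Num.Theory.
Local Open Scope ring_scope.

(** * Power series and quotient algebras *)

(** No basis of [hU] or [hW] is available: both are known by generators and relations only. A map
    out of them is therefore built on the free algebra and shown to kill the relations, and the Fock
    action of [hW] arises in this way too, from operators on the Fock space. In C[[h]] the element q
    - q^-1 is not invertible, so identities between q-numbers are proved after multiplication by it,
    which integrality then cancels. Moreover the elements of the algebras are classes of series, not
    of polynomials in the generators, and each passage from words to series needs h-adic continuity.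
    For pi and the action it is automatic: a C[[h]]-linear map commutes with h^m, hence respects
    congruences modulo h^m. The statements on representations concern every pi and every action with
    the prescribed properties, so the matrix coefficients are derived from these properties alone.
    One computation over a commutative ring K with a morphism iota from C serves both settings. All
    that is used of alpha and beta follows from their squares, whence the freedom in the choice of
    branches. *)

Section ConstAdd.
Variable V : zmodType.

Lemma fpsC_is_additive : additive (@fpsC V).
Proof. by move=> x y; apply: fpsP => -[|m] //=; rewrite subr0. Qed.
HB.instance Definition _ := GRing.isAdditive.Build V (fps V) (@fpsC V) fpsC_is_additive.

End ConstAdd.

Section Adic.
Variables (K : comNzRingType) (V : lmodType K).
Implicit Types (c : fps K) (s t v : fps V).

Definition fpsX : fps K := Fps (fun m => (m == 1%N)%:R).
Definition fps_tail m v : fps V := Fps (fun k => v (m + k)%N).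

Lemma fpsZE c v m : (c *: v) m = \sum_(i < m.+1) c i *: v (m - i)%N.
Proof. by []. Qed.

Lemma fpsC_scale a v m : (fpsC a *: v) m = a *: v m.
Proof.
by rewrite fpsZE big_ord_recl big1 /= ?addr0 ?subn0 // => i _; rewrite scale0r.
Qed.

Lemma fpsCZ a (x : V) : fpsC (a *: x) = fpsC a *: fpsC x.
Proof. by apply: fpsP => m; rewrite fpsC_scale /=; case: eqP; rewrite ?scaler0. Qed.

Lemma fpsZC (c : fps K) (x : V) m : (c *: fpsC x) m = c m *: x.
Proof.
rewrite fpsZE big_ord_recr subnn /= big1 ?add0r // => i _.
by rewrite /= subn_eq0 leqNgt ltn_ord scaler0.
Qed.

Lemma fpsC_nz (x : V) : x != 0 -> fpsC x != 0.
Proof. by apply: contra_neq => /(congr1 (fun s : fps V => s 0%N)). Qed.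

Lemma fpsXZE v m : (fpsX *: v) m = if m is m'.+1 then v m' else 0.
Proof.
case: m => [|m]; rewrite fpsZE big_ord_recl scale0r add0r ?big_ord0 //.
by rewrite big_ord_recl scale1r /= subn1 big1 ?addr0 // => i _; rewrite scale0r.
Qed.

Lemma fpsXnZE m v k : (fpsX ^+ m *: v) k = if (k < m)%N then 0 else v (k - m)%N.
Proof.
elim: m k => [|m IH] k; first by rewrite scale1r subn0.
by rewrite exprS -scalerA fpsXZE; case: k.
Qed.

(** Taylor expansion with remainder: modulo h^m a series is a finite combination of constants, to
    which linearity applies. *)
Lemma fps_split m v :
  v = \sum_(k < m) fpsX ^+ k *: fpsC (v k) + fpsX ^+ m *: fps_tail m v.
Proof.
apply: fpsP => k; rewrite fpsDE fps_sumE fpsXnZE.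
have [km|mk] := ltnP k m.
  rewrite addr0 (bigD1 (Ordinal km)) // fpsXnZE ltnn subnn -[LHS]addr0; congr (_ + _).
  rewrite big1 // => i ik.
  rewrite fpsXnZE; case: ifP => // /negbT; rewrite -leqNgt => ki /=.
  by case: eqP => // /eqP; rewrite subn_eq0 => ki'; case/eqP: ik; apply/val_inj/anti_leq/andP.
rewrite [fps_coef (fps_tail _ _) _]/= subnKC // big1 ?add0r // => i _; rewrite fpsXnZE.
case: ifP => // _ /=; case: eqP => // /eqP; rewrite subn_eq0 => ki.
by move: (ltn_ord i); rewrite ltnNge (leq_trans mk ki).
Qed.

(** The h-adic topology is separated; equalities of series are proved modulo every power of h. *)
Lemma fps_adic s t : (forall m, exists r, s = t + fpsX ^+ m *: r) -> s = t.
Proof.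
move=> st; apply: fpsP => m; have [r ->] := st m.+1.
by rewrite fpsDE fpsXnZE ltnSn addr0.
Qed.

End Adic.

HB.instance Definition _ (K : comNzRingType) (X : choiceType) := GRing.NzRing.on (free_alg K X).

Section Algebras.

(** The scalar c acts as c times the empty word, and this element is central, as one sees on
    monomials. *)
Fact free_scaleAr (K : comNzRingType) (X : choiceType) (c : K) (x y : free_alg K X) :
  c *: (x * y) = x * (c *: y).
Proof.
suff E (z : free_alg K X) : c *: z = z * c%:A.
  by rewrite (E (x * y)) (E y) mulrA.
rewrite [in LHS](monalgE z) [in RHS](monalgE z) scaler_sumr mulr_suml.
apply: eq_bigr => k _; rewrite -[c *: mkmalgU _ _]mul_malgC -[c *: 1]mul_malgC mulr1.
by rewrite !malgM_def !fgmulUU mul1m mulm1 mulrC.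
Qed.

HB.instance Definition _ (K : comNzRingType) (X : choiceType) :=
  GRing.Lalgebra_isAlgebra.Build K (free_alg K X) (@free_scaleAr K X).

Variables (K : comNzRingType) (A : algType K).

Fact fps_scaleAr (c : fps K) (s t : fps A) : c *: (s * t) = s * (c *: t).
Proof.
rewrite scalerAl; apply: fpsP => m.
(* Associativity for s, c, t in this order, with c_j s_i as the product of s_i and c_j; its
   convolution is that of c and s read backwards. *)
rewrite [RHS](cauchyA (f := *%R) (g := *:%R) (f' := *%R) (g' := fun x a => a *: x)).
- apply: eq_bigr => k _; congr (_ * _).
  rewrite fpsZE (reindex_inj rev_ord_inj) /=; apply: eq_bigr => i _.
  by rewrite subSS subKn // -ltnS.
- exact: mulr0.
- by move=> x y z; rewrite mulrDr.
- exact: mul0r.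
- by move=> x y z; rewrite mulrDl.
- by move=> x a y; rewrite -scalerAr scalerAl.
Qed.

HB.instance Definition _ := GRing.Lalgebra_isAlgebra.Build (fps K) (fps A) fps_scaleAr.

End Algebras.

Section Const.
Variable A : nzRingType.

Lemma fpsCM : {morph @fpsC A : x y / x * y}.
Proof.
move=> x y; apply: fpsP => m; rewrite fpsME big_ord_recl big1 ?addr0; last first.
  by move=> i _; rewrite mul0r.
by rewrite subn0 /=; case: eqP; rewrite ?mulr0.
Qed.

Lemma fpsC1 : @fpsC A 1 = 1. Proof. by []. Qed.

HB.instance Definition _ := GRing.isMonoidMorphism.Build A (fps A) (@fpsC A) (conj fpsC1 fpsCM).

End Const.

(** An additive map that commutes with h is h-adically continuous, and the polynomials in h are
    dense; so the constants decide. *)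
Lemma fps_dense (K : comNzRingType) (V W : lmodType K) (F G : fps V -> fps W) :
  additive F -> additive G ->
  (forall s, F (fpsX K *: s) = fpsX K *: F s) ->
  (forall s, G (fpsX K *: s) = fpsX K *: G s) ->
  (forall x, F (fpsC x) = G (fpsC x)) -> F =1 G.
Proof.
move=> FB GB FX GX FG s; apply: (@fps_adic K) => m.
pose D s := F s - G s.
have DB : additive D.
  by move=> x y; rewrite /D FB GB !opprB [G y - G x]addrC addrACA [- F y + _]addrC.
pose D' : {additive fps V -> fps W} := HB.pack D (GRing.isAdditive.Build _ _ D DB).
have DX k t : D' (fpsX K ^+ k *: t) = fpsX K ^+ k *: D' t.
  elim: k => [|k IH]; first by rewrite !scale1r.
  by rewrite exprS -!scalerA -IH /= /D FX GX scalerBr.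
(* In the expansion of s the first m terms are killed by F - G, which leaves h^m times the value at
   the tail. *)
exists (D' (fps_tail m s)); rewrite -DX.
apply/eqP; rewrite addrC -subr_eq; apply/eqP; rewrite -[LHS]/(D' s).
rewrite {1}(fps_split m s) raddfD raddf_sum big1 ?add0r // => k _.
by rewrite DX /= /D FG subrr scaler0.
Qed.

Section Ext.
Variables (K : comNzRingType) (A B : algType K) (phi : A -> fps B).
Hypothesis phi_lin : forall a x y, phi (a *: x + y) = fpsC a *: phi x + phi y.
Hypothesis phi_mul : monoid_morphism phi.

(** The extension of phi by continuity: the sum of the h^i s_i goes to the sum of the h^i phi(s_i),
    whose coefficients are finite sums. *)
Definition fps_ext (s : fps A) : fps B := Fps (fun m => \sum_(i < m.+1) phi (s i) (m - i)%N).

Let phiD x y : phi (x + y) = phi x + phi y.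
Proof. by rewrite -[x]scale1r phi_lin fpsC1 !scale1r. Qed.

Let phi0 : phi 0 = 0.
Proof. by apply: (@addrI _ (phi 0)); rewrite -phiD !addr0. Qed.

Lemma fps_ext_is_additive : additive fps_ext.
Proof.
move=> s t; apply: fpsP => m; rewrite fpsDE fpsNE /= -sumrB; apply: eq_bigr => i _.
have phiB : phi (s i - t i) = phi (s i) - phi (t i) by apply/eqP; rewrite eq_sym subr_eq -phiD subrK.
by rewrite -[RHS]/((phi (s i) - phi (t i)) (m - i)%N) -phiB.
Qed.
HB.instance Definition _ := GRing.isAdditive.Build (fps A) (fps B) fps_ext fps_ext_is_additive.

Let fps_extE s m : fps_ext s m = \sum_(i < m.+1) phi (s i) (m - i)%N. Proof. by []. Qed.

Lemma fps_extC a : fps_ext (fpsC a) = phi a.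
Proof.
apply: fpsP => m /=; rewrite big_ord_recl subn0 big1 ?addr0 // => i _.
by rewrite /= phi0.
Qed.

Let extX s : fps_ext (fpsX K *: s) = fpsX K *: fps_ext s.
Proof.
apply: fpsP => -[|m]; rewrite [RHS]fpsXZE fps_extE.
  by rewrite big_ord1 fpsXZE phi0.
rewrite big_ord_recl fpsXZE phi0 add0r; apply: eq_bigr => i _.
by rewrite lift0 subSS fpsXZE.
Qed.

(** Density is applied in c and then in s, which leaves a constant scalar and a constant series,
    where [phi_lin] decides. Multiplicativity is obtained in the same way, from two constant
    factors. *)
Lemma fps_ext_scale (c : fps K) s : fps_ext (c *: s) = c *: fps_ext s.
Proof.
apply: (@fps_dense K K^o B (fun c => fps_ext (c *: s)) (fun c => c *: fps_ext s)) c.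
- by move=> c d; rewrite scalerBl raddfB.
- by move=> c d; rewrite scalerBl.
- by move=> c; rewrite -scalerA extX.
- by move=> c; rewrite -scalerA.
move=> a.
apply: (@fps_dense K A B (fun s => fps_ext (fpsC a *: s)) (fun s => fpsC a *: fps_ext s)) s.
- by move=> c d; rewrite scalerBr raddfB.
- by move=> c d; rewrite raddfB scalerBr.
- by move=> c; rewrite scalerA mulrC -scalerA extX.
- by move=> c; rewrite extX !scalerA mulrC.
by move=> x; rewrite -fpsCZ !fps_extC -[a *: x]addr0 phi_lin phi0 addr0.
Qed.

Lemma fps_ext_is_monoid_morphism : monoid_morphism fps_ext.
Proof.
split=> [|s t]; first by rewrite -fpsC1 fps_extC phi_mul.1.
apply: (@fps_dense K A B (fun s => fps_ext (s * t)) (fun s => fps_ext s * fps_ext t)) s.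
- by move=> c d; rewrite mulrBl raddfB.
- by move=> c d; rewrite raddfB mulrBl.
- by move=> c; rewrite -scalerAl extX.
- by move=> c; rewrite extX scalerAl.
move=> x.
apply: (@fps_dense K A B (fun t => fps_ext (fpsC x * t)) (fun t => fps_ext (fpsC x) * fps_ext t)) t.
- by move=> c d; rewrite mulrBr raddfB.
- by move=> c d; rewrite raddfB mulrBr.
- by move=> c; rewrite -scalerAr extX.
- by move=> c; rewrite extX scalerAr.
by move=> y; rewrite -fpsCM !fps_extC phi_mul.2.
Qed.

(** Continuity in quantitative form; it is the source of the closedness of kernels. *)
Lemma fps_ext_local (s t : fps A) m :
  (forall k, (k < m)%N -> s k = t k) -> forall k, (k < m)%N -> fps_ext s k = fps_ext t k.
Proof.
move=> st k km; apply: eq_bigr => i _; rewrite st //.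
by rewrite (leq_trans _ km) ?ltn_ord.
Qed.

End Ext.

Section FreeLift.
Variables (K : comNzRingType) (X : choiceType) (S : nzRingType).
Variables (sigma : {rmorphism K -> S}) (f : X -> S).
Hypothesis sigmaC : forall c s, GRing.comm (sigma c) s.

(** Universal property of the free algebra, relative to a morphism sigma from K to the centre of S.
    As S need not be a K-algebra, this covers series over C[[h]] and, in a converse ring, conjugated
    scalars. *)
Definition free_lift : free_alg K X -> S :=
  mmap sigma (fun m : fmonom X => \prod_(x <- fmonom_val m) f x).

Lemma free_lift_is_additive : additive free_lift.
Proof. exact: mmap_is_additive. Qed.
HB.instance Definition _ := GRing.isAdditive.Build (free_alg K X) S free_lift free_lift_is_additive.

Lemma free_liftZ c x : free_lift (c *: x) = sigma c * free_lift x.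
Proof.
rewrite /free_lift (mmapEw (msuppZ_le _ _)) mmapE big_distrr /=.
by apply/eq_bigr=> k _; rewrite mcoeffZ rmorphM mulrA.
Qed.

Lemma free_lift_gen x : free_lift (gen x) = f x.
Proof. by rewrite /free_lift mmapU /= rmorph1 mul1r fmuE /= big_seq1. Qed.

Lemma free_lift_is_monoid_morphism : monoid_morphism free_lift.
Proof.
split=> [|x y]; first by rewrite /free_lift mmapU /= rmorph1 mul1r fm1 big_nil.
rewrite malgME raddf_sum mulr_suml /=; apply: eq_bigr=> i _.
rewrite raddf_sum mulr_sumr /=; apply: eq_bigr=> j _.
rewrite /free_lift mmapU /= rmorphM fmM big_cat /= !mulrA; congr (_ * _).
by rewrite -!mulrA; congr (_ * _); apply: sigmaC.
Qed.

End FreeLift.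

Section Quot.
Variables (K : nzRingType) (A : lalgType K) (I : ideal A).

Lemma cl_is_monoid_morphism : monoid_morphism (cl I).
Proof. by split=> // x y; rewrite -cl_mul. Qed.
HB.instance Definition _ := GRing.isMonoidMorphism.Build A (quot_alg I) (cl I) cl_is_monoid_morphism.

Lemma clZ a x : cl I (a *: x) = a *: cl I x.
Proof. by rewrite -cl_scale. Qed.

Lemma cl0 x : I x -> cl I x = 0.
Proof. by move=> Ix; rewrite -(raddf0 (cl I)); apply/clP/asboolP; rewrite subr0. Qed.

Lemma cl_eq0 x : cl I x = 0 -> I x.
Proof. by rewrite -(raddf0 (cl I)) => /clP/asboolP; rewrite subr0. Qed.

Lemma quot_scaleAl a (x y : quot_alg I) : a *: (x * y) = (a *: x) * y.
Proof.
elim/cl_ind: x => x; elim/cl_ind: y => y.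
by rewrite -rmorphM -!clZ -rmorphM scalerAl.
Qed.

(** Psi is evaluated at a chosen representative, so the definition makes sense for every Psi; it is
    the factorization of Psi once Psi kills I. *)
Definition quot_fact (Z : Type) (Psi : A -> Z) : quot_alg I -> Z :=
  fun q => Psi (repr (q : Quotient.quot (ideal_pred I))).

Lemma quot_factE (Z : zmodType) (Psi : {additive A -> Z}) x :
  (forall x, I x -> Psi x = 0) -> quot_fact Psi (cl I x) = Psi x.
Proof.
move=> PsiI; apply/eqP; rewrite -subr_eq0 -raddfB PsiI //.
by apply: cl_eq0; rewrite raddfB /= cl_repr subrr.
Qed.

End Quot.

Lemma quot_scaleAr (K : comNzRingType) (A : algType K) (I : ideal A) a (x y : quot_alg I) :
  a *: (x * y) = x * (a *: y).
Proof.
elim/cl_ind: x => x; elim/cl_ind: y => y.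
by rewrite -rmorphM -!clZ -rmorphM scalerAr.
Qed.

Lemma ideal_gen_sub (A : nzRingType) (r : set A) x : r x -> ideal_gen r x.
Proof. by move=> rx I _; apply. Qed.

Lemma closed_ideal_gen_sub (A : nzRingType) (r : set (fps A)) x : r x -> closed_ideal_gen r x.
Proof. by move=> rx I _ _; apply. Qed.

Lemma closed_ideal_gen_closed (A : nzRingType) (r : set (fps A)) : h_closed (closed_ideal_gen r).
Proof.
move=> x xP I II cI rI; apply: (cI) => m; have [y yr xy] := xP m.
by exists y => //; apply: yr.
Qed.

Lemma kernel_ideal (A : nzRingType) (B : pzRingType) (F : A -> B) :
  additive F -> monoid_morphism F -> is_ideal [set x | F x = 0]%classic.
Proof.
move=> FB [F1 FM]; have F0 : F 0 = 0 by rewrite -(subrr 0) FB subrr.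
split=> // [x y /= Fx Fy|a x /= Fx]; first by rewrite FB Fx Fy subrr.
by rewrite !FM Fx mulr0 mul0r.
Qed.

(** The generated ideal is the intersection of the ideals containing r, and the kernel of F is one
    of these. In the h-adic version the kernel must be closed as well. *)
Lemma ideal_gen_ker (A : nzRingType) (B : pzRingType) (F : A -> B) (r : set A) :
  additive F -> monoid_morphism F -> (forall x, r x -> F x = 0) ->
  forall x, ideal_gen r x -> F x = 0.
Proof. by move=> FB FM Fr x xr; apply: (xr [set x | F x = 0]%classic) => //; exact: kernel_ideal. Qed.

Lemma closed_ideal_gen_ker (A : nzRingType) (B : pzRingType) (F : fps A -> B) (r : set (fps A)) :
  additive F -> monoid_morphism F -> h_closed [set x | F x = 0]%classic ->
  (forall x, r x -> F x = 0) -> forall x, closed_ideal_gen r x -> F x = 0.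
Proof. by move=> FB FM Fc Fr x xr; apply: (xr [set x | F x = 0]%classic) => //; exact: kernel_ideal. Qed.

(** * Linear maps, submodules and spans *)

Section LinearFun.
Variables (K : comNzRingType) (V W : lmodType K) (G : V -> W).
Hypothesis Glin : linear G.

Lemma lin0 : G 0 = 0.
Proof. by apply: (@addrI _ (G 0)); have := Glin 1 0 0; rewrite !scale1r !addr0. Qed.

Lemma linZ c x : G (c *: x) = c *: G x.
Proof. by rewrite -[c *: x]addr0 Glin lin0 addr0. Qed.

Lemma linD x y : G (x + y) = G x + G y.
Proof. by rewrite -[x]scale1r Glin !scale1r. Qed.

Lemma lin_sum (I : Type) (r : seq I) (F : I -> V) :
  G (\sum_(i <- r) F i) = \sum_(i <- r) G (F i).
Proof.
elim: r => [|a r IH]; first by rewrite !big_nil lin0.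
by rewrite !big_cons linD IH.
Qed.

End LinearFun.

Section Submodules.
Variables (K : comNzRingType) (V : lmodType K).

Lemma submodule0 (M : set V) : submodule M -> M 0.
Proof. by case. Qed.

Lemma submoduleZ (M : set V) c v : submodule M -> M v -> M (c *: v).
Proof. by move=> [M0 MD] Mv; rewrite -[_ *: _]addr0; apply: MD. Qed.

Lemma submoduleD (M : set V) u v : submodule M -> M u -> M v -> M (u + v).
Proof. by move=> [M0 MD] Mu Mv; rewrite -[u]scale1r; apply: MD. Qed.

Lemma submodule_sum (M : set V) (I : eqType) (r : seq I) (F : I -> V) :
  submodule M -> (forall i, i \in r -> M (F i)) -> M (\sum_(i <- r) F i).
Proof.
move=> Ms; elim: r => [|a r IH] MF; first by rewrite big_nil; apply: (submodule0 Ms).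
rewrite big_cons; apply: (submoduleD Ms); first by apply: MF; rewrite mem_head.
by apply: IH => i ir; apply: MF; rewrite inE ir orbT.
Qed.

Lemma span_submodule (B : set V) : submodule (Defs.span B).
Proof.
split=> [M [] //|c x y xB yB M Ms BM].
by case: (Ms) => _; apply; [apply: xB|apply: yB].
Qed.

Lemma span_sub (B : set V) v : B v -> Defs.span B v.
Proof. by move=> Bv M _; apply. Qed.

End Submodules.

(** * The Serre relations from q-bosons *)

Section Shift.
Variables (C : comNzRingType) (n : nat) (p : C).
Implicit Types (x : 'I_n -> C) (i j k : 'I_n).

Lemma shiftK j c x : shift j (- c) (shift j c x) = x.
Proof. by apply: funext => i; rewrite /shift mulNrn addrK. Qed.

Lemma shiftNK j c x : shift j c (shift j (- c) x) = x.
Proof. by apply: funext => i; rewrite /shift mulNrn subrK. Qed.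

Lemma sum_shift j c x : \sum_i shift j c x i = \sum_i x i + c.
Proof.
rewrite /shift big_split /=; congr (_ + _).
rewrite (bigD1 j) //= eqxx big1 ?addr0 // => i /negPf ->.
by rewrite mulr0n.
Qed.

(* [ext x] extends x = (x_1, ..., x_n) by x_0 = p - x_1 - ... - x_n; the weights
   are then x_{i-1} - x_i for all i, as the index i stands for i + 1. *)
Definition ext x (k : nat) : C :=
  if k is k'.+1 then (if insub k' is Some i then x i else 0) else p - \sum_i x i.

Definition weight i x : C := ext x i - x i.

Lemma ext0 i x : i = 0%N :> nat -> ext x i = p - \sum_i x i.
Proof. by rewrite /ext => ->. Qed.

Lemma extS i j x : i = j.+1 :> nat -> ext x i = x j.
Proof. by rewrite /ext => ->; rewrite valK. Qed.

Lemma ord_case i : i = 0%N :> nat \/ exists j, i = j.+1 :> nat.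
Proof.
case: i => [[|k] ki]; first by left.
by right; exists (Ordinal (ltnW ki)).
Qed.

(** The operator e_i carries a quantum from the mode i to the mode before it; for the first i the
    latter is the fictitious x_0 of [ext], which changes by itself with the sum of the x_j. [raise]
    is the opposite move, made by f_i. *)
Definition lower i x : 'I_n -> C :=
  fun j => x j - (j == i)%:R + (j.+1 == i :> nat)%:R.
Definition raise i x : 'I_n -> C :=
  fun j => x j + (j == i)%:R - (j.+1 == i :> nat)%:R.

Lemma lower0 i x : i = 0%N :> nat -> lower i x = shift i (- 1) x.
Proof. by move=> i0; apply: funext => j; rewrite /lower /shift i0 addr0 mulNrn. Qed.

Lemma raise0 i x : i = 0%N :> nat -> raise i x = shift i 1 x.
Proof. by move=> i0; apply: funext => j; rewrite /raise /shift i0 subr0. Qed.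

Lemma lowerS i j x : i = j.+1 :> nat -> lower i x = shift i (- 1) (shift j 1 x).
Proof.
by move=> ij; apply: funext => k; rewrite /lower /shift ij eqSS mulNrn addrAC.
Qed.

Lemma raiseS i j x : i = j.+1 :> nat -> raise i x = shift i 1 (shift j (- 1) x).
Proof.
by move=> ij; apply: funext => k; rewrite /raise /shift ij eqSS mulNrn addrAC.
Qed.

(** With x_0 included, e_1 no longer plays a special role: the mode i (at the place i + 1 of [ext])
    loses a quantum and the place i gains one, for all i alike. *)
Lemma ext_lower i x (k : nat) : (k <= n)%N -> ext (lower i x) k = ext x k + (k == i)%:R - (k == i.+1)%:R.
Proof.
case: k => [|k] kn /=.
  rewrite subr0; have [i0|[j ij]] := ord_case i.
    by rewrite lower0 // sum_shift i0 eqxx opprD opprK addrA.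
  by rewrite (lowerS _ ij) !sum_shift addrK ij addr0.
case: insubP => [j _ jk|]; last by rewrite kn.
by rewrite /lower -jk eqSS -addrA [- _ + _]addrC addrA.
Qed.

Lemma ext_raise i x (k : nat) : (k <= n)%N -> ext (raise i x) k = ext x k - (k == i)%:R + (k == i.+1)%:R.
Proof.
case: k => [|k] kn /=.
  rewrite addr0; have [i0|[j ij]] := ord_case i.
    by rewrite raise0 // sum_shift i0 eqxx opprD addrA.
  by rewrite (raiseS _ ij) !sum_shift subrK ij subr0.
case: insubP => [j _ jk|]; last by rewrite kn.
by rewrite /raise -jk eqSS addrAC.
Qed.

Let cartanE i j : (cartan i j)%:~R = 2 * (i == j)%:R - (i.+1 == j :> nat)%:R - (j.+1 == i :> nat)%:R :> C.
Proof. by rewrite /cartan !rmorphB rmorphM. Qed.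

Lemma weight_lower i j x : weight i (lower j x) = weight i x + (cartan i j)%:~R.
Proof.
rewrite /weight ext_lower ?(ltnW (ltn_ord i)) // cartanE /lower [j.+1 == i]eq_sym.
by rewrite -val_eqE /=; ring.
Qed.

Lemma weight_raise i j x : weight i (raise j x) = weight i x - (cartan i j)%:~R.
Proof.
rewrite /weight ext_raise ?(ltnW (ltn_ord i)) // cartanE /raise [j.+1 == i]eq_sym.
by rewrite -val_eqE /=; ring.
Qed.

End Shift.

(** The relations of W(n) as equations in a bare ring, so that the quotients over C[[h]] and over C
    are treated together. Scalars are represented by constant functions, which [wcst] makes
    central. *)
Record weyl_system (C K : nzRingType) (iota : C -> K) (n : nat) (W : pzRingType)
    (ap am : 'I_n -> W) (fn : (('I_n -> C) -> K) -> W) : Prop := WeylSystem {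
  wmp : forall i j, am i * ap j = ap j * am i + 1 *+ (i == j);
  wpp : forall i j, ap i * ap j = ap j * ap i;
  wmm : forall i j, am i * am j = am j * am i;
  wf1 : fn (fun=> 1) = 1;
  wfD : forall F G, fn (fun x => F x + G x) = fn F + fn G;
  wfM : forall F G, fn (fun x => F x * G x) = fn F * fn G;
  wnum : forall i, fn (fun x => iota (x i)) = ap i * am i;
  wcst : forall c w, fn (fun=> c) * w = w * fn (fun=> c);
  wfp : forall F j, fn F * ap j = ap j * fn (fun x => F (shift j 1 x));
  wfm : forall F j, fn F * am j = am j * fn (fun x => F (shift j (-1) x)) }.

(* A Serre relation for b and c is transferred to products: in [serre1] the repeated factor is g b,
   where b moves past g at the price of turning it into g'; in [serre2] it is z b, and g goes with c. *)
Section Serre.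
Variable W : pzRingType.
Implicit Types (g b z c Q : W).

Lemma serre1 g g' b z c Q : (forall w, Q * w = w * Q) ->
  b * g = g' * b -> GRing.comm (z * c) g -> GRing.comm (z * c) g' ->
  GRing.comm z b -> GRing.comm z c ->
  b * b * c + c * b * b = Q * (b * c * b) ->
  let x := g * b in let y := z * c in x * x * y + y * x * x = Q * (x * y * x).
Proof.
move=> QC bg + + zb zc S /=.
set y := z * c => yg yg'; have yE : y = z * c by [].
clearbody y.
have bz w : b * (z * w) = z * (b * w) by rewrite !mulrA zb.
(* Each of the three words equals g g' z times the corresponding word in b, b, c, so the relation
   for b and c is multiplied by g g' z from the left. *)
have -> : g * b * (g * b) * y = g * g' * z * (b * b * c).
  by rewrite yE !mulrA -[g * b * g]mulrA bg -!mulrA !bz.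
have -> : y * (g * b) * (g * b) = g * g' * z * (c * b * b).
  rewrite -!mulrA [y * (g * _)]mulrA yg -!mulrA [b * (g * _)]mulrA bg -!mulrA.
  by rewrite [y * (g' * _)]mulrA yg' yE -!mulrA.
have -> : g * b * y * (g * b) = g * g' * z * (b * c * b).
  rewrite -!mulrA [y * (g * _)]mulrA yg -!mulrA [b * (g * _)]mulrA bg -!mulrA.
  by rewrite yE -!mulrA bz.
by rewrite -mulrDr S mulrA -QC !mulrA.
Qed.

Lemma serre2 g b z c Q : (forall w, Q * w = w * Q) ->
  GRing.comm (z * b) g -> GRing.comm z b -> GRing.comm z c ->
  b * b * c + c * b * b = Q * (b * c * b) ->
  let x := z * b in let y := g * c in x * x * y + y * x * x = Q * (x * y * x).
Proof.
move=> QC + zb zc S /=.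
set x := z * b => xg; have xE : x = z * b by [].
clearbody x.
have bz w : b * (z * w) = z * (b * w) by rewrite !mulrA zb.
have cz w : c * (z * w) = z * (c * w) by rewrite !mulrA zc.
have -> : x * x * (g * c) = g * z * z * (b * b * c).
  rewrite -!mulrA [x * (g * _)]mulrA xg -!mulrA [x * (g * _)]mulrA xg -!mulrA.
  by rewrite xE -!mulrA bz.
have -> : g * c * x * x = g * z * z * (c * b * b).
  by rewrite xE -!mulrA bz !cz.
have -> : x * (g * c) * x = g * z * z * (b * c * b).
  by rewrite -!mulrA [x * (g * _)]mulrA xg xE -!mulrA cz bz.
by rewrite -mulrDr S mulrA -QC !mulrA.
Qed.

End Serre.

(* The Serre relation reads the same in the converse ring, where the f_i have the form of the e_i. *)
Section SerreConverse.
Variable W : pzRingType.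
Implicit Types (g b z c Q : W).

Let conv_serre Q (x y : W) : (forall w, Q * w = w * Q) ->
  ((x : W^c) * x * y + (y : W^c) * x * x = (Q : W^c) * ((x : W^c) * y * x)) <->
  (x * x * y + y * x * x = Q * (x * y * x)).
Proof.
move=> QC; rewrite -[X in X = _ <-> _]/(y * (x * x) + x * (x * y)).
rewrite -[X in _ = X <-> _]/(x * (y * x) * Q).
by rewrite addrC QC !mulrA.
Qed.

Lemma serre1c g g' b z c Q : (forall w, Q * w = w * Q) ->
  g * b = b * g' -> GRing.comm (c * z) g -> GRing.comm (c * z) g' ->
  GRing.comm z b -> GRing.comm z c ->
  b * b * c + c * b * b = Q * (b * c * b) ->
  let x := b * g in let y := c * z in x * x * y + y * x * x = Q * (x * y * x).
Proof.
move=> QC bg yg yg' zb zc S x y; apply/conv_serre => //.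
apply: (@serre1 W^c g g' b z c Q) => // [w|]; first exact/esym/QC.
exact/(conv_serre _ _ QC).
Qed.

Lemma serre2c g b z c Q : (forall w, Q * w = w * Q) ->
  GRing.comm (b * z) g -> GRing.comm z b -> GRing.comm z c ->
  b * b * c + c * b * b = Q * (b * c * b) ->
  let x := b * z in let y := c * g in x * x * y + y * x * x = Q * (x * y * x).
Proof.
move=> QC xg zb zc S x y; apply/conv_serre => //.
apply: (@serre2 W^c g b z c Q) => // [w|]; first exact/esym/QC.
exact/(conv_serre _ _ QC).
Qed.

End SerreConverse.

Section QBosons.
Variables (C K : comNzRingType) (iota : {rmorphism C -> K}) (n : nat) (W : pzRingType).
Variables (ap am : 'I_n -> W) (fn : (('I_n -> C) -> K) -> W).
Hypothesis sys : weyl_system iota ap am fn.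
Variables (p : C) (alpha beta qint : C -> K) (q2 : K).
(** Here [qint] is [x] and [q2] is q + q^-1. Writing alpha(x)^2 x = [x] instead of a quotient makes
    x = 0 no exception. *)
Hypothesis alphaP : forall x, alpha x ^+ 2 * iota x = qint x.
Hypothesis betaP : forall x, beta x ^+ 2 = qint x.
Hypothesis qint_rec : forall x, qint (x + 2) + qint x = q2 * qint (x + 1).
Hypothesis qint_ef : forall a b, qint (a + 1) * qint b - qint a * qint (b + 1) = qint (b - a).
Implicit Types (i j k : 'I_n) (F G : ('I_n -> C) -> K).

Lemma fnC F G : fn F * fn G = fn G * fn F.
Proof. by rewrite -!(wfM sys); congr fn; apply: funext => x; rewrite mulrC. Qed.

Lemma fnB F G : fn (fun x => F x - G x) = fn F - fn G.
Proof.
apply/eqP; rewrite eq_sym subr_eq -(wfD sys); apply/eqP.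
by congr fn; apply: funext => x; rewrite subrK.
Qed.

Lemma ap_fn F j : ap j * fn F = fn (fun x => F (shift j (-1) x)) * ap j.
Proof.
rewrite (wfp sys); congr (_ * fn _).
by apply: funext => x; rewrite shiftK.
Qed.

Lemma am_fn F j : am j * fn F = fn (fun x => F (shift j 1 x)) * am j.
Proof.
rewrite (wfm sys); congr (_ * fn _).
by apply: funext => x; rewrite shiftNK.
Qed.

Definition bm i := fn (fun x => alpha (x i + 1)) * am i.
Definition bp i := fn (fun x => alpha (x i)) * ap i.

Lemma fn_bp F j : fn F * bp j = bp j * fn (fun x => F (shift j 1 x)).
Proof. by rewrite /bp mulrA fnC -!mulrA (wfp sys). Qed.

Lemma fn_bm F j : fn F * bm j = bm j * fn (fun x => F (shift j (-1) x)).
Proof. by rewrite /bm mulrA fnC -!mulrA (wfm sys). Qed.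

Lemma bp_fn F j : bp j * fn F = fn (fun x => F (shift j (-1) x)) * bp j.
Proof. by rewrite /bp -mulrA ap_fn !mulrA fnC. Qed.

Lemma bm_fn F j : bm j * fn F = fn (fun x => F (shift j 1 x)) * bm j.
Proof. by rewrite /bm -mulrA am_fn !mulrA fnC. Qed.

(** With the function on the other side, the ladder operators in b_i^- b_i^+ and b_i^+ b_i^- stand
    next to each other between two equal functions. *)
Lemma bpE i : bp i = ap i * fn (fun x => alpha (x i + 1)).
Proof.
by rewrite /bp (wfp sys); congr (_ * fn _); apply: funext => x; rewrite /shift eqxx.
Qed.

Lemma bmE i : bm i = am i * fn (fun x => alpha (x i)).
Proof.
rewrite /bm (wfm sys); congr (_ * fn _).
by apply: funext => x; rewrite /shift eqxx subrK.
Qed.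

Lemma bm_bp i : bm i * bp i = fn (fun x => qint (x i + 1)).
Proof.
rewrite bpE /bm -mulrA [am i * _]mulrA (wmp sys) eqxx -(wnum sys) -(wf1 sys).
rewrite -(wfD sys) -!(wfM sys); congr fn; apply: funext => x.
by rewrite -alphaP rmorphD rmorph1; ring.
Qed.

Lemma bp_bm i : bp i * bm i = fn (fun x => qint (x i)).
Proof.
rewrite bmE /bp -mulrA [ap i * _]mulrA -(wnum sys).
rewrite -!(wfM sys); congr fn; apply: funext => x.
by rewrite -alphaP; ring.
Qed.

Let fn_ap_comm F j : (forall x, F (shift j 1 x) = F x) -> GRing.comm (fn F) (ap j).
Proof. by move=> FE; rewrite /GRing.comm (wfp sys); congr (_ * fn _); apply: funext. Qed.

Let fn_am_comm F j : (forall x, F (shift j (-1) x) = F x) -> GRing.comm (fn F) (am j).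
Proof. by move=> FE; rewrite /GRing.comm (wfm sys); congr (_ * fn _); apply: funext. Qed.

Let shift_neq i j c (x : 'I_n -> C) : i != j -> shift j c x i = x i.
Proof. by move=> /negPf ij; rewrite /shift ij addr0. Qed.

Let comm4 (a b c d : W) : GRing.comm a c -> GRing.comm a d -> GRing.comm b c ->
  GRing.comm b d -> GRing.comm (a * b) (c * d).
Proof.
move=> ac ad bc bd.
by apply: commrM; apply: commr_sym; apply: commrM; apply: commr_sym.
Qed.

Lemma bm_comm i j : GRing.comm (bm i) (bm j).
Proof.
have [->//|ij] := eqVneq i j.
apply: comm4; first exact: fnC.
- by apply: fn_am_comm => x; rewrite shift_neq.
- by apply: commr_sym; apply: fn_am_comm => x; rewrite shift_neq // eq_sym.
- exact: (wmm sys).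
Qed.

Lemma bp_comm i j : GRing.comm (bp i) (bp j).
Proof.
have [->//|ij] := eqVneq i j.
apply: comm4; first exact: fnC.
- by apply: fn_ap_comm => x; rewrite shift_neq.
- by apply: commr_sym; apply: fn_ap_comm => x; rewrite shift_neq // eq_sym.
- exact: (wpp sys).
Qed.

Lemma bm_bp_comm i j : i != j -> GRing.comm (bm i) (bp j).
Proof.
move=> ij; apply: comm4; first exact: fnC.
- by apply: fn_ap_comm => x; rewrite shift_neq.
- by apply: commr_sym; apply: fn_am_comm => x; rewrite shift_neq // eq_sym.
- by rewrite /GRing.comm (wmp sys) (negPf ij) addr0.
Qed.

Let Q := fn (fun=> q2).

Let QC w : Q * w = w * Q. Proof. exact: (wcst sys). Qed.

Lemma serre_bm i : bm i * bm i * bp i + bp i * bm i * bm i = Q * (bm i * bp i * bm i).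
Proof.
rewrite -mulrA bm_bp bm_fn bp_bm -mulrDl -(wfD sys) mulrA -(wfM sys); congr (fn _ * _).
by apply: funext => x; rewrite /shift eqxx -qint_rec -addrA.
Qed.

Lemma serre_bp i : bp i * bp i * bm i + bm i * bp i * bp i = Q * (bp i * bm i * bp i).
Proof.
rewrite -mulrA bp_bm bp_fn bm_bp -mulrDl -(wfD sys) mulrA -(wfM sys); congr (fn _ * _).
apply: funext => x; rewrite /shift eqxx.
(* Moving a function across b_i^+ shifts its argument down, so the recurrence is taken one place
   lower, between [x - 1], [x] and [x + 1]. *)
have := qint_rec (x i - 1); rewrite subrK (_ : x i - 1 + 2 = x i + 1); last by ring.
by rewrite addrC.
Qed.

Section Generators.
Variables (e f : 'I_n -> W).
Hypothesis e0 : forall i, i = 0%N :> nat ->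
  e i = fn (fun x => alpha (x i + 1) * beta (p - \sum_j x j)) * am i.
Hypothesis eS : forall i j, i = j.+1 :> nat ->
  e i = fn (fun x => alpha (x j) * alpha (x i + 1)) * (am i * ap j).
Hypothesis f0 : forall i, i = 0%N :> nat ->
  f i = fn (fun x => alpha (x i) * beta (p - \sum_j x j + 1)) * ap i.
Hypothesis fS : forall i j, i = j.+1 :> nat ->
  f i = fn (fun x => alpha (x j + 1) * alpha (x i)) * (ap i * am j).

Let g := fn (fun x => beta (p - \sum_j x j)).
Let neqS i j : i = j.+1 :> nat -> i != j.
Proof. by move=> ij; rewrite -val_eqE /= ij gtn_eqF. Qed.

Lemma e0E i : i = 0%N :> nat -> e i = g * bm i.
Proof. by move=> /e0 ->; rewrite (wfM sys) fnC -mulrA. Qed.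

(** Moving the root to the right of b_1^+ turns its argument p - N + 1 into p - N. Then f_1 is the
    mirror image of e_1, as needed for the passage to the converse ring. *)
Lemma f0E i : i = 0%N :> nat -> f i = bp i * g.
Proof.
move=> /f0 ->; rewrite (wfM sys) fnC -mulrA -/(bp i) bp_fn; congr (fn _ * _).
by apply: funext => x; rewrite sum_shift opprD opprK addrA.
Qed.

Lemma eSE i j : i = j.+1 :> nat -> e i = bm i * bp j.
Proof.
move=> ij; rewrite (eS ij) (wfM sys) fnC -mulrA [fn _ * (am i * _)]mulrA.
rewrite fn_am_comm /bm /bp ?mulrA // => x.
by rewrite shift_neq // eq_sym neqS.
Qed.

Lemma fSE i j : i = j.+1 :> nat -> f i = bp i * bm j.
Proof.
move=> ij; rewrite (fS ij) (wfM sys) fnC -mulrA [fn _ * (ap i * _)]mulrA.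
rewrite fn_ap_comm /bm /bp ?mulrA // => x.
by rewrite shift_neq // eq_sym neqS.
Qed.

Lemma fn_e F i : fn F * e i = e i * fn (fun x => F (lower i x)).
Proof.
have [i0|[j ij]] := ord_case i.
  rewrite (e0E i0) mulrA fnC -mulrA fn_bm -[RHS]mulrA; congr (_ * (_ * fn _)).
  by apply: funext => x; rewrite lower0.
rewrite (eSE ij) mulrA fn_bm -mulrA fn_bp mulrA; congr (_ * fn _).
by apply: funext => x; rewrite (lowerS _ ij).
Qed.

Lemma fn_f F i : fn F * f i = f i * fn (fun x => F (raise i x)).
Proof.
have [i0|[j ij]] := ord_case i.
  rewrite (f0E i0) mulrA fn_bp -mulrA fnC -[RHS]mulrA; congr (_ * (_ * fn _)).
  by apply: funext => x; rewrite raise0.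
rewrite (fSE ij) mulrA fn_bp -mulrA fn_bm mulrA; congr (_ * fn _).
by apply: funext => x; rewrite (raiseS _ ij).
Qed.

(** Beyond the first one, the e_j preserve N, of which g is a function. *)
Let g_e j k : j = k.+1 :> nat -> GRing.comm g (e j).
Proof.
move=> jk; rewrite /GRing.comm fn_e; congr (_ * fn _).
by apply: funext => x; rewrite (lowerS _ jk) !sum_shift addrK.
Qed.

Let g_f j k : j = k.+1 :> nat -> GRing.comm g (f j).
Proof.
move=> jk; rewrite /GRing.comm fn_f; congr (_ * fn _).
by apply: funext => x; rewrite (raiseS _ jk) !sum_shift subrK.
Qed.

Let bp_bm_comm i j : i != j -> GRing.comm (bp i) (bm j).
Proof. by move=> ij; apply/commr_sym/bm_bp_comm; rewrite eq_sym. Qed.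

Let neq_pred i j k (l : 'I_n) : i = k.+1 :> nat -> j = l.+1 :> nat -> i != j -> k != l.
Proof. by move=> ik jl; rewrite -!val_eqE /= ik jl. Qed.

Let mulr_swap (b c a d : W) : GRing.comm b c -> a * b * (c * d) = a * c * (b * d).
Proof. by move=> bc; rewrite -!mulrA [b * (c * d)]mulrA bc !mulrA. Qed.

Lemma e_f_comm i j : i != j -> GRing.comm (e i) (f j).
Proof.
move=> ij; have [i0|[k ik]] := ord_case i; have [j0|[l jl]] := ord_case j.
- by case/eqP: ij; apply: val_inj; rewrite /= i0 j0.
- apply: commr_sym; rewrite (e0E i0); apply: commrM; first exact/commr_sym/(g_f jl).
  rewrite (fSE jl); apply: commr_sym; apply: commrM; [exact: bm_bp_comm|exact: bm_comm].
- rewrite (f0E j0); apply: commrM; last exact/commr_sym/(g_e ik).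
  rewrite (eSE ik); apply: commr_sym; apply: commrM; [|exact: bp_comm].
  by apply: bp_bm_comm; rewrite eq_sym.
- rewrite (eSE ik) (fSE jl); apply: comm4;
    [exact: bm_bp_comm|exact: bm_comm|exact: bp_comm|exact/bp_bm_comm/(neq_pred ik jl)].
Qed.

(** Both cases are [qint_ef] at a = N_i and b = N_{i-1}, with N_0 = p - N for the first i: there g^2
    = [N_0] and its shift [N_0 + 1] take the places of b_0^+ b_0^- and b_0^- b_0^+. *)
Lemma e_f_brak i : e i * f i - f i * e i = fn (fun x => qint (weight p i x)).
Proof.
have [i0|[k ik]] := ord_case i.
  have -> : e i * f i = g * (bm i * bp i) * g by rewrite (e0E i0) (f0E i0) !mulrA.
  have -> : f i * e i = bp i * (g * g) * bm i by rewrite (e0E i0) (f0E i0) !mulrA.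
  rewrite bm_bp -!(wfM sys) bp_fn -mulrA bp_bm -(wfM sys) -fnB; congr fn.
  apply: funext => x; rewrite sum_shift opprD opprK addrA mulrAC -!expr2 !betaP.
  by rewrite mulrC -[_ * _ in X in _ - X]mulrC qint_ef /weight ext0.
rewrite (eSE ik) (fSE ik).
rewrite (mulr_swap _ _ (bp_comm k i)) (mulr_swap _ _ (bm_comm k i)).
rewrite !bm_bp !bp_bm -!(wfM sys) -fnB; congr fn; apply: funext => x.
by rewrite qint_ef /weight (extS _ _ ik).
Qed.

(** Two factors can fail to commute only if they are a b^- and a b^+ of the same mode, which would
    make i and j adjacent; g meets only operators that preserve N. *)
Lemma e_comm i j : ~~ Defs.adjacent i j -> GRing.comm (e i) (e j).
Proof.
rewrite negb_or => /andP[ij ji].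
have [->//|nij] := eqVneq i j.
have [i0|[k ik]] := ord_case i; have [j0|[l jl]] := ord_case j.
- by case/eqP: nij; apply: val_inj; rewrite /= i0 j0.
- apply: commr_sym; rewrite (e0E i0); apply: commrM; first exact/commr_sym/(g_e jl).
  rewrite (eSE jl); apply: commr_sym; apply: commrM; first exact: bm_comm.
  by apply: bm_bp_comm; apply: contraNneq ij => ->; rewrite -jl.
- rewrite (e0E j0); apply: commrM; first exact/commr_sym/(g_e ik).
  rewrite (eSE ik); apply: commr_sym; apply: commrM; first exact: bm_comm.
  by apply: bm_bp_comm; apply: contraNneq ji => ->; rewrite -ik.
- rewrite (eSE ik) (eSE jl); apply: comm4; [exact: bm_comm| | |exact: bp_comm].
    by apply: bm_bp_comm; apply: contraNneq ij => ->; rewrite -jl.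
  by apply: bp_bm_comm; apply: contraNneq ji => <-; rewrite -ik.
Qed.

Lemma f_comm i j : ~~ Defs.adjacent i j -> GRing.comm (f i) (f j).
Proof.
rewrite negb_or => /andP[ij ji].
have [->//|nij] := eqVneq i j.
have [i0|[k ik]] := ord_case i; have [j0|[l jl]] := ord_case j.
- by case/eqP: nij; apply: val_inj; rewrite /= i0 j0.
- apply: commr_sym; rewrite (f0E i0); apply: commrM; last exact/commr_sym/(g_f jl).
  rewrite (fSE jl); apply: commr_sym; apply: commrM; first exact: bp_comm.
  by apply: bp_bm_comm; apply: contraNneq ij => ->; rewrite -jl.
- rewrite (f0E j0); apply: commrM; last exact/commr_sym/(g_f ik).
  rewrite (fSE ik); apply: commr_sym; apply: commrM; first exact: bp_comm.
  by apply: bp_bm_comm; apply: contraNneq ji => ->; rewrite -ik.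
- rewrite (fSE ik) (fSE jl); apply: comm4; [exact: bp_comm| | |exact: bm_comm].
    by apply: bp_bm_comm; apply: contraNneq ij => ->; rewrite -jl.
  by apply: bm_bp_comm; apply: contraNneq ji => <-; rewrite -ik.
Qed.

(** Adjacent e_i and e_j share one mode: it occurs as b^+ in the one with the larger index and as
    b^- in the other. The relation for this mode is transferred to the products: by [serre2] if i is
    the larger index, by [serre1] if it is the smaller. In the latter case the factor g of e_1 does
    not commute with b_1^-, which accounts for the g' of [serre1]. *)
Lemma serre_e i j : Defs.adjacent i j ->
  e i * e i * e j + e j * e i * e i = Q * (e i * e j * e i).
Proof.
case/orP=> /eqP ij; last first.
  rewrite (eSE (esym ij)); have ji := neqS (esym ij).
  have [j0|[l jl]] := ord_case j.
    rewrite (e0E j0); apply: serre2; [exact: QC| |exact: bm_bp_comm|exact: bm_comm|exact: serre_bp].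
    by rewrite -(eSE (esym ij)); apply/commr_sym/(g_e (esym ij)).
  rewrite (eSE jl) [bm j * bp l]bm_bp_comm ?neqS //.
  apply: serre2; [exact: QC| |exact: bm_bp_comm|exact: bm_comm|exact: serre_bp].
  apply: commr_sym; apply: commrM; last exact: bp_comm.
  by apply: bp_bm_comm; rewrite -val_eqE /= -ij jl ltn_eqF // leqnSn.
rewrite (eSE (esym ij)); have ji := neqS (esym ij).
have [i0|[k ik]] := ord_case i.
  rewrite (e0E i0); apply: serre1; [exact: QC|exact: bm_fn| | |exact: bm_comm|exact: bm_bp_comm|exact: serre_bm].
    by rewrite -(eSE (esym ij)); apply/commr_sym/(g_e (esym ij)).
  rewrite -(eSE (esym ij)); apply: commr_sym; rewrite /GRing.comm fn_e; congr (_ * fn _).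
  by apply: funext => x; rewrite (lowerS _ (esym ij)) !sum_shift addrK.
rewrite (eSE ik) [bm i * bp k]bm_bp_comm ?neqS //.
have Ck : GRing.comm (bm j * bp i) (bp k).
  apply: commr_sym; apply: commrM; last exact: bp_comm.
  by apply: bp_bm_comm; rewrite -val_eqE /= -ij ik ltn_eqF // leqnSn.
apply: serre1; [exact: QC|apply: bm_bp_comm; exact: neqS|exact: Ck|exact: Ck|exact: bm_comm|exact: bm_bp_comm|exact: serre_bm].
Qed.

Lemma serre_f i j : Defs.adjacent i j ->
  f i * f i * f j + f j * f i * f i = Q * (f i * f j * f i).
Proof.
case/orP=> /eqP ij; last first.
  have ji := neqS (esym ij); rewrite (fSE (esym ij)) bp_bm_comm //.
  have [j0|[l jl]] := ord_case j.
    rewrite (f0E j0); apply: serre2c; [exact: QC| |exact: bp_bm_comm|exact: bp_comm|exact: serre_bm].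
    by rewrite -bp_bm_comm // -(fSE (esym ij)); apply/commr_sym/(g_f (esym ij)).
  rewrite (fSE jl).
  apply: serre2c; [exact: QC| |exact: bp_bm_comm|exact: bp_comm|exact: serre_bm].
  apply: commr_sym; apply: commrM; first exact: bm_comm.
  by apply: bm_bp_comm; rewrite -val_eqE /= -ij jl ltn_eqF // leqnSn.
rewrite (fSE (esym ij)); have ji := neqS (esym ij).
rewrite [bp j * bm i]bp_bm_comm //.
have [i0|[k ik]] := ord_case i.
  rewrite (f0E i0); apply: serre1c; [exact: QC|exact: fn_bp| | |exact: bp_comm|exact: bp_bm_comm|exact: serre_bp].
    by rewrite -bp_bm_comm // -(fSE (esym ij)); apply/commr_sym/(g_f (esym ij)).
  rewrite -bp_bm_comm // -(fSE (esym ij)); apply: commr_sym; rewrite /GRing.comm fn_f; congr (_ * fn _).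
  by apply: funext => x; rewrite (raiseS _ (esym ij)) !sum_shift addrAC subrK.
rewrite (fSE ik).
have Ck : GRing.comm (bm i * bp j) (bm k).
  apply: commr_sym; apply: commrM; first exact: bm_comm.
  by apply: bm_bp_comm; rewrite -val_eqE /= -ij ik ltn_eqF // leqnSn.
apply: serre1c; [exact: QC| |exact: Ck|exact: Ck|exact: bp_comm|exact: bp_bm_comm|exact: serre_bp].
by apply: bm_bp_comm; rewrite eq_sym; exact: neqS.
Qed.

Section Relations.
Variables (T : lalgType K) (q qV : K) (hT eT fT brT : 'I_n -> T) (Psi : {rmorphism T -> W}).
Hypothesis qqV : q * qV = 1.
Hypothesis q2E : q + qV = q2.
Hypothesis PsiZ : forall c x, Psi (c *: x) = fn (fun=> c) * Psi x.
Hypothesis Psi_h : forall i, Psi (hT i) = fn (fun x => iota (weight p i x)).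
Hypothesis Psi_e : forall i, Psi (eT i) = e i.
Hypothesis Psi_f : forall i, Psi (fT i) = f i.
Hypothesis Psi_br : forall i, Psi (brT i) = fn (fun x => qint (weight p i x)).

Let fn_int (c : int) : fn (fun=> c%:~R) = c%:~R.
Proof.
pose phi (m : int) : W := fn (fun=> m%:~R).
have phiB : additive phi.
  by move=> a b; rewrite /phi -fnB; congr fn; apply: funext => x; rewrite rmorphB.
pose phi' : {additive int -> W} := HB.pack phi (GRing.isAdditive.Build _ _ phi phiB).
by rewrite -[LHS]/(phi' c) -[in LHS](intz c) raddfMz /= /phi mulr1z (wf1 sys).
Qed.

Let fn0 : fn (fun=> 0) = 0. Proof. exact: (fn_int 0). Qed.

Lemma Uq_rel_HP x : Uq_rel q qV hT eT fT brT x -> Psi x = 0.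
Proof.
(* The nested commutator expands to a a b - (c + d) a b a + c d b a a. With c d = 1 this is
   symmetric in c and d, so the two forms of the Serre relation coincide. *)
have serre (a b : T) : Psi a * Psi a * Psi b + Psi b * Psi a * Psi a = Q * (Psi a * Psi b * Psi a) ->
    forall c d, c * d = 1 -> c + d = q2 -> Psi (qcomm c a (qcomm d a b)) = 0.
  move=> S c d cd1 cdq.
  rewrite /qcomm !(rmorphB, rmorphM, PsiZ) mulrBr mulrBl mulrBr !mulrA.
  rewrite -(wfM sys) cd1 (wf1 sys) mul1r -(wcst sys d (Psi a)).
  rewrite opprB addrACA S -opprD /Q -cdq (wfD sys) !mulrDl !mulrA.
  by rewrite [fn _ * _ * _ * _ + _]addrC subrr.
case=> {x}.
- by move=> i j; rewrite rmorphB !rmorphM !Psi_h fnC subrr.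
- move=> i j; rewrite rmorphB rmorphMz rmorphB !rmorphM Psi_h Psi_e fn_e -mulrzr -fn_int.
  rewrite -!mulrBr -!fnB [X in _ * fn X](_ : _ = fun=> 0) ?fn0 ?mulr0 //.
  by apply: funext => x; rewrite weight_lower rmorphD rmorph_int; ring.
- move=> i j; rewrite rmorphD rmorphMz rmorphB !rmorphM Psi_h Psi_f fn_f -mulrzr -fn_int.
  rewrite -mulrBr -mulrDr -fnB -(wfD sys) [X in _ * fn X](_ : _ = fun=> 0) ?fn0 ?mulr0 //.
  by apply: funext => x; rewrite weight_raise rmorphB rmorph_int; ring.
- move=> i j; rewrite rmorphB rmorphMn rmorphB !rmorphM Psi_e Psi_f Psi_br.
  have [<-|ij] := eqVneq i j; first by rewrite e_f_brak subrr.
  by rewrite e_f_comm // subrr subr0.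
- by move=> i j ij; rewrite rmorphB !rmorphM !Psi_e e_comm // subrr.
- by move=> i j ij; rewrite rmorphB !rmorphM !Psi_f f_comm // subrr.
- by move=> i j ij; apply: serre => //; rewrite !Psi_e serre_e.
- by move=> i j ij; apply: serre; rewrite ?(addrC qV) ?(mulrC qV) // !Psi_e serre_e.
- by move=> i j ij; apply: serre => //; rewrite !Psi_f serre_f.
- by move=> i j ij; apply: serre; rewrite ?(addrC qV) ?(mulrC qV) // !Psi_f serre_f.
Qed.

Section CartanPowers.
Variables (kT kVT : 'I_n -> T) (pw : C -> K) (qz : int -> K).
Hypothesis pwNM : forall x, pw x * pw (- x) = 1.
Hypothesis pw_shift : forall x c, pw (x + c%:~R) = qz c * pw x.
Hypothesis Psi_k : forall i, Psi (kT i) = fn (fun x => pw (weight p i x)).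
Hypothesis Psi_kV : forall i, Psi (kVT i) = fn (fun x => pw (- weight p i x)).

Lemma rel_kkV i : Psi (kT i * kVT i - 1) = 0.
Proof.
rewrite rmorphB rmorphM rmorph1 Psi_k Psi_kV -(wfM sys) -(wf1 sys) -fnB -fn0; congr fn.
by apply: funext => x; rewrite pwNM subrr.
Qed.

Lemma rel_kVk i : Psi (kVT i * kT i - 1) = 0.
Proof.
rewrite rmorphB rmorphM rmorph1 Psi_k Psi_kV -(wfM sys) -(wf1 sys) -fnB -fn0; congr fn.
by apply: funext => x; rewrite mulrC pwNM subrr.
Qed.

Lemma rel_kk i j : Psi (comm (kT i) (kT j)) = 0.
Proof. by rewrite rmorphB !rmorphM !Psi_k fnC subrr. Qed.

Lemma rel_kh i j : Psi (comm (kT i) (hT j)) = 0.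
Proof. by rewrite rmorphB !rmorphM Psi_k Psi_h fnC subrr. Qed.

Lemma rel_ke i j : Psi (kT i * eT j - qz (cartan i j) *: (eT j * kT i)) = 0.
Proof.
rewrite rmorphB PsiZ !rmorphM Psi_k Psi_e fn_e mulrA (wcst sys) -mulrA -(wfM sys) -mulrBr -fnB.
rewrite [X in _ * fn X](_ : _ = fun=> 0) ?fn0 ?mulr0 //.
by apply: funext => x; rewrite weight_lower pw_shift subrr.
Qed.

Lemma rel_kf i j : Psi (kT i * fT j - qz (- cartan i j) *: (fT j * kT i)) = 0.
Proof.
rewrite rmorphB PsiZ !rmorphM Psi_k Psi_f fn_f mulrA (wcst sys) -mulrA -(wfM sys) -mulrBr -fnB.
rewrite [X in _ * fn X](_ : _ = fun=> 0) ?fn0 ?mulr0 //.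
by apply: funext => x; rewrite weight_raise -mulrNz pw_shift subrr.
Qed.

End CartanPowers.
End Relations.
End Generators.
End QBosons.

(** * q-numbers *)

(** Absence of zero divisors as a bare property of a commutative ring, shared by C[[h]] and C. *)
Definition integral (K : comNzRingType) := forall a b : K, a * b = 0 -> a = 0 \/ b = 0.

Lemma integral_mulI (K : comNzRingType) (d a b : K) :
  integral K -> d != 0 -> d * a = d * b -> a = b.
Proof.
move=> Kint d0 /eqP; rewrite -subr_eq0 -mulrBr => /eqP /Kint[/eqP|/eqP].
  by rewrite (negPf d0).
by rewrite subr_eq0 => /eqP.
Qed.

Lemma integral_mul_neq0 (K : comNzRingType) (a b : K) :
  integral K -> a != 0 -> b != 0 -> a * b != 0.
Proof. by move=> Kint a0 b0; apply/eqP => /Kint[/eqP|/eqP]; apply/negP. Qed.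

(* K = C[[h]] has no inverse of q - q^-1, so [qi] is given by its product with it. *)
Section QNumbers.
Variables (C K : comNzRingType) (pw qi : C -> K).
Hypothesis Kint : integral K.
Hypothesis pwD : forall x y, pw (x + y) = pw x * pw y.
Hypothesis pw0 : pw 0 = 1.
Hypothesis d0 : pw 1 - pw (- 1) != 0.
Hypothesis qiE : forall x, (pw 1 - pw (- 1)) * qi x = pw x - pw (- x).

Let pw1V : pw 1 * pw (- 1) = 1. Proof. by rewrite -pwD subrr pw0. Qed.

Lemma qint_recE x : qi (x + 2) + qi x = (pw 1 + pw (- 1)) * qi (x + 1).
Proof.
apply: (integral_mulI Kint d0); rewrite mulrDr [RHS]mulrCA !qiE.
have -> : x + 2 = x + 1 + 1 by ring.
rewrite !opprD !pwD.
have E : pw 1 * pw (- 1) = 1 := pw1V.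
(* The terms q^x and q^-x are multiplied by q q^-1, after which both sides agree as polynomials. *)
transitivity (pw x * (pw 1 * pw 1 + pw 1 * pw (- 1)) - pw (- x) * (pw (- 1) * pw (- 1) + pw 1 * pw (- 1))).
  by rewrite E; ring.
by ring.
Qed.

Lemma qint_efE a b : qi (a + 1) * qi b - qi a * qi (b + 1) = qi (b - a).
Proof.
(* The left-hand side is quadratic in q-numbers, hence two factors q - q^-1. *)
apply: (integral_mulI Kint d0); apply: (integral_mulI Kint d0).
set d := pw 1 - pw (- 1).
transitivity ((d * qi (a + 1)) * (d * qi b) - (d * qi a) * (d * qi (b + 1))); first by ring.
by rewrite !qiE !opprD opprK !pwD /d; ring.
Qed.

End QNumbers.

Section Formal.
Variable R : realType.
Local Notation C := R[i].

(** A nonzero series is a power of h times a series with nonzero constant term, and the latter is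
    invertible. *)
Lemma fps_integral : integral (fps C).
Proof.
move=> s t st; have [->|s0] := eqVneq s 0; [by left|right].
have [a [sa0 sa]] : exists a, s a != 0 /\ forall k, (k < a)%N -> s k = 0.
  have ex : exists k, s k != 0.
    apply: contrapT => ns; case/eqP: s0; apply: fpsP => k.
    by apply: contrapT => /eqP sk; apply: ns; exists k.
  exists (ex_minn ex); case: ex_minnP => a sa min; split=> // k ka.
  by apply/eqP; apply: contraTT ka => /min; rewrite -leqNgt.
have sE : s = fpsX C ^+ a *: (fps_tail a s : fps C^o).
  rewrite {1}(@fps_split C C^o a s) big1 ?add0r // => k _.
  by rewrite sa // raddf0 scaler0.
have u0 : fps_tail a s 0%N != 0 by rewrite /= addn0.
have ut : (fps_tail a s : fps C) * t = 0.
  apply: fpsP => k; have := congr1 (fun u : fps C => u (a + k)%N) st.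
  rewrite {1}sE -[X in X * _]/((fpsX C ^+ a : fps C) * _) -mulrA.
  by rewrite [LHS](@fpsXnZE C C^o) ltnNge leq_addr /= addKn.
by rewrite -[t]mul1r -(fps_mulV u0) mulrAC ut mul0r.
Qed.

(** The functional equation of the exponential, which in each degree is the binomial theorem. *)
Lemma h_qpowD (x y : C) : h_qpow (x + y : C^o) = h_qpow (x : C^o) * h_qpow (y : C^o) :> fps C.
Proof.
apply: fpsP => m; rewrite fpsME.
rewrite -[LHS]/((2 ^- m / m`!%:R) * (x + y) ^+ m) (exprDn x) mulr_sumr [RHS](reindex_inj rev_ord_inj).
apply: eq_bigr => -[i /= im] _; rewrite subSS; rewrite ltnS in im.
rewrite -[RHS]/((2 ^- (m - i) / (m - i)`!%:R * x ^+ (m - i)) * (2 ^- (m - (m - i)) / (m - (m - i))`!%:R * y ^+ (m - (m - i)))).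
rewrite subKn // -mulr_natr -(bin_fact im) -{1}(subnK im) exprD !natrM.
have fn0 k : k`!%:R != 0 :> C by rewrite pnatr_eq0 -lt0n fact_gt0.
have b0 : 'C(m, i)%:R != 0 :> C by rewrite pnatr_eq0 -lt0n bin_gt0.
have t0 k : 2 ^+ k != 0 :> C by rewrite expf_neq0 // pnatr_eq0.
by field; rewrite !fn0 b0 mul1r !t0.
Qed.

Lemma h_qpow0 : h_qpow (0 : C^o) = 1 :> fps C.
Proof.
apply: fpsP => m; rewrite -[LHS]/(2 ^- m / m`!%:R * (0 : C) ^+ m).
case: m => [|m]; last by rewrite (expr0n _ m.+1) mulr0.
by rewrite (expr0 (0 : C)) mulr1 (expr0 (2 : C)) !invr1 mulr1.
Qed.

Lemma h_qqV : h_q R * h_qV R = 1.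
Proof. by rewrite -h_qpowD subrr h_qpow0. Qed.

Lemma h_qq_neq0 : h_q R - h_qV R != 0.
Proof.
apply/eqP => /(congr1 (fun s : fps C => s 1%N)).
have := @divh_qpow0 R C^o 1; rewrite -[LHS]/((h_q R - h_qV R) 1%N) => -> /eqP.
by rewrite oner_eq0.
Qed.

Lemma h_qint_rec (x : C) : h_qint (x + 2) + h_qint x = (h_q R + h_qV R) * h_qint (x + 1).
Proof.
apply: (@qint_recE C (fps C) (fun x => h_qpow (x : C^o)) (@h_qint R) fps_integral h_qpowD h_qpow0 h_qq_neq0).
by move=> y; exact: (@h_bracketP R C^o y).
Qed.

Lemma h_qint_ef (a b : C) :
  h_qint (a + 1) * h_qint b - h_qint a * h_qint (b + 1) = h_qint (b - a).
Proof.
apply: (@qint_efE C (fps C) (fun x => h_qpow (x : C^o)) (@h_qint R) fps_integral h_qpowD h_qq_neq0).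
by move=> y; exact: (@h_bracketP R C^o y).
Qed.

Lemma h_qratioP (x : C) : h_qratio x * fpsC x = h_qint x.
Proof. by rewrite h_qintE mulrC. Qed.

Lemma h_qint0 : h_qint (0 : C) = 0.
Proof. by rewrite h_qintE raddf0 mul0r. Qed.

Lemma h_qint_neq0 (x : C) : x != 0 -> h_qint x != 0.
Proof.
move=> x0; apply/eqP => /(congr1 (fun s : fps C => s 0%N)).
by rewrite h_qintE fpsC_mulE => /eqP; rewrite mulf_eq0 (negPf x0) (negPf (h_qratio0 x)).
Qed.

End Formal.

Section Numeric.
Variable R : realType.
Local Notation C := R[i].

Lemma cexpD (z w : C) : cexp (z + w) = cexp z * cexp w.
Proof.
case: z w => [a b] [c d]; rewrite /cexp /= expRD cosD sinD; simpc.
by congr Complex; ring.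
Qed.

Lemma cexp0 : cexp 0 = 1 :> C.
Proof. by rewrite /cexp /= expR0 cos0 sin0; simpc. Qed.

Variable h : C.

Lemma n_qpowD x y : n_qpow h (x + y) = n_qpow h x * n_qpow h y.
Proof. by rewrite /n_qpow -cexpD mulrDr mulrDl. Qed.

Lemma n_qpow0 : n_qpow h 0 = 1.
Proof. by rewrite /n_qpow mulr0 mul0r cexp0. Qed.

Lemma n_qpowNM x : n_qpow h x * n_qpow h (- x) = 1.
Proof. by rewrite -n_qpowD subrr n_qpow0. Qed.

Lemma n_qpow_neq0 x : n_qpow h x != 0.
Proof. by have /eqP := n_qpowNM x; apply: contraTneq => ->; rewrite mul0r eq_sym oner_eq0. Qed.

Lemma n_qpowN x : n_qpow h (- x) = (n_qpow h x)^-1.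
Proof. by apply: (mulfI (n_qpow_neq0 x)); rewrite n_qpowNM mulfV ?n_qpow_neq0. Qed.

Lemma n_qpow_nat (m : nat) : n_qpow h m%:R = n_q h ^+ m.
Proof.
elim: m => [|m IH]; first by rewrite n_qpow0.
by rewrite -natr1 n_qpowD IH exprSr.
Qed.

Lemma n_qpow_int (m : int) : n_qpow h m%:~R = n_q h ^ m.
Proof.
case: m => m; first exact: n_qpow_nat.
by rewrite NegzE mulrNz n_qpowN -pmulrn n_qpow_nat exprnN.
Qed.

Hypothesis qroot : forall m, (0 < m)%N -> n_q h ^+ m != 1.

Lemma n_qq_neq0 : n_q h - (n_q h)^-1 != 0.
Proof.
rewrite subr_eq0; apply: contra_neq (qroot (isT : (0 < 2)%N)) => qq.
by rewrite expr2 {2}qq mulfV // n_qpow_neq0.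
Qed.

Lemma n_qintM x : (n_q h - (n_q h)^-1) * n_qint h x = n_qpow h x - n_qpow h (- x).
Proof. by rewrite mulrC /n_qint divfK // n_qq_neq0. Qed.

Let qV : (n_q h)^-1 = n_qpow h (- 1). Proof. by rewrite n_qpowN. Qed.

Let d0 : n_qpow h 1 - n_qpow h (- 1) != 0. Proof. by rewrite -qV n_qq_neq0. Qed.

Lemma field_integral (F : fieldType) : integral F.
Proof. by move=> a b /eqP; rewrite mulf_eq0 => /orP[]/eqP; [left|right]. Qed.

Lemma n_qint_rec x : n_qint h (x + 2) + n_qint h x = (n_q h + (n_q h)^-1) * n_qint h (x + 1).
Proof.
rewrite qV; apply: (@qint_recE C C (n_qpow h) (n_qint h) (@field_integral _) n_qpowD n_qpow0 d0).
by move=> y; rewrite -qV n_qintM.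
Qed.

Lemma n_qint_ef a b :
  n_qint h (a + 1) * n_qint h b - n_qint h a * n_qint h (b + 1) = n_qint h (b - a).
Proof.
apply: (@qint_efE C C (n_qpow h) (n_qint h) (@field_integral _) n_qpowD d0).
by move=> y; rewrite -qV n_qintM.
Qed.

Lemma n_qint0 : n_qint h 0 = 0.
Proof. by rewrite /n_qint oppr0 subrr mul0r. Qed.

Lemma n_qratioP x : n_qratio h x * x = n_qint h x.
Proof.
by rewrite /n_qratio; case: eqVneq => [->|x0]; rewrite ?mulr0 ?n_qint0 // divfK.
Qed.

(** If [m + 1] were 0, then q^(2(m + 1)) = 1, against the hypothesis on q. *)
Lemma n_qint_neq0 (m : nat) : n_qint h m.+1%:R != 0.
Proof.
have : n_qpow h m.+1%:R - n_qpow h (- m.+1%:R) != 0.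
  rewrite n_qpowN n_qpow_nat subr_eq0.
  apply: contra_neq (qroot (isT : (0 < m.+1 + m.+1)%N)) => qq.
  by rewrite exprD {2}qq mulfV // expf_neq0 // n_qpow_neq0.
by rewrite -n_qintM; apply: contra_neq => ->; rewrite mulr0.
Qed.

(** Induction by [m + 1] = [m] q + q^-m. In the order of the complex numbers, 0 < q includes that q
    is real. *)
Lemma n_qint_ge0 (m : nat) : 0 < n_q h -> 0 <= n_qint h m%:R.
Proof.
move=> q0; elim: m => [|m IH]; first by rewrite n_qint0.
have -> : n_qint h m.+1%:R = n_qint h m%:R * n_q h + n_qpow h (- m%:R).
  apply: (mulfI n_qq_neq0); rewrite mulrDr [_ * (n_qint h m%:R * _)]mulrA !n_qintM -natr1 opprD !n_qpowD.
  by rewrite /n_q !n_qpowN; field; rewrite !n_qpow_neq0.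
apply: addr_ge0; first by rewrite mulr_ge0 // ltW.
by rewrite n_qpowN n_qpow_nat invr_ge0 exprn_ge0 // ltW.
Qed.

End Numeric.

(** * The morphism pi *)

Section WeylQuotient.
Variables (C K : comNzRingType) (iota : C -> K) (n : nat) (A : algType K) (I : ideal A).
Variables (ap am : 'I_n -> A) (fn : (('I_n -> C) -> K) -> A).
Hypothesis relI : forall x, Weyl_rel iota ap am fn x -> I x.

Let rel0 x : Weyl_rel iota ap am fn x -> cl I x = 0.
Proof. by move=> /relI/cl0. Qed.

Let relE x y : Weyl_rel iota ap am fn (x - y) -> cl I x = cl I y.
Proof. by move=> /rel0; rewrite raddfB => /subr0_eq. Qed.

Lemma quot_fn_cst c : cl I (fn (fun=> c)) = c *: (1 : quot_alg I).
Proof. by rewrite (relE (W_const iota ap am fn c)) clZ. Qed.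

Lemma quot_fn_scale c w : cl I (fn (fun=> c)) * w = c *: w.
Proof. by rewrite quot_fn_cst -quot_scaleAl mul1r. Qed.

Lemma quot_weyl_system :
  weyl_system iota (fun i => cl I (ap i)) (fun i => cl I (am i)) (fun F => cl I (fn F)).
Proof.
split=> /=.
- move=> i j; have := rel0 (W_mp iota ap am fn i j).
  rewrite rmorphB rmorphB !rmorphM rmorphMn rmorph1 => /subr0_eq <-.
  by rewrite addrC subrK.
- by move=> i j; rewrite -!rmorphM; apply: relE; apply: W_pp.
- by move=> i j; rewrite -!rmorphM; apply: relE; apply: W_mm.
- by rewrite quot_fn_cst scale1r.
- by move=> F G; rewrite -rmorphD; apply: relE; apply: W_add.
- by move=> F G; rewrite -rmorphM; apply: relE; apply: W_mul.
- by move=> i; rewrite -rmorphM; apply: relE; apply: W_num.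
- by move=> c w; rewrite quot_fn_scale quot_fn_cst -quot_scaleAr mulr1.
- by move=> F j; rewrite -!rmorphM; apply: relE; apply: W_fp.
- by move=> F j; rewrite -!rmorphM; apply: relE; apply: W_fm.
Qed.

End WeylQuotient.

Section Lift.
Variables (K : comNzRingType) (X : choiceType).

Section Plain.
Variables (A : algType K) (f : X -> A).

Let algC (c : K) (s : A) : GRing.comm (in_alg A c) s.
Proof. by rewrite /GRing.comm -scalerAl mul1r -scalerAr mulr1. Qed.

Definition alg_lift : free_alg K X -> A := free_lift (in_alg A) f.

HB.instance Definition _ := GRing.isAdditive.Build (free_alg K X) A alg_lift
  (free_lift_is_additive (in_alg A) f).
HB.instance Definition _ := GRing.isMonoidMorphism.Build (free_alg K X) A alg_lift
  (free_lift_is_monoid_morphism f algC).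

Lemma alg_liftZ c x : alg_lift (c *: x) = c *: alg_lift x.
Proof. by rewrite /alg_lift free_liftZ -scalerAl mul1r. Qed.

Lemma alg_lift_gen x : alg_lift (gen x) = f x.
Proof. exact: free_lift_gen. Qed.

End Plain.

Section Series.
Variables (A : algType K) (f : X -> fps A).

Let sigma : {rmorphism K -> fps A} := in_alg (fps A) \o @fpsC K.

Let sigmaC c s : GRing.comm (sigma c) s.
Proof. by rewrite /GRing.comm /= -scalerAl mul1r -scalerAr mulr1. Qed.

Let phi := free_lift sigma f.

Let phi_lin a x y : phi (a *: x + y) = fpsC a *: phi x + phi y.
Proof. by rewrite /phi raddfD /= free_liftZ -scalerAl mul1r. Qed.

Let phi_mul : monoid_morphism phi.
Proof. exact: free_lift_is_monoid_morphism. Qed.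

(** Words are lifted by freeness and series of words by continuity. The generators may go to
    nonconstant series, as the functions of the N_i do on the Fock space. *)
Definition series_lift : fps (free_alg K X) -> fps A := fps_ext phi.

HB.instance Definition _ := GRing.isAdditive.Build (fps (free_alg K X)) (fps A) series_lift
  (fps_ext_is_additive phi_lin).
HB.instance Definition _ := GRing.isMonoidMorphism.Build (fps (free_alg K X)) (fps A) series_lift
  (fps_ext_is_monoid_morphism phi_lin phi_mul).

Lemma series_liftZ c s : series_lift (c *: s) = c *: series_lift s.
Proof. exact: fps_ext_scale. Qed.

Lemma series_lift_gen x : series_lift (fpsC (gen x)) = f x.
Proof. by rewrite /series_lift (fps_extC phi_lin); exact: free_lift_gen. Qed.

Lemma series_lift_local (s t : fps (free_alg K X)) m : (forall k, (k < m)%N -> s k = t k) ->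
  forall k, (k < m)%N -> series_lift s k = series_lift t k.
Proof. exact: fps_ext_local. Qed.

(** If the coefficients of s go to constants, the lift creates no powers of h and may be computed
    coefficient by coefficient. *)
Lemma series_lift_coef (s : fps (free_alg K X)) (t : fps A) :
  (forall m, series_lift (fpsC (s m)) = fpsC (t m)) -> series_lift s = t.
Proof.
move=> st; apply: fpsP => m.
rewrite -[LHS]/(\sum_(i < m.+1) phi (s i) (m - i)%N) big_ord_recr /= big1 => [|i _].
  by rewrite add0r subnn -(fps_extC phi_lin) [fps_ext _ _]st.
rewrite -(fps_extC phi_lin) [fps_ext _ _]st /= subn_eq0 leqNgt ltn_ord //.
Qed.

End Series.
End Lift.

Section HPGenerators.
Variables (C K : comNzRingType) (iota : {rmorphism C -> K}) (n : nat).

(** The prescribed values of pi(h_i) are polynomials in the N_i; the relations are checked on them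
    as functions, where they are the weights. *)
Lemma fn_weight0 (W : pzRingType) ap am fn p (i : 'I_n) :
  @weyl_system C K iota n W ap am fn -> i = 0%N :> nat ->
  fn (fun x => iota (weight p i x)) = fn (fun=> iota p) - \sum_j ap j * am j - ap i * am i.
Proof.
move=> sys i0; have fn_sum (r : seq 'I_n) :
    fn (fun x => iota (\sum_(j <- r) x j)) = \sum_(j <- r) ap j * am j.
  elim: r => [|a r IH].
    rewrite big_nil -(subrr (fn (fun=> 0))) -(fnB sys); congr fn.
    by apply: funext => x; rewrite big_nil subrr rmorph0.
  rewrite big_cons -IH -(wnum sys) -(wfD sys); congr fn.
  by apply: funext => x; rewrite big_cons rmorphD.
rewrite -fn_sum -(wnum sys) -!(fnB sys); congr fn; apply: funext => x.
by rewrite /weight ext0 // !rmorphB.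
Qed.

Lemma fn_weightS (W : pzRingType) ap am fn p (i j : 'I_n) :
  @weyl_system C K iota n W ap am fn -> i = j.+1 :> nat ->
  fn (fun x => iota (weight p i x)) = ap j * am j - ap i * am i.
Proof.
move=> sys ij; rewrite -!(wnum sys) -(fnB sys); congr fn; apply: funext => x.
by rewrite /weight (extS _ _ ij) rmorphB.
Qed.

Variables (A : nzRingType) (ap am : 'I_n -> A) (fn : (('I_n -> C) -> K) -> A).
Variables (p : C) (alpha beta : C -> K).

Definition HP_gen (u : Ugen n) : A :=
  match u with
  | GenH i => fn (fun x => iota (weight p i x))
  | GenE i =>
      if i == 0%N :> nat then fn (fun x => alpha (x i + 1) * beta (p - \sum_j x j)) * am i
      else fn (fun x => alpha (x (ord_pred i)) * alpha (x i + 1)) * (am i * ap (ord_pred i))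
  | GenF i =>
      if i == 0%N :> nat then fn (fun x => alpha (x i) * beta (p - \sum_j x j + 1)) * ap i
      else fn (fun x => alpha (x (ord_pred i) + 1) * alpha (x i)) * (ap i * am (ord_pred i))
  end.

(** [ord_pred] is the cyclic predecessor, which away from 0 is the ordinary one. *)
Lemma ord_predS (i j : 'I_n) : i = j.+1 :> nat -> ord_pred i = j.
Proof. by move=> ij; apply: val_inj; rewrite /= ij addSn /= modnDr modn_small. Qed.

Lemma HP_genP (W : pzRingType) (Psi : {rmorphism A -> W}) (pW : W) :
  @weyl_system C K iota n W (Psi \o ap) (Psi \o am) (Psi \o fn) ->
  pW = Psi (fn (fun=> iota p)) ->
  HP_on_generators GenH GenE GenF (Psi \o ap) (Psi \o am) (Psi \o fn) p pW alpha beta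
    (Psi \o HP_gen).
Proof.
move=> sys pWE; split; last split.
- by move=> i i0 /=; rewrite pWE; apply: fn_weight0 sys i0.
- by move=> i j ij /=; apply: fn_weightS sys ij.
- by move=> i /= ->; rewrite eqxx rmorphM.
- by move=> i j /= ij; rewrite (ord_predS ij) ij /= !rmorphM.
- by move=> i /= ->; rewrite eqxx rmorphM.
- by move=> i j /= ij; rewrite (ord_predS ij) ij /= !rmorphM.
Qed.

End HPGenerators.

Section SeriesBracket.
Variables (R : realType) (B A : algType R[i]) (F : {rmorphism fps B -> fps A}).
Hypothesis FZ : forall c s, F (c *: s) = c *: F s.
Hypothesis F_coef : forall (s : fps B) (t : fps A),
  (forall m, F (fpsC (s m)) = fpsC (t m)) -> F s = t.

(** The coefficients of the series in question are multiples of powers of x plus the same for - x,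
    so they go to constants and [F_coef] applies. *)
Lemma rmorph_bracket x y : F (fpsC x) = fpsC y -> F (h_bracket x) = h_bracket y.
Proof.
move=> Fx; rewrite /h_bracket FZ; congr (_ *: _).
apply: F_coef => m.
set c : R[i] := 2 ^- m.+1 / m.+1`!%:R.
rewrite -[divh _ m]/(c *: x ^+ m.+1 - c *: (- x) ^+ m.+1).
rewrite -[divh (_ y - _) m]/(c *: y ^+ m.+1 - c *: (- y) ^+ m.+1).
have FM z z' : F (fpsC z) = fpsC z' -> F (fpsC (c *: z ^+ m.+1)) = fpsC (c *: z' ^+ m.+1).
  by move=> Fz; rewrite !fpsCZ FZ !(rmorphXn (@fpsC _)) (rmorphXn F) Fz.
rewrite !(raddfB (@fpsC _)) (raddfB F) /= (FM _ _ Fx) (FM _ (- y)) //.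
by rewrite !(raddfN (@fpsC _)) (raddfN F) /= Fx.
Qed.

End SeriesBracket.

Section FormalQuotient.
Variables (R : realType) (n : nat).
Local Notation C := R[i].
Variables (A : algType C) (J : ideal (fps A)) (ap am : 'I_n -> fps A).
Variables (fn : (('I_n -> C) -> fps C) -> fps A).
Hypothesis relJ : forall x, Weyl_rel (@fpsC C) ap am fn x -> J x.
Hypothesis closedJ : h_closed J.

Let Fn F : quot_alg J := cl J (fn F).
Let sys := quot_weyl_system relJ.

Let FnZ c F : Fn (fun x => c * F x) = c *: Fn F.
Proof. by rewrite /Fn (wfM sys) (quot_fn_scale relJ). Qed.

Let Fn_sum (I : Type) (r : seq I) (F : I -> ('I_n -> C) -> fps C) :
  Fn (fun x => \sum_(i <- r) F i x) = \sum_(i <- r) Fn (F i).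
Proof.
elim: r => [|a r IH].
  rewrite big_nil -[RHS](scale0r (Fn (fun=> 0))) -FnZ; congr Fn.
  by apply: funext => x; rewrite big_nil mul0r.
rewrite big_cons -IH -(wfD sys); congr Fn.
by apply: funext => x; rewrite big_cons.
Qed.

(* As J is closed, it is enough to compare both sides modulo h^m for each m. *)
Lemma quot_series (y : fps A) (G : nat -> ('I_n -> C) -> C) :
  (forall m, cl J (fpsC (y m)) = cl J (fn (fun x => fpsC (G m x)))) ->
  cl J y = cl J (fn (fun x => Fps (fun m => G m x))).
Proof.
move=> yG; apply/clP/asboolP; apply: closedJ => m.
set g := fn (fun x => Fps (fun m => G m x)).
set g' := fn (fun x => Fps (fun k => G (m + k)%N x)).
(* This agrees with y - g below h^m. Note that g' is not the tail of g, which is a single generator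
   labelled by a series-valued function; only modulo J does g split into m functions and h^m g'. *)
exists (y - g - fpsX C ^+ m *: (fps_tail m y - g')); last first.
  move=> k km; rewrite fpsDE fpsNE.
  by rewrite [X in _ = _ - X](@fpsXnZE C) km subr0.
apply: (@cl_eq0 (fps C)).
have Ey : cl J y = \sum_(k < m) fpsX C ^+ k *: Fn (fun x => fpsC (G k x)) +
    fpsX C ^+ m *: cl J (fps_tail m y).
  have {1}-> : y = _ := @fps_split C A m y.
  rewrite raddfD /= clZ (raddf_sum (cl J)); congr (_ + _).
  by apply: eq_bigr => k _; rewrite /= clZ yG.
have Eg : cl J g = \sum_(k < m) fpsX C ^+ k *: Fn (fun x => fpsC (G k x)) +
    fpsX C ^+ m *: cl J g'.
  rewrite -[cl J g]/(Fn _) -[cl J g']/(Fn _) -FnZ.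
  under eq_bigr => k _ do rewrite -FnZ.
  rewrite -Fn_sum -(wfD sys); congr Fn; apply: funext => x.
  exact: (@fps_split C C^o m (Fps (G^~ x))).
rewrite !raddfB /= !clZ Ey Eg; set S := \sum_(_ < _) _.
by rewrite -opprD [S + _]addrC addrKA subrr.
Qed.

(** The coefficients of [g] are polynomials in g, up to the common scalar series, hence functions of
    the N_i modulo J; [quot_series] sums them up. *)
Lemma quot_bracket (g : A) (w : ('I_n -> C) -> C) :
  cl J (fpsC g) = cl J (fn (fun x => fpsC (w x))) ->
  cl J (h_bracket g) = cl J (fn (fun x => h_qint (w x))).
Proof.
move=> clg.
have FnX F m : Fn F ^+ m = Fn (fun x => F x ^+ m).
  elim: m => [|m IH]; first by rewrite expr0 -(wf1 sys).
  by rewrite exprS IH -(wfM sys); congr Fn; apply: funext => x; rewrite exprS.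
have FnN F : - Fn F = Fn (fun x => - F x).
  by rewrite -scaleN1r -FnZ; congr Fn; apply: funext => x; rewrite mulN1r.
rewrite /h_bracket clZ.
rewrite (_ : cl J _ = Fn (fun x => divh (h_qpow (w x : C^o) - h_qpow (- w x : C^o)))).
  by rewrite -FnZ.
apply: quot_series => m.
set c : C := 2 ^- m.+1 / m.+1`!%:R.
rewrite -[divh _ m]/(c *: g ^+ m.+1 - c *: (- g) ^+ m.+1).
rewrite (_ : (fun x => _) = fun x => fpsC c * fpsC (w x) ^+ m.+1 - fpsC c * (- fpsC (w x)) ^+ m.+1).
  have clM (z : A) : cl J (fpsC (c *: z ^+ m.+1)) = fpsC c *: cl J (fpsC z) ^+ m.+1.
    by rewrite fpsCZ clZ (rmorphXn (@fpsC A)) (rmorphXn (cl J)).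
  rewrite (raddfB (@fpsC A)) (raddfB (cl J)) /= !clM (raddfN (@fpsC A)) (raddfN (cl J)) /= clg.
  rewrite -[cl J (fn _)]/(Fn _) FnN !FnX -[X in X - _]FnZ -[X in _ - X]FnZ.
  by rewrite -(fnB sys).
apply: funext => x; rewrite -(rmorphN (@fpsC C)) -!(rmorphXn (@fpsC C)) -!(rmorphM (@fpsC C)).
by rewrite -(rmorphB (@fpsC C)).
Qed.

End FormalQuotient.

Section FormalMorphism.
Variables (R : realType) (n : nat) (p : R[i]) (alpha beta : R[i] -> fps R[i]).
Local Notation C := R[i].
Local Notation W' := (free_alg C (Wgen n C (fps C))).
Local Notation J := (hW_ideal R n).
Hypothesis alphaP : forall x, alpha x ^+ 2 = h_qratio x.
Hypothesis betaP : forall x, beta x ^+ 2 = h_qint x.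

Let ap i : fps W' := fpsC (gen (GenAp i)).
Let am i : fps W' := fpsC (gen (GenAm i)).
Let fn F : fps W' := fpsC (gen (GenFn F)).
Let sys := quot_weyl_system (@closed_ideal_gen_sub W' (@hW_rel R n)).
Let gens := HP_gen (@fpsC C) ap am fn p alpha beta.

Let Psi : {rmorphism fps (free_alg C (Ugen n)) -> hW R n} := cl J \o series_lift gens.

Let PsiE u : Psi (fpsC (gen u)) = cl J (gens u).
Proof. by rewrite /= series_lift_gen. Qed.

Let PsiHP := @HP_genP _ _ (@fpsC C) n (fps W') ap am fn p alpha beta _ (cl J)
  (fpsC p *: (1 : hW R n)) sys (esym (quot_fn_cst (@closed_ideal_gen_sub W' (@hW_rel R n)) (fpsC p))).

Let Psi_bracket i : Psi (h_bracket (gen (GenH i))) = hW_fn (fun x => h_qint (weight p i x)).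
Proof.
have gE : series_lift gens (fpsC (gen (GenH i))) = fpsC (gen (GenFn (fun x => fpsC (weight p i x)))).
  exact: series_lift_gen.
rewrite /= (rmorph_bracket (@series_liftZ _ _ _ gens) (@series_lift_coef _ _ _ gens) gE).
apply: (@quot_bracket R n W' J ap am fn) => //; [exact: closed_ideal_gen_sub|exact: closed_ideal_gen_closed].
Qed.

Let Psi_rel x : @hU_rel R n x -> Psi x = 0.
Proof.
have [hh0 hhS [he0 heS hf0 hfS]] := PsiHP.
apply: (@Uq_rel_HP _ _ (@fpsC C) n (hW R n) _ _ _ sys p alpha beta (@h_qint R)
  (h_q R + h_qV R) _ _ _ _ (fun i => cl J (gens (GenE i))) (fun i => cl J (gens (GenF i)))
  he0 heS hf0 hfS _ _ _ _ _ _ _ Psi).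
- by move=> y; rewrite alphaP h_qratioP.
- exact: betaP.
- exact: h_qint_rec.
- exact: h_qint_ef.
- exact: h_qqV.
- by [].
- move=> c y; rewrite /= series_liftZ clZ; apply/esym.
  exact: (quot_fn_scale (@closed_ideal_gen_sub W' (@hW_rel R n))).
- by move=> i; rewrite PsiE.
- by move=> i; rewrite PsiE.
- by move=> i; rewrite PsiE.
- exact: Psi_bracket.
Qed.

Let Psi_ideal x : hU_ideal R n x -> Psi x = 0.
Proof.
apply: closed_ideal_gen_ker; [exact: raddfB|split; [exact: rmorph1|exact: rmorphM]| |exact: Psi_rel].
(* The lift carries approximations of y to approximations of its image, and the target ideal is
   closed. *)
move=> y yP; apply: (@cl0 (fps C)); apply: closed_ideal_gen_closed => m.
have [z z0 yz] := yP m; exists (series_lift gens z); first exact: (@cl_eq0 (fps C)).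
by move=> k km; apply: (@series_lift_local _ _ _ gens y z m).
Qed.

Let pi : hU R n -> hW R n := quot_fact Psi.

Let piE x : pi (cl (hU_ideal R n) x) = Psi x.
Proof. exact: (@quot_factE (fps C) _ (hU_ideal R n) (hW R n) Psi x Psi_ideal). Qed.

Lemma formal_pi_exists : exists pi : hU R n -> hW R n, hHP p alpha beta pi.
Proof.
exists pi; split.
  split.
    move=> c; elim/cl_ind=> x; elim/cl_ind=> y.
    by rewrite -clZ -raddfD !piE raddfD /= series_liftZ clZ.
  split; first by rewrite -(rmorph1 (cl (hU_ideal R n))) piE rmorph1.
  by elim/cl_ind=> x; elim/cl_ind=> y; rewrite -rmorphM !piE rmorphM.
have [hh0 hhS [he0 heS hf0 hfS]] := PsiHP.
split; last split.
- by move=> i i0; rewrite piE PsiE; exact: hh0.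
- by move=> i j ij; rewrite piE PsiE; exact: hhS.
- by move=> i i0; rewrite piE PsiE; exact: he0.
- by move=> i j ij; rewrite piE PsiE; exact: heS.
- by move=> i i0; rewrite piE PsiE; exact: hf0.
- by move=> i j ij; rewrite piE PsiE; exact: hfS.
Qed.

End FormalMorphism.

Section NumericMorphism.
Variables (R : realType) (n : nat) (p h : R[i]) (alpha beta : R[i] -> R[i]).
Local Notation C := R[i].
Local Notation W' := (free_alg C (Wgen n C C)).
Local Notation J := (@nW_ideal R n).
Hypothesis qroot : forall m, (0 < m)%N -> n_q h ^+ m != 1.
Hypothesis alphaP : forall x, alpha x ^+ 2 = n_qratio h x.
Hypothesis betaP : forall x, beta x ^+ 2 = n_qint h x.

Let ap i : W' := gen (GenAp i).
Let am i : W' := gen (GenAm i).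
Let fn F : W' := gen (GenFn F).
Let relJ := @ideal_gen_sub W' (@nW_rel R n).
Let sys : weyl_system ((idfun : {rmorphism C -> C}) : C -> C)
    (fun i => cl J (ap i)) (fun i => cl J (am i)) (fun F => cl J (fn F)) :=
  quot_weyl_system relJ.

Let gens (u : nUgen n) : W' :=
  match u with
  | GenU u => HP_gen idfun ap am fn p alpha beta u
  | GenK i => fn (fun x => n_qpow h (weight p i x))
  | GenKV i => fn (fun x => n_qpow h (- weight p i x))
  end.

Let Psi : {rmorphism free_alg C (nUgen n) -> nW R n} := cl J \o alg_lift gens.

Let PsiE u : Psi (gen u) = cl J (gens u).
Proof. by rewrite /= alg_lift_gen. Qed.

Let PsiHP := @HP_genP _ _ idfun n W' ap am fn p alpha beta _ (cl J)
  (p *: (1 : nW R n)) sys (esym (quot_fn_cst relJ p)).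

Let PsiB x y : Psi (x - y) = Psi x - Psi y.
Proof. exact: raddfB. Qed.

Let PsiZ c x : Psi (c *: x) = c *: Psi x.
Proof. by rewrite /= alg_liftZ clZ. Qed.

Let e i : nW R n := cl J (gens (GenU (GenE i))).
Let f i : nW R n := cl J (gens (GenU (GenF i))).
Let Fn F : nW R n := cl J (fn F).

Let FnZ c F : Fn (fun x => c * F x) = c *: Fn F.
Proof. by rewrite /Fn (wfM sys) (quot_fn_scale relJ). Qed.

Let Psi_cst c x : Psi (c *: x) = Fn (fun=> c) * Psi x.
Proof. by rewrite PsiZ; apply/esym/(quot_fn_scale relJ). Qed.

Let br i : free_alg C (nUgen n) := (n_q h - (n_q h)^-1)^-1 *: (gen (GenK i) - gen (GenKV i)).

Let Psi_br i : Psi (br i) = Fn (fun x => n_qint h (weight p i x)).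
Proof.
rewrite PsiZ PsiB (PsiE (GenK i)) (PsiE (GenKV i)) -[X in _ *: X](fnB sys) -[LHS]FnZ.
by congr Fn; apply: funext => x; rewrite /n_qint mulrC.
Qed.

Let pw_shift x (c : int) : n_qpow h (x + c%:~R) = n_q h ^ c * n_qpow h x.
Proof. by rewrite n_qpowD n_qpow_int mulrC. Qed.

Let Psi_rel x : @nU_rel R n (n_q h) x -> Psi x = 0.
Proof.
have [_ _ [he0 heS hf0 hfS]] := PsiHP.
have Psi_h i : Psi (gen (GenU (GenH i))) = Fn (fun x => weight p i x) by exact: PsiE.
have Psi_e i : Psi (gen (GenU (GenE i))) = e i by exact: PsiE.
have Psi_f i : Psi (gen (GenU (GenF i))) = f i by exact: PsiE.
have Psi_k i : Psi (gen (GenK i)) = Fn (fun x => n_qpow h (weight p i x)) by exact: PsiE.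
have Psi_kV i : Psi (gen (GenKV i)) = Fn (fun x => n_qpow h (- weight p i x)) by exact: PsiE.
case=> {x}.
- apply: (@Uq_rel_HP _ _ idfun n (nW R n) _ _ _ sys p alpha beta (n_qint h)
    (n_q h + (n_q h)^-1) _ _ _ _ e f he0 heS hf0 hfS _ _ _ _ _ _ _ Psi _ _ Psi_cst Psi_h Psi_e Psi_f Psi_br).
  + by move=> y; rewrite alphaP n_qratioP.
  + exact: betaP.
  + exact: n_qint_rec.
  + exact: n_qint_ef.
  + by rewrite mulfV // n_qpow_neq0.
  + by [].
- move=> i; exact: (rel_kkV sys (n_qpowNM h) Psi_k Psi_kV i).
- move=> i; exact: (rel_kVk sys (n_qpowNM h) Psi_k Psi_kV i).
- move=> i j; exact: (rel_kk sys Psi_k i j).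
- move=> i j; exact: (rel_kh sys Psi_h Psi_k i j).
- move=> i j; exact: (rel_ke sys he0 heS Psi_cst Psi_e pw_shift Psi_k i j).
- move=> i j; exact: (rel_kf sys hf0 hfS Psi_cst Psi_f pw_shift Psi_k i j).
Qed.

Let Psi_ideal x : @nU_ideal R n (n_q h) x -> Psi x = 0.
Proof.
by apply: ideal_gen_ker; [exact: raddfB|split; [exact: rmorph1|exact: rmorphM]|exact: Psi_rel].
Qed.

Let pi : nU n (n_q h) -> nW R n := quot_fact Psi.

Let piE x : pi (cl (nU_ideal n (n_q h)) x) = Psi x.
Proof. exact: (@quot_factE C _ (nU_ideal n (n_q h)) (nW R n) Psi x Psi_ideal). Qed.

Lemma numeric_pi_exists : exists pi : nU n (n_q h) -> nW R n, nHP p alpha beta pi.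
Proof.
exists pi; have [hh0 hhS [he0 heS hf0 hfS]] := PsiHP; split.
- split.
    move=> c; elim/cl_ind=> x; elim/cl_ind=> y.
    by rewrite -clZ -raddfD !piE raddfD /= alg_liftZ clZ.
  split; first by rewrite -(rmorph1 (cl (nU_ideal n (n_q h)))) piE rmorph1.
  by elim/cl_ind=> x; elim/cl_ind=> y; rewrite -rmorphM !piE rmorphM.
- split; last split.
  + by move=> i i0; rewrite piE PsiE; exact: hh0.
  + by move=> i j ij; rewrite piE PsiE; exact: hhS.
  + by move=> i i0; rewrite piE PsiE; exact: he0.
  + by move=> i j ij; rewrite piE PsiE; exact: heS.
  + by move=> i i0; rewrite piE PsiE; exact: hf0.
  + by move=> i j ij; rewrite piE PsiE; exact: hfS.
- move=> i i0; rewrite !piE !PsiE; split; congr Fn; apply: funext => x;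
    by rewrite /weight (ext0 _ _ i0).
- move=> i j ij; rewrite !piE !PsiE; split; congr Fn; apply: funext => x;
    by rewrite /weight (extS _ _ ij).
Qed.

End NumericMorphism.

(** * The Fock representation *)

Section EndomorphismAlgebra.
Variables (K : comNzRingType) (V : lmodType K).

(** Operators as elements of a type, which can carry a ring structure under composition and so
    receive the lift of the free algebra. *)
Record endo := Endo { endo_fun :> V -> V; endoP : linear endo_fun }.

Lemma endo_eq (f g : endo) : (forall v, f v = g v) -> f = g.
Proof.
case: f g => [f fP] [g gP] /= /funext fg; rewrite {}fg in fP *.
by congr Endo; apply: Prop_irrelevance.
Qed.

HB.instance Definition _ := gen_eqMixin endo.
HB.instance Definition _ := gen_choiceMixin endo.

Lemma endoD (f : endo) u v : f (u + v) = f u + f v.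
Proof. by rewrite -[u]scale1r endoP !scale1r. Qed.

Lemma endo0 (f : endo) : f 0 = 0.
Proof. by apply: (@addrI _ (f 0)); rewrite -endoD !addr0. Qed.

Lemma endoZ (f : endo) c v : f (c *: v) = c *: f v.
Proof. by rewrite -[c *: v]addr0 endoP endo0 addr0. Qed.

Fact endo_zero_linear : linear (fun _ : V => 0 : V).
Proof. by move=> c u v; rewrite scaler0 addr0. Qed.
Fact endo_id_linear : linear (fun v : V => v).
Proof. by []. Qed.
Fact endo_opp_linear (f : endo) : linear (fun v => - f v).
Proof. by move=> c u v; rewrite endoP opprD scalerN. Qed.
Fact endo_add_linear (f g : endo) : linear (fun v => f v + g v).
Proof. by move=> c u v; rewrite !endoP scalerDr addrACA. Qed.
Fact endo_scale_linear a (f : endo) : linear (fun v => a *: f v).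
Proof. by move=> c u v; rewrite endoP scalerDr !scalerA [a * c]mulrC. Qed.
Fact endo_comp_linear (f g : endo) : linear (fun v => f (g v)).
Proof. by move=> c u v; rewrite !endoP. Qed.

Definition endo_zero := Endo endo_zero_linear.
Definition endo_id := Endo endo_id_linear.
Definition endo_opp f := Endo (endo_opp_linear f).
Definition endo_add f g := Endo (endo_add_linear f g).
Definition endo_scale a f := Endo (endo_scale_linear a f).
Definition endo_comp f g := Endo (endo_comp_linear f g).

Fact endo_addA : associative endo_add.
Proof. by move=> f g k; apply: endo_eq => v /=; rewrite addrA. Qed.
Fact endo_addC : commutative endo_add.
Proof. by move=> f g; apply: endo_eq => v /=; rewrite addrC. Qed.
Fact endo_add0 : left_id endo_zero endo_add.
Proof. by move=> f; apply: endo_eq => v /=; rewrite add0r. Qed.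
Fact endo_addN : left_inverse endo_zero endo_opp endo_add.
Proof. by move=> f; apply: endo_eq => v /=; rewrite addNr. Qed.

HB.instance Definition _ := GRing.isZmodule.Build endo endo_addA endo_addC endo_add0 endo_addN.

(* [v0] makes the ring of endomorphisms nontrivial, which [nzRingType] demands. *)
Definition endo_of (v0 : V) (v0_nz : v0 != 0) : Type := endo.

Variables (v0 : V) (v0_nz : v0 != 0).
Local Notation E := (endo_of v0_nz).
HB.instance Definition _ := GRing.Zmodule.on E.

Fact endo_compA : associative (endo_comp : E -> E -> E).
Proof. by move=> f g k; apply: endo_eq. Qed.
Fact endo_comp1 : left_id (endo_id : E) endo_comp.
Proof. by move=> f; apply: endo_eq. Qed.
Fact endo_compr1 : right_id (endo_id : E) endo_comp.
Proof. by move=> f; apply: endo_eq. Qed.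
Fact endo_compDl : left_distributive (endo_comp : E -> E -> E) +%R.
Proof. by move=> f g k; apply: endo_eq. Qed.
Fact endo_compDr : right_distributive (endo_comp : E -> E -> E) +%R.
Proof. by move=> f g k; apply: endo_eq => v; apply: endoD. Qed.
Fact endo_id_nz : (endo_id : E) != 0.
Proof. by apply: contra_neq v0_nz => /(congr1 (fun f : endo => f v0)). Qed.

HB.instance Definition _ := GRing.Zmodule_isNzRing.Build E
  endo_compA endo_comp1 endo_compr1 endo_compDl endo_compDr endo_id_nz.

Fact endo_scaleA a b (f : E) : endo_scale a (endo_scale b f) = endo_scale (a * b) f :> E.
Proof. by apply: endo_eq => v /=; rewrite scalerA. Qed.
Fact endo_scale1 : left_id 1 (endo_scale : K -> E -> E).
Proof. by move=> f; apply: endo_eq => v /=; rewrite scale1r. Qed.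
Fact endo_scaleDr : right_distributive (endo_scale : K -> E -> E) +%R.
Proof. by move=> a f g; apply: endo_eq => v; rewrite /= scalerDr. Qed.
Fact endo_scaleDl (f : E) : {morph (endo_scale^~ f : K -> E) : a b / a + b}.
Proof. by move=> a b; apply: endo_eq => v; rewrite /= scalerDl. Qed.

HB.instance Definition _ := GRing.Zmodule_isLmodule.Build K E
  endo_scaleA endo_scale1 endo_scaleDr endo_scaleDl.

Fact endo_scaleAl a (f g : E) : a *: (f * g) = (a *: f) * g.
Proof. exact: endo_eq. Qed.
HB.instance Definition _ := GRing.Lmodule_isLalgebra.Build K E endo_scaleAl.

Fact endo_scaleAr a (f g : E) : a *: (f * g) = f * (a *: g).
Proof. by apply: endo_eq => v; rewrite [RHS]endoZ. Qed.
HB.instance Definition _ := GRing.Lalgebra_isAlgebra.Build K E endo_scaleAr.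

(** Series of operators rather than operators on V[[h]]: the target of [series_lift] is a ring of
    series, and its continuity is needed for the closed ideal. *)
Definition series_act (s : fps E) (v : fps V) : fps V :=
  Fps (fun m => \sum_(i < m.+1) (s i : endo) (v (m - i)%N)).

Lemma series_act_linear_r (s : fps E) : linear (series_act s).
Proof.
have D u v : series_act s (u + v) = series_act s u + series_act s v.
  apply: fpsP => m /=; rewrite -big_split; apply: eq_bigr => i _; exact: endoD.
move=> c u v; rewrite D; congr (_ + _); apply: fpsP => m.
rewrite [LHS](cauchyA (f := fun (f : endo) v => f v) (g := *:%R) (f' := fun (f : endo) v => f v)
  (g' := fun (f : E) a => a *: f : endo)).
- rewrite [RHS](cauchyA (f := *:%R) (g := fun (f : E) v => (f : endo) v)
    (f' := fun (f : endo) v => f v) (g' := fun a (f : E) => a *: f : endo)).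
  + apply: eq_bigr => k _; congr (endo_fun _ _).
    rewrite [RHS](reindex_inj rev_ord_inj) /=; apply: eq_bigr => i _.
    by rewrite subSS subKn // -ltnS.
  + exact: scaler0.
  + by move=> a x y; rewrite scalerDr.
  + by [].
  + by [].
  + by [].
- exact: endo0.
- by move=> f x y; apply: endoD.
- by [].
- by [].
- by move=> f a x; rewrite endoZ.
Qed.

Lemma series_act_linear_l (v : fps V) : linear (series_act^~ v).
Proof.
have D (s t : fps E) : series_act (s + t) v = series_act s v + series_act t v.
  by apply: fpsP => m /=; rewrite -big_split; apply: eq_bigr => i _.
move=> c s t; rewrite D; congr (_ + _); apply: fpsP => m.
rewrite [RHS](cauchyA (f := *:%R) (g := fun (f : E) v => (f : endo) v)
    (f' := fun (f : endo) v => f v) (g' := fun a (f : E) => a *: f : endo)) //.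
  exact: scaler0.
by move=> a x y; rewrite scalerDr.
Qed.

Lemma series_act1 v : series_act 1 v = v.
Proof.
apply: fpsP => m /=; rewrite big_ord_recl big1 ?addr0 ?subn0 //.
Qed.

Lemma series_actM (s t : fps E) v : series_act (s * t) v = series_act s (series_act t v).
Proof.
apply: fpsP => m; apply/esym.
apply: (cauchyA (f := fun (f : E) v => (f : endo) v) (g := fun (f : E) v => (f : endo) v)
  (f' := fun (f : endo) v => f v) (g' := fun f g : E => f * g)) => //.
- exact: endo0.
- by move=> f x y; apply: endoD.
Qed.

Lemma series_actC (f : E) v : series_act (fpsC f) (fpsC v) = fpsC ((f : endo) v).
Proof.
apply: fpsP => m /=; rewrite big_ord_recl big1 ?addr0 ?subn0 //=.
by case: eqP => // _; rewrite endo0.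
Qed.

Lemma series_act_coef (s : fps E) v m : series_act s (fpsC v) m = (s m : endo) v.
Proof.
rewrite /= big_ord_recr /= subnn eqxx big1 ?add0r // => i _.
by rewrite subn_eq0 leqNgt ltn_ord /= endo0.
Qed.

End EndomorphismAlgebra.

Section LinearExtension.
Variables (X : choiceType) (K : comNzRingType) (V : lmodType K) (g : X -> V).

Definition malg_ext (v : malg X K) : V := \sum_(k <- msupp v) mcoeff k v *: g k.

(** The sum may run over any finite set that contains the support, which gives u, v and c u + v a
    common range of summation. *)
Lemma malg_extEw (d : finSet X) (v : malg X K) : fsubset (msupp v) d ->
  malg_ext v = \sum_(k <- d) mcoeff k v *: g k.
Proof.
move=> le; rewrite [LHS](big_fset_incl _ le) => //= x xd /mcoeff_outdom ->.
by rewrite scale0r.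
Qed.

Lemma malg_ext_linear : linear malg_ext.
Proof.
move=> c u v; pose d := fsetU (fsetU (msupp u) (msupp v)) (msupp (c *: u + v)).
have du : fsubset (msupp u) d by rewrite /d -fsetUA fsubsetUl.
have dv : fsubset (msupp v) d by rewrite /d [fsetU (msupp u) _]fsetUC -fsetUA fsubsetUl.
rewrite (malg_extEw du) (malg_extEw dv) (@malg_extEw d) ?fsubsetUr //.
rewrite scaler_sumr -big_split; apply: eq_bigr => k _.
by rewrite mcoeffD mcoeffZ scalerDl scalerA.
Qed.

Lemma malg_extU k : malg_ext (mkmalgU k 1) = g k.
Proof. by rewrite (malg_extEw msuppU_le) big_seq_fset1 mcoeffUU scale1r. Qed.

End LinearExtension.

Lemma malg_sum (X : choiceType) (K : nzRingType) (v : malg X K) :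
  v = \sum_(k <- msupp v) mcoeff k v *: mkmalgU k 1.
Proof.
rewrite {1}(monalgE v); apply: eq_bigr => k _; apply/malgP => k'.
by rewrite mcoeffZ !mcoeffU mulrnAr mulr1.
Qed.

(** * Ladder operators on the states with given occupation numbers *)

Section Occupation.
Variables (R : realType) (n : nat).
Local Notation C := R[i].
Implicit Types (l : occ n) (i j : 'I_n).

Definition incr i l : occ n := [ffun j => (l j + (j == i))%N].
(** The subtraction is truncated: for l_i = 0 the result is l itself, and then the coefficient
    sqrt(l_i) of a_i^- vanishes. *)
Definition decr i l : occ n := [ffun j => (l j - (j == i))%N].

Lemma incrK i l : decr i (incr i l) = l.
Proof. by apply/ffunP => k; rewrite !ffunE addnK. Qed.

Lemma decrK i l : (0 < l i)%N -> incr i (decr i l) = l.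
Proof.
move=> li; apply/ffunP => k; rewrite !ffunE subnK //.
by case: eqP => // ->.
Qed.

Lemma incr_decr i j l : i != j -> decr i (incr j l) = incr j (decr i l).
Proof.
move=> ij; apply/ffunP => k; rewrite !ffunE.
by case: (eqVneq k i) => [->|]; rewrite ?(negPf ij) ?addn0 ?subn0.
Qed.

Lemma incr_incr i j l : incr i (incr j l) = incr j (incr i l).
Proof. by apply/ffunP => k; rewrite !ffunE addnAC. Qed.

Lemma decr_decr i j l : decr i (decr j l) = decr j (decr i l).
Proof. by apply/ffunP => k; rewrite !ffunE -!subnDA addnC. Qed.

Lemma sqrtC_nat2 (m : nat) : sqrtC (m%:R : C) * sqrtC m%:R = m%:R.
Proof. by rewrite -expr2 sqrtCK. Qed.

Definition natfun l : 'I_n -> C := fun i => (l i)%:R.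

Lemma natfun_incr i l : natfun (incr i l) = shift i 1 (natfun l).
Proof. by apply: funext => j; rewrite /natfun /shift ffunE natrD. Qed.

Lemma natfun_decr i l : (0 < l i)%N -> natfun (decr i l) = shift i (-1) (natfun l).
Proof.
move=> li; rewrite -{2}(decrK li) natfun_incr.
by apply: funext => j; rewrite /shift mulNrn addrK.
Qed.

Section KetAction.
Variables (K : comNzRingType) (iota : {rmorphism C -> K}) (V : lmodType K) (vec : occ n -> V).
Variables (T : lalgType K) (act : T -> V -> V).
Hypothesis actl : forall v, linear (act^~ v).
Hypothesis actr : forall x, linear (act x).
Hypothesis act1 : forall v, act 1 v = v.
Hypothesis actM : forall x y v, act (x * y) v = act x (act y v).
Variables (ap am : 'I_n -> T) (fn : (('I_n -> C) -> K) -> T).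
Hypothesis act_ap : forall i l, act (ap i) (vec l) = iota (sqrtC (l i).+1%:R) *: vec (incr i l).
Hypothesis act_am : forall i l, act (am i) (vec l) = iota (sqrtC (l i)%:R) *: vec (decr i l).
Hypothesis act_fn : forall F l, act (fn F) (vec l) = F (natfun l) *: vec l.

Let actlD v x y : act (x + y) v = act x v + act y v.
Proof. exact: (linD (actl v)). Qed.
Let actl0 v : act 0 v = 0.
Proof. exact: (lin0 (actl v)). Qed.
Let actlZ v c x : act (c *: x) v = c *: act x v.
Proof. exact: (linZ (actl v)). Qed.
Let actlN v x : act (- x) v = - act x v.
Proof. by apply/eqP; rewrite -subr_eq0 opprK -actlD addNr actl0. Qed.
Let actlB v x y : act (x - y) v = act x v - act y v.
Proof. by rewrite actlD actlN. Qed.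
Let actrZ x c v : act x (c *: v) = c *: act x v.
Proof. exact: linZ. Qed.

(** The products of ladder coefficients are l_i + 1 and l_i, which gives the commutator 1. The case
    l_i = 0, where [decr] does not undo [incr], is absorbed by sqrt(0) = 0. *)
Lemma Weyl_rel_ket x l : Weyl_rel iota ap am fn x -> act x (vec l) = 0.
Proof.
case=> {x}.
- move=> i j; rewrite !actlB !actM act_ap act_am !actrZ act_am act_ap !scalerA -!rmorphM.
  have [<-|ij] := eqVneq i j.
    rewrite ffunE eqxx addn1 incrK sqrtC_nat2 act1.
    have -> : iota (sqrtC (l i)%:R * sqrtC (decr i l i).+1%:R) *: vec (incr i (decr i l)) = iota (l i)%:R *: vec l.
      have [->|li] := posnP (l i); first by rewrite sqrtC0 mul0r rmorph0 !scale0r.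
      by rewrite decrK // ffunE eqxx subn1 prednK // sqrtC_nat2.
    rewrite -{3}[vec l]scale1r -!scalerBl -rmorphB -natr1 addrAC subrr add0r rmorph1 subrr scale0r //.
  rewrite !ffunE (negPf ij) eq_sym (negPf ij) addn0 subn0 incr_decr // mulrC subrr.
  by rewrite mulr0n actl0 subrr.
- move=> i j; rewrite !actlB !actM !act_ap !actrZ !act_ap !scalerA -!rmorphM incr_incr.
  rewrite !ffunE; have [->|ij] := eqVneq i j; first by rewrite subrr.
  by rewrite !addn0 mulrC subrr.
- move=> i j; rewrite !actlB !actM !act_am !actrZ !act_am !scalerA -!rmorphM decr_decr.
  rewrite !ffunE; have [->|ij] := eqVneq i j; first by rewrite subrr.
  by rewrite !subn0 mulrC subrr.
- by move=> c; rewrite actlB act_fn actlZ act1 subrr.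
- by move=> F G; rewrite actlB actlD !act_fn -scalerDl subrr.
- by move=> F G; rewrite actlB actM !act_fn actrZ act_fn scalerA [G _ * _]mulrC subrr.
- move=> i; rewrite actlB actM act_fn act_am actrZ act_ap scalerA -rmorphM /natfun.
  have [->|li] := posnP (l i); first by rewrite sqrtC0 mul0r rmorph0 !scale0r subr0.
  by rewrite decrK // ffunE eqxx subn1 prednK // sqrtC_nat2 subrr.
- move=> F j; rewrite actlB !actM act_ap act_fn !actrZ act_ap act_fn natfun_incr.
  by rewrite !scalerA mulrC subrr.
- move=> F j; rewrite actlB !actM act_am act_fn !actrZ act_am act_fn !scalerA.
  have [->|lj] := posnP (l j); first by rewrite sqrtC0 rmorph0 mulr0 mul0r !scale0r subr0.
  by rewrite natfun_decr // mulrC subrr.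
Qed.

Let actX_ap (i : 'I_n) l m : l i = 0%N ->
  act (ap i ^+ m) (vec l) = iota (sqrtC m`!%:R) *: vec [ffun j => if j == i then m else l j].
Proof.
move=> li0; elim: m => [|m IH].
  rewrite expr0 act1 sqrtC1 rmorph1 scale1r; congr vec.
  by apply/ffunP => j; rewrite ffunE; case: eqP => // ->.
rewrite exprS actM IH actrZ act_ap scalerA -rmorphM !ffunE eqxx.
rewrite -sqrtCM ?nnegrE ?ler0n // -natrM mulnC -factS; congr (_ *: vec _).
by apply/ffunP => j; rewrite !ffunE; case: eqP; rewrite ?addn1 ?addn0.
Qed.

(** The modes are filled one after the other; each is still empty when its turn comes, so it
    contributes exactly the factor sqrt(l_i!). *)
Lemma vec_vacuum l : vec l = iota (sqrtC (\prod_i (l i)`!%:R))^-1 *: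
  act (\prod_i ap i ^+ l i) (vec [ffun=> 0%N]).
Proof.
have E (r : seq 'I_n) : uniq r -> act (\prod_(i <- r) ap i ^+ l i) (vec [ffun=> 0%N]) =
    iota (sqrtC (\prod_(i <- r) (l i)`!%:R)) *: vec [ffun j => if j \in r then l j else 0%N].
  elim: r => [|a r IH] /=.
    by move=> _; rewrite !big_nil act1 sqrtC1 rmorph1 scale1r; congr vec; apply/ffunP => j; rewrite !ffunE.
  move=> /andP[ar ur]; rewrite !big_cons actM IH // actrZ actX_ap ?ffunE ?(negPf ar) //.
  have p0 : 0 <= \prod_(i <- r) (l i)`!%:R :> C by apply: prodr_ge0 => k _; rewrite ler0n.
  rewrite scalerA -rmorphM -sqrtCM ?nnegrE ?ler0n // mulrC.
  congr (_ *: vec _); apply/ffunP => j; rewrite !ffunE inE; case: eqP => // -> //.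
rewrite E ?index_enum_uniq // scalerA -rmorphM mulVf ?rmorph1 ?scale1r.
  by congr vec; apply/ffunP => j; rewrite ffunE mem_index_enum.
rewrite sqrtC_eq0; apply/prodf_neq0 => i _.
by rewrite pnatr_eq0 -lt0n fact_gt0.
Qed.

End KetAction.
End Occupation.

Section FockSpace.
Variables (R : realType) (n : nat).
Local Notation C := R[i].

Lemma ket_neq0 (l : occ n) : ket R l != 0.
Proof. by rewrite /ket monalgU_eq0 oner_eq0. Qed.

Local Notation E := (endo_of (ket_neq0 [ffun=> 0%N])).

Definition ket_op (g : occ n -> fock R n) : E := Endo (malg_ext_linear g).

Lemma ket_opE g l : (ket_op g : endo _) (ket R l) = g l.
Proof. exact: malg_extU. Qed.

Lemma endo_ket0 (f : endo (fock R n)) : (forall l, f (ket R l) = 0) -> forall v, f v = 0.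
Proof.
move=> f0 v; rewrite (malg_sum v); elim: (enum_fset _) => [|l r IH].
  by rewrite big_nil endo0.
by rewrite big_cons endoD endoZ f0 IH scaler0 addr0.
Qed.

Definition create (i : 'I_n) : E := ket_op (fun l => sqrtC (l i).+1%:R *: ket R (incr i l)).
Definition annihilate (i : 'I_n) : E := ket_op (fun l => sqrtC (l i)%:R *: ket R (decr i l)).
Definition diagonal (F : occ n -> C) : E := ket_op (fun l => F l *: ket R l).

Section Formal.
Local Notation T := (fps (free_alg C (Wgen n C (fps C)))).
Local Notation J := (hW_ideal R n).

(** A function F takes values in C[[h]], so F(N) becomes a series of diagonal operators, one for
    each power of h. *)
Definition h_gens (u : Wgen n C (fps C)) : fps E :=
  match u with
  | GenAp i => fpsC (create i)
  | GenAm i => fpsC (annihilate i)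
  | GenFn F => Fps (fun m => diagonal (fun l => F (natfun R l) m))
  end.

Let rho := series_lift h_gens.
Let act (s : T) (v : fps (fock R n)) := series_act (rho s) v.
Let vec (l : occ n) : fps (fock R n) := fpsC (ket R l).

Let actl v : linear (act^~ v).
Proof.
move=> c s t; rewrite /act /rho raddfD /= series_liftZ.
exact: series_act_linear_l.
Qed.
Let actr s : linear (act s). Proof. exact: series_act_linear_r. Qed.
Let act1 v : act 1 v = v.
Proof. by rewrite /act /rho rmorph1 series_act1. Qed.
Let actM s t v : act (s * t) v = act s (act t v).
Proof. by rewrite /act /rho rmorphM series_actM. Qed.
Let act_ap i l : act (fpsC (gen (GenAp i))) (vec l) = fpsC (sqrtC (l i).+1%:R) *: vec (incr i l).
Proof. by rewrite /act /rho series_lift_gen series_actC ket_opE fpsCZ. Qed.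
Let act_am i l : act (fpsC (gen (GenAm i))) (vec l) = fpsC (sqrtC (l i)%:R) *: vec (decr i l).
Proof. by rewrite /act /rho series_lift_gen series_actC ket_opE fpsCZ. Qed.
Let act_fn F l : act (fpsC (gen (GenFn F))) (vec l) = F (natfun R l) *: vec l.
Proof.
rewrite /act /rho series_lift_gen; apply: fpsP => m.
by rewrite series_act_coef ket_opE fpsZC.
Qed.

Let rho_rel x : @hW_rel R n x -> rho x = 0.
Proof.
move=> xr; apply: fpsP => m; apply: endo_eq; apply: endo_ket0 => l.
rewrite -series_act_coef -/(act x _) -/(vec l).
by rewrite (Weyl_rel_ket (iota := @fpsC C) actl actr act1 actM act_ap act_am act_fn).
Qed.

Let rho_ideal x : J x -> rho x = 0.
Proof.
apply: closed_ideal_gen_ker; [exact: raddfB|split; [exact: rmorph1|exact: rmorphM]| |exact: rho_rel].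
(* The coefficient of index m of the image depends on the coefficients of y up to m, hence the
   approximation to order m + 1. *)
move=> y yP; apply: fpsP => m; have [z z0 yz] := yP m.+1.
by rewrite (series_lift_local h_gens yz) // -/rho z0.
Qed.

Let rhoW : hW R n -> fps E := quot_fact rho.

Let rhoWE x : rhoW (cl J x) = rho x.
Proof. exact: (@quot_factE (fps C) _ J (fps E) rho x rho_ideal). Qed.

Lemma formal_fock_exists : exists act, @h_fock_rep R n act.
Proof.
exists (fun u v => series_act (rhoW u) v); split.
- split.
  + move=> v c; elim/cl_ind => s; elim/cl_ind => t.
    by rewrite -clZ -raddfD !rhoWE; apply: actl.
  + by elim/cl_ind => s c u v; rewrite rhoWE; apply: actr.
  + by move=> v; rewrite -(rmorph1 (cl J)) rhoWE; apply: act1.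
  + by elim/cl_ind => s; elim/cl_ind => t v; rewrite -rmorphM !rhoWE; apply: actM.
- by move=> i; rewrite rhoWE -/(act _ _) -/(vec _) act_am ffunE sqrtC0 raddf0 scale0r.
- move=> l.
  have -> : \prod_i (@hW_ap R n i) ^+ l i = cl J (\prod_i (fpsC (gen (GenAp i)) : T) ^+ l i).
    by rewrite (rmorph_prod (cl J)); apply: eq_bigr => i _; rewrite (rmorphXn (cl J)).
  rewrite rhoWE.
  exact: (vec_vacuum (iota := @fpsC C) actr act1 actM act_ap).
- by move=> F l; rewrite rhoWE; apply: act_fn.
Qed.

End Formal.

Section Numeric.
Local Notation T := (free_alg C (Wgen n C C)).
Local Notation J := (@nW_ideal R n).

Definition n_gens (u : Wgen n C C) : E :=
  match u with
  | GenAp i => create i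
  | GenAm i => annihilate i
  | GenFn F => diagonal (fun l => F (natfun R l))
  end.

Let rho := alg_lift n_gens.
Let act (s : T) (v : fock R n) := (rho s : endo (fock R n)) v.

Let actl v : linear (act^~ v).
Proof. by move=> c s t; rewrite /act /rho raddfD /= alg_liftZ. Qed.
Let actr s : linear (act s). Proof. exact: endoP. Qed.
Let act1 v : act 1 v = v.
Proof. by rewrite /act /rho rmorph1. Qed.
Let actM s t v : act (s * t) v = act s (act t v).
Proof. by rewrite /act /rho rmorphM. Qed.
Let act_ap i l : act (gen (GenAp i)) (ket R l) = sqrtC (l i).+1%:R *: ket R (incr i l).
Proof. by rewrite /act /rho alg_lift_gen ket_opE. Qed.
Let act_am i l : act (gen (GenAm i)) (ket R l) = sqrtC (l i)%:R *: ket R (decr i l).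
Proof. by rewrite /act /rho alg_lift_gen ket_opE. Qed.
Let act_fn F l : act (gen (GenFn F)) (ket R l) = F (natfun R l) *: ket R l.
Proof. by rewrite /act /rho alg_lift_gen ket_opE. Qed.

Let rho_rel x : @nW_rel R n x -> rho x = 0.
Proof.
move=> xr; apply: endo_eq; apply: endo_ket0 => l.
by rewrite -/(act x _) (Weyl_rel_ket (iota := idfun) actl actr act1 actM act_ap act_am act_fn).
Qed.

Let rho_ideal x : J x -> rho x = 0.
Proof.
by apply: ideal_gen_ker; [exact: raddfB|split; [exact: rmorph1|exact: rmorphM]|exact: rho_rel].
Qed.

Let rhoW : nW R n -> E := quot_fact rho.

Let rhoWE x : rhoW (cl J x) = rho x.
Proof. exact: (@quot_factE C _ J E rho x rho_ideal). Qed.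

Lemma numeric_fock_exists : exists act, @n_fock_rep R n act.
Proof.
exists (fun u v => (rhoW u : endo (fock R n)) v); split.
- split.
  + move=> v c; elim/cl_ind => s; elim/cl_ind => t.
    by rewrite -clZ -raddfD !rhoWE; apply: actl.
  + by elim/cl_ind => s c u v; rewrite rhoWE; apply: actr.
  + by move=> v; rewrite -(rmorph1 (cl J)) rhoWE; apply: act1.
  + by elim/cl_ind => s; elim/cl_ind => t v; rewrite -rmorphM !rhoWE; apply: actM.
- by move=> i; rewrite rhoWE -/(act _ _) act_am ffunE sqrtC0 scale0r.
- move=> l.
  have -> : \prod_i (@nW_ap R n i) ^+ l i = cl J (\prod_i (gen (GenAp i) : T) ^+ l i).
    by rewrite (rmorph_prod (cl J)); apply: eq_bigr => i _; rewrite (rmorphXn (cl J)).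
  rewrite rhoWE.
  exact: (vec_vacuum (iota := idfun) actr act1 actM act_ap).
- by move=> F l; rewrite rhoWE; apply: act_fn.
Qed.

End Numeric.
End FockSpace.

(** * Matrix coefficients of the generators *)

Section HPAction.
Variables (R : realType) (n : nat).
Local Notation C := R[i].
Variables (K : comNzRingType) (iota : {rmorphism C -> K}) (A : lalgType K) (I : ideal A).
Variables (V : lmodType K) (vec : occ n -> V).
Variables (ap am : 'I_n -> quot_alg I) (fn : (('I_n -> C) -> K) -> quot_alg I).
Hypothesis sys : weyl_system iota ap am fn.
Hypothesis fn_cst : forall c, fn (fun=> c) = c *: (1 : quot_alg I).
Variable act : quot_alg I -> V -> V.
Hypothesis fockP : fock_representation iota vec ap am fn act.
Implicit Types (l : occ n) (i j : 'I_n).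

Let actP : representation act. Proof. by case: fockP. Qed.
Let actM a b v : act (a * b) v = act a (act b v). Proof. by case: actP. Qed.
Let act1 v : act 1 v = v. Proof. by case: actP => _ _ ->. Qed.
Let actr a : linear (act a). Proof. by case: actP. Qed.
Let actl v : linear (act^~ v). Proof. by case: actP. Qed.

Lemma act_0r a : act a 0 = 0.
Proof. exact: lin0. Qed.
Lemma act_scaler a c v : act a (c *: v) = c *: act a v.
Proof. exact: linZ. Qed.
Lemma act_addl a b v : act (a + b) v = act a v + act b v.
Proof. exact: (linD (actl v)). Qed.

Lemma act_fn_vec F l : act (fn F) (vec l) = F (natfun R l) *: vec l.
Proof. by case: fockP. Qed.

(** The states are given by the vacuum formula, in which a_i^+ raises one exponent; the coefficient
    is the quotient of the two normalizing roots. *)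
Lemma act_ap_vec i l : act (ap i) (vec l) = iota (sqrtC (l i).+1%:R) *: vec (incr i l).
Proof.
have [_ _ vecE _] := fockP; rewrite [in RHS]vecE {1}vecE act_scaler scalerA -rmorphM -actM.
have f0 (m : occ n) : 0 <= \prod_j (m j)`!%:R :> C.
  by apply: prodr_ge0 => k _; rewrite ler0n.
have fnz (m : occ n) : sqrtC (\prod_j (m j)`!%:R : C) != 0.
  by rewrite sqrtC_eq0; apply/prodf_neq0 => k _; rewrite pnatr_eq0 -lt0n fact_gt0.
have fE : \prod_j (incr i l j)`!%:R = (l i).+1%:R * \prod_j (l j)`!%:R :> C.
  rewrite (bigD1 i) // [in RHS](bigD1 i) //= mulrA -natrM ffunE eqxx addn1 factS; congr (_ * _).
  by apply: eq_bigr => j /negPf ji; rewrite ffunE ji addn0.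
congr (iota _ *: act _ _).
  rewrite fE sqrtCM ?nnegrE ?ler0n // invfM mulrA mulfV ?mul1r //.
  by rewrite sqrtC_eq0 pnatr_eq0.
have apX_comm (m : occ n) (r : seq 'I_n) : GRing.comm (ap i) (\prod_(j <- r) ap j ^+ m j).
  elim: r => [|a r IH]; first by rewrite big_nil; apply: commr1.
  by rewrite big_cons; apply: commrM IH; apply: commrX; apply: (wpp sys).
have E (r : seq 'I_n) : uniq r -> \prod_(j <- r) ap j ^+ incr i l j =
    (if i \in r then ap i else 1) * \prod_(j <- r) ap j ^+ l j.
  elim: r => [|a r IH] /=; first by rewrite !big_nil mul1r.
  move=> /andP[ar ur]; rewrite !big_cons IH // ffunE inE [i == a]eq_sym.
  have [ai|ai] := eqVneq a i.
    by rewrite ai in ar *; rewrite (negPf ar) addn1 exprS mul1r mulrA.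
  rewrite addn0 /=; case: ifP => _; rewrite ?mul1r // !mulrA; congr (_ * _).
  by apply/commr_sym/commrX/(wpp sys).
by rewrite E ?index_enum_uniq // mem_index_enum.
Qed.

(** If the mode i is empty, a_i^- commutes with all factors and reaches the vacuum. Otherwise the
    state is a multiple of a_i^+ applied to the lower one, and a_i^- a_i^+ = N_i + 1 acts there by
    l_i. *)
Lemma act_am_vec i l : act (am i) (vec l) = iota (sqrtC (l i)%:R) *: vec (decr i l).
Proof.
have [li0|li] := posnP (l i).
  rewrite li0 sqrtC0 rmorph0 scale0r.
  have [_ am0 vecE _] := fockP; rewrite vecE act_scaler -actM.
  suff E (r : seq 'I_n) : am i * (\prod_(j <- r) ap j ^+ l j) = \prod_(j <- r) ap j ^+ l j * am i.
    by rewrite E actM am0 act_0r scaler0.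
  elim: r => [|a r IH]; first by rewrite !big_nil mulr1 mul1r.
  rewrite !big_cons -mulrA -IH !mulrA; congr (_ * _).
  have [->|ai] := eqVneq a i; first by rewrite li0 mulr1 mul1r.
  by apply: commrX; rewrite /GRing.comm (wmp sys) eq_sym (negPf ai) addr0.
have lE : vec l = iota (sqrtC (l i)%:R)^-1 *: act (ap i) (vec (decr i l)).
  rewrite act_ap_vec decrK // ffunE eqxx subn1 prednK // scalerA -rmorphM mulVf ?rmorph1 ?scale1r //.
  by rewrite sqrtC_eq0 pnatr_eq0 -lt0n.
rewrite {1}lE act_scaler -actM (wmp sys) eqxx -(wnum sys) act_addl act_fn_vec mulr1n act1.
rewrite -[X in _ + X]scale1r -scalerDl -(rmorph1 iota) -rmorphD scalerA -rmorphM /natfun ffunE eqxx.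
rewrite subn1 natr1 prednK //; congr (iota _ *: _).
by rewrite -{2}(sqrtC_nat2 R (l i)) mulKf // sqrtC_eq0 pnatr_eq0 -lt0n.
Qed.

Variables (U : Type) (h e f : 'I_n -> U) (pi : U -> quot_alg I) (P : nat).
Variables (alpha beta : C -> K).
Hypothesis hp : HP_on_generators h e f ap am fn P%:R (iota P%:R *: (1 : quot_alg I)) alpha beta pi.

Lemma act_h_vec i l : act (pi (h i)) (vec l) = iota (weight P%:R i (natfun R l)) *: vec l.
Proof.
have [h0 hS _] := hp; have [i0|[j ij]] := ord_case i.
  by rewrite h0 // -fn_cst -(fn_weight0 P%:R sys i0) act_fn_vec.
by rewrite (hS _ _ ij) -(fn_weightS P%:R sys ij) act_fn_vec.
Qed.

Definition quanta l := (\sum_i l i)%N.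

(* Up to [step_coef i l], e_i maps the state l to [step i l], and f_i maps it back. *)
Definition step i l : occ n := if i == 0%N :> nat then decr i l else incr (ord_pred i) (decr i l).

Definition step_coef i l : K :=
  if i == 0%N :> nat then alpha (l i)%:R * beta (P%:R - (quanta l)%:R + 1) * iota (sqrtC (l i)%:R)
  else alpha (l (ord_pred i)).+1%:R * alpha (l i)%:R *
    iota (sqrtC (l (ord_pred i)).+1%:R * sqrtC (l i)%:R).

Lemma quanta_incr i l : quanta (incr i l) = (quanta l).+1.
Proof.
rewrite /quanta (bigD1 i) // [in RHS](bigD1 i) //= ffunE eqxx addn1 addSn; congr (_ + _).+1.
by apply: eq_bigr => j /negPf ji; rewrite ffunE ji addn0.
Qed.

Lemma quanta_decr i l : (0 < l i)%N -> (quanta (decr i l)).+1 = quanta l.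
Proof. by move=> li; rewrite -(quanta_incr i) decrK. Qed.

Lemma quanta_step0 i l : i = 0%N :> nat -> (0 < l i)%N -> (quanta (step i l)).+1 = quanta l.
Proof. by move=> i0 li; rewrite /step i0 quanta_decr. Qed.

Lemma quanta_stepS i j l : i = j.+1 :> nat -> (0 < l i)%N -> quanta (step i l) = quanta l.
Proof. by move=> ij li; rewrite /step ij quanta_incr quanta_decr. Qed.

Lemma natfun_sum l : \sum_i natfun R l i = (quanta l)%:R.
Proof. by rewrite /quanta natr_sum. Qed.

Lemma act_e_vec0 i l : l i = 0%N -> act (pi (e i)) (vec l) = 0.
Proof.
have [_ _ [e0 eS _ _]] := hp; move=> li; have [i0|[j ij]] := ord_case i.
  by rewrite e0 // actM act_am_vec li sqrtC0 rmorph0 scale0r act_0r.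
have ji : i != j by rewrite -val_eqE /= ij gtn_eqF.
by rewrite (eS _ _ ij) !actM act_ap_vec act_scaler act_am_vec ffunE li (negPf ji) sqrtC0 rmorph0 scale0r scaler0 act_0r.
Qed.

Lemma act_e_vec i l : (0 < l i)%N ->
  act (pi (e i)) (vec l) = step_coef i l *: vec (step i l).
Proof.
have [_ _ [e0 eS _ _]] := hp; move=> li; rewrite /step_coef /step; have [i0|[j ij]] := ord_case i.
  rewrite e0 // i0 actM act_am_vec act_scaler act_fn_vec scalerA mulrC natfun_sum.
  (* The function in e_1 is evaluated after the removal of a quantum, where p - N is P - quanta l +
     1. *)
  by rewrite -(quanta_decr li) /natfun ffunE eqxx subn1 natr1 prednK // -(natr1 (quanta (decr i l))) opprD addrA subrK.
have ji : i != j by rewrite -val_eqE /= ij gtn_eqF.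
rewrite (eS _ _ ij) (ord_predS ij) ij !actM act_ap_vec act_scaler act_am_vec !act_scaler act_fn_vec !scalerA.
rewrite incr_decr // /natfun !ffunE !eqxx [j == i]eq_sym (negPf ji) subn0 !addn0 addn1 subn1 natr1 prednK //.
by rewrite -rmorphM mulrC.
Qed.

Lemma act_f_vec0 i j l : i = j.+1 :> nat -> l j = 0%N -> act (pi (f i)) (vec l) = 0.
Proof.
have [_ _ [_ _ f0 fS]] := hp; move=> ij lj.
by rewrite (fS _ _ ij) !actM act_am_vec lj sqrtC0 rmorph0 scale0r !act_0r.
Qed.

(** The functions in e_i and f_i are evaluated at the end state, [step i l] for e_i and l for f_i.
    The shifts by 1 in their definitions make the two values equal, so that e_i and f_i are
    transposes of each other. *)
Lemma act_f_vec i l : (0 < l i)%N ->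
  act (pi (f i)) (vec (step i l)) = step_coef i l *: vec l.
Proof.
have [_ _ [_ _ f0 fS]] := hp; move=> li; rewrite /step_coef /step; have [i0|[j ij]] := ord_case i.
  rewrite f0 // i0 actM act_ap_vec decrK // act_scaler act_fn_vec scalerA mulrC natfun_sum.
  by rewrite ffunE eqxx subn1 prednK.
have ji : i != j by rewrite -val_eqE /= ij gtn_eqF.
rewrite (fS _ _ ij) (ord_predS ij) ij !actM act_am_vec incrK act_scaler act_ap_vec decrK // !act_scaler act_fn_vec !scalerA.
rewrite !ffunE eqxx [j == i]eq_sym (negPf ji) eqxx subn0 addn1 subn1 prednK // -rmorphM mulrC /natfun.
by rewrite natr1.
Qed.

(** The second case is the one in which f_i has no quantum to take and gives 0; it cannot occur for
    the first i. *)
Lemma stepP i l : (exists2 l' : occ n, (0 < l' i)%N & l = step i l') \/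
  (exists2 j : 'I_n, i = j.+1 :> nat & l j = 0%N).
Proof.
rewrite /step; have [i0|[j ij]] := ord_case i.
  left; exists (incr i l); first by rewrite ffunE eqxx addn1.
  by rewrite i0 incrK.
have ji : i != j by rewrite -val_eqE /= ij gtn_eqF.
have [lj|lj] := posnP (l j); first by right; exists j.
left; exists (incr i (decr j l)); first by rewrite ffunE eqxx addn1.
by rewrite ij (ord_predS ij) incrK decrK.
Qed.

End HPAction.

(** * Irreducibility *)

Section Box.
Variables (n P : nat).

(** A finite enumeration exists because no occupation number exceeds the total P. *)
Definition box : seq (occ n) :=
  [seq l <- [seq [ffun i => nat_of_ord (u i)] : occ n | u : {ffun 'I_n -> 'I_P.+1} <- enum {: {ffun 'I_n -> 'I_P.+1}}] | (quanta l <= P)%N].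

Lemma mem_box (l : occ n) : (l \in box) = (quanta l <= P)%N.
Proof.
rewrite mem_filter; case: leqP => //= lP; apply/mapP.
have li i : (l i < P.+1)%N.
  by rewrite ltnS (leq_trans _ lP) // /quanta (bigD1 i) //= leq_addr.
exists [ffun i => Ordinal (li i)]; first by rewrite mem_enum.
by apply/ffunP => i; rewrite !ffunE.
Qed.

Lemma box_uniq : uniq box.
Proof.
apply/filter_uniq; rewrite map_inj_uniq ?enum_uniq // => u v /ffunP uv.
by apply/ffunP => i; apply: val_inj; have := uv i; rewrite !ffunE.
Qed.

End Box.

Section Irreducibility.
Variables (R : realType) (n P : nat).
Local Notation C := R[i].
Implicit Types (l : occ n) (i j : 'I_n).

Let wt i l : C := weight P%:R i (natfun R l).

(* Equal weights force l_i - l'_i = d for all i, and then (n + 1) d = 0. *)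
Lemma weight_inj l l' : (forall i, wt i l = wt i l') -> l = l'.
Proof.
move=> wE; pose d : C := (quanta l')%:R - (quanta l)%:R.
have dE k i : (i : nat) = k -> (l i)%:R - (l' i)%:R = d.
  elim: k i => [|k IH] i ik.
    have := wE i; rewrite /wt /weight !ext0 // !natfun_sum /natfun /d => E.
    have -> : (l i)%:R = P%:R - (quanta l)%:R - (P%:R - (quanta l)%:R - (l i)%:R) :> C by ring.
    by rewrite E; ring.
  have kn : (k < n)%N by rewrite (leq_trans _ (ltn_ord i)) // ik.
  have := wE i; rewrite /wt /weight !(extS _ _ (ik : i = (Ordinal kn).+1 :> nat)) /natfun => E.
  rewrite -(IH (Ordinal kn) erefl).
  have -> : (l i)%:R = (l (Ordinal kn))%:R - ((l (Ordinal kn))%:R - (l i)%:R) :> C by ring.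
  by rewrite E; ring.
have d0 : d = 0.
  (* The differences l_i - l'_i sum up to n d, but also to - d by the definition of d. *)
  have : d *+ n.+1 = 0.
    have : \sum_i ((l i)%:R - (l' i)%:R) = d *+ n.
      by rewrite (eq_bigr (fun=> d)) ?sumr_const ?card_ord // => i _; exact: dE.
    rewrite sumrB -!natr_sum -/(quanta l) -/(quanta l') mulrS => <-.
    by rewrite /d addrA subrK subrr.
  by move/eqP; rewrite mulrn_eq0 => /orP[//|/eqP].
apply/ffunP => i; apply/eqP; rewrite -(eqr_nat C) -subr_eq0.
by rewrite (dE _ i erefl) d0.
Qed.

Variables (K : comNzRingType) (iota : {rmorphism C -> K}) (V : lmodType K) (vec : occ n -> V).
Hypothesis Kint : integral K.
Hypothesis iota_nz : forall c, c != 0 -> iota c != 0.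
Variables (H E F : 'I_n -> V -> V) (coef : 'I_n -> occ n -> K).
Hypothesis H_linear : forall i, linear (H i).
Hypothesis H_vec : forall i l, H i (vec l) = iota (wt i l) *: vec l.
Hypothesis E_vec : forall i l, (0 < l i)%N -> E i (vec l) = coef i l *: vec (step i l).
Hypothesis F_vec : forall i l, (0 < l i)%N -> F i (vec (step i l)) = coef i l *: vec l.
Hypothesis coef_nz : forall i l, (0 < l i)%N -> (quanta l <= P)%N -> coef i l != 0.
Variable M : set V.
Hypothesis M_submodule : submodule M.
Hypothesis M_sub : forall v, M v -> exists c : occ n -> K, v = \sum_(l <- box n P) c l *: vec l.
(** Nonzero scalars can be cancelled in front of basis vectors: over C this holds for every
    subspace, over C[[h]] it is the torsion-freeness in [h_irreducible]. *)
Hypothesis M_sat : forall c l, (quanta l <= P)%N -> c != 0 -> M (c *: vec l) -> M (vec l).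
Hypothesis M_H : forall i v, M v -> M (H i v).
Hypothesis M_E : forall i v, M v -> M (E i v).
Hypothesis M_F : forall i v, M v -> M (F i v).

Let HZ i c v : H i (c *: v) = c *: H i v.
Proof. exact: linZ. Qed.

Let HD i u v : H i (u + v) = H i u + H i v.
Proof. exact: linD. Qed.

Let H_sum i (c : occ n -> K) (s : seq (occ n)) :
  H i (\sum_(l <- s) c l *: vec l) = \sum_(l <- s) (iota (wt i l) * c l) *: vec l.
Proof.
elim: s => [|a s IH]; first by rewrite !big_nil -[X in H i X](scale0r 0) HZ scale0r.
by rewrite !big_cons HD HZ IH H_vec scalerA mulrC.
Qed.

(* [H i - wt i a] kills [vec a] but not [vec l0], as soon as the i-th weights of a and l0 differ. *)
Lemma separate (s : seq (occ n)) (c : occ n -> K) c0 l0 : l0 \notin s ->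
  M (c0 *: vec l0 + \sum_(l <- s) c l *: vec l) -> exists2 d, d != 0 & M ((d * c0) *: vec l0).
Proof.
elim: s c c0 => [|a s IH] c c0 l0s Mv.
  by exists 1; rewrite ?oner_neq0 // mul1r; move: Mv; rewrite big_nil addr0.
move: l0s; rewrite inE negb_or => /andP[l0a l0s].
have [i wi] : exists i, wt i l0 != wt i a.
  apply: contrapT => nw; case/eqP: l0a; apply: weight_inj => i.
  by apply: contrapT => /eqP wi; apply: nw; exists i.
have MH : M ((- iota (wt i a)) *: (c0 *: vec l0 + \sum_(l <- a :: s) c l *: vec l) +
             H i (c0 *: vec l0 + \sum_(l <- a :: s) c l *: vec l)).
  by apply: M_submodule.2 => //; apply: M_H.
have {}MH : M ((iota (wt i l0 - wt i a) * c0) *: vec l0 +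
    \sum_(l <- s) (iota (wt i l - wt i a) * c l) *: vec l).
  congr M: MH; rewrite HD HZ H_vec H_sum scalerDr addrACA !scalerA -scalerDl; congr (_ *: _ + _).
    by rewrite (rmorphB iota (wt i l0)); ring.
  rewrite scaler_sumr -big_split big_cons /= scalerA -scalerDl mulNr addNr scale0r add0r.
  apply: eq_bigr => l _; rewrite scalerA -scalerDl (rmorphB iota (wt i l)); congr (_ *: _); ring.
have [d d0 Md] := IH _ _ l0s MH.
(* The total factor is a product of differences of weights, one for each vector removed. *)
exists (d * iota (wt i l0 - wt i a)); last by rewrite -mulrA.
by apply: (integral_mul_neq0 Kint) => //; apply: iota_nz; rewrite subr_eq0.
Qed.

(* Every step of an e_i lowers the level, whose only zero is the vacuum. *)
Let level l := (\sum_(i < n) i.+1 * l i)%N.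

Let level_step i l : (0 < l i)%N -> (level (step i l) < level l)%N.
Proof.
have level_incr j m : level (incr j m) = (level m + j.+1)%N.
  rewrite /level (bigD1 j) // [in RHS](bigD1 j) //= ffunE eqxx mulnDr muln1 addnAC.
  congr (_ + _ + _)%N.
  by apply: eq_bigr => k /negPf kj; rewrite ffunE kj addn0.
move=> li; have lE : level l = (level (decr i l) + i.+1)%N by rewrite -level_incr decrK.
rewrite /step lE; have [i0|[j ij]] := ord_case i; first by rewrite i0 addn1.
by rewrite ij (ord_predS ij) level_incr ltn_add2l.
Qed.

Let step_le i l : (0 < l i)%N -> (quanta l <= P)%N -> (quanta (step i l) <= P)%N.
Proof.
move=> li lP; have [i0|[j ij]] := ord_case i; last by rewrite (quanta_stepS ij).
by rewrite (leq_trans _ lP) // -(quanta_step0 i0 li).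
Qed.

Let vac_or l : l = [ffun=> 0%N] \/ exists i, (0 < l i)%N.
Proof.
have [/existsP[i li]|] := boolP [exists i, (0 < l i)%N]; first by right; exists i.
rewrite negb_exists => /forallP l0; left; apply/ffunP => i.
by have := l0 i; rewrite ffunE lt0n negbK => /eqP.
Qed.

Let vac_M l : (quanta l <= P)%N -> M (vec l) -> M (vec [ffun=> 0%N]).
Proof.
have [m] := ubnP (level l); elim: m l => // m IH l lm lP Ml.
have [<- //|[i li]] := vac_or l.
apply: (IH (step i l)); [|exact: step_le|].
  by rewrite -ltnS (leq_trans _ lm) // ltnS level_step.
by apply: (M_sat _ (coef_nz li lP)); rewrite ?step_le // -E_vec //; apply: M_E.
Qed.

Let M_vac l : (quanta l <= P)%N -> M (vec [ffun=> 0%N]) -> M (vec l).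
Proof.
have [m] := ubnP (level l); elim: m l => // m IH l lm lP Mv.
have [-> //|[i li]] := vac_or l.
apply: (M_sat _ (coef_nz li lP)) => //; rewrite -F_vec //; apply: M_F; apply: IH => //.
  by rewrite -ltnS (leq_trans _ lm) // ltnS level_step.
exact: step_le.
Qed.

Lemma irreducible_vec v l : M v -> v != 0 -> (quanta l <= P)%N -> M (vec l).
Proof.
move=> Mv v0 lP; have [c vE] := M_sub Mv.
have [l0 l0b c0] : exists2 l0, l0 \in box n P & c l0 != 0.
  apply: contrapT => nc; case/eqP: v0; rewrite vE big_seq big1 // => l0 l0b.
  have [->|c0] := eqVneq (c l0) 0; first by rewrite scale0r.
  by case: nc; exists l0.
have [d d0 Md] : exists2 d, d != 0 & M ((d * c l0) *: vec l0).
  apply: (@separate (rem l0 (box n P)) c); first by rewrite mem_rem_uniqF // box_uniq.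
  by move: Mv; rewrite vE (perm_big _ (perm_to_rem l0b)) big_cons.
apply: M_vac => //; have l0P : (quanta l0 <= P)%N by rewrite -mem_box.
by apply: (vac_M l0P); apply: (M_sat l0P) Md; apply: integral_mul_neq0.
Qed.

End Irreducibility.

(** * Invariance of F_0 and F_1 *)

(** Induction on words, built up by multiplication from the left: enough for properties of an
    action, where the leftmost letter acts last. *)
Lemma free_ind (K : comNzRingType) (X : choiceType) (Q : free_alg K X -> Prop) :
  Q 0 -> (forall c x y, Q x -> Q y -> Q (c *: x + y)) -> Q 1 ->
  (forall a x, Q x -> Q (gen a * x)) -> forall x, Q x.
Proof.
move=> Q0 QD Q1 QM x; rewrite (malg_sum x); elim: (enum_fset _) => [|k r IH].
  by rewrite big_nil.
rewrite big_cons; apply: QD IH; case: k => s; elim: s => [|a s IHs].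
  by rewrite -fmoneE; exact: Q1.
have -> : mkmalgU (FMonom (a :: s)) (1 : K) = gen a * mkmalgU (FMonom s) 1 :> free_alg K X.
  rewrite -[RHS]/(fgmul (mkmalgU (fmu a) 1) (mkmalgU (FMonom s) 1)) fgmulUU mulr1.
  by congr mkmalgU; rewrite -[RHS]/(fmmul _ _) fmmulE fmuE.
exact: QM.
Qed.

(** The preimage of M under G is a submodule containing B, hence it contains the span. *)
Lemma span_stable (K : comNzRingType) (V : lmodType K) (B : set V) (W : lmodType K) (M : set W) (G : V -> W) :
  linear G -> submodule M -> (forall v, B v -> M (G v)) -> forall v, Defs.span B v -> M (G v).
Proof.
move=> Glin Ms BM v vB; apply: (vB [set v | M (G v)]%classic) => [|w /BM //]; split.
  by rewrite /= (lin0 Glin); exact: (submodule0 Ms).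
by move=> c x y Mx My; rewrite /= Glin; case: Ms => _; apply.
Qed.

Section KetStability.
Variables (R : realType) (n P : nat).
Implicit Types (l : occ n) (i j : 'I_n).
Variables (K : comNzRingType) (V : lmodType K) (vec : occ n -> V).

(** A vanishing image is covered as 0 times some ket of Q, for instance the ket of l itself. *)
Definition ket_stable (Q : occ n -> Prop) (G : V -> V) :=
  forall l, Q l -> exists2 m, Q m & exists c, G (vec l) = c *: vec m.

Lemma diag_stable Q G (w : occ n -> K) : (forall l, G (vec l) = w l *: vec l) -> ket_stable Q G.
Proof. by move=> Gw l Ql; exists l => //; exists (w l). Qed.

Variables (E F : 'I_n -> V -> V) (coef : 'I_n -> occ n -> K).
Hypothesis E_vec0 : forall i l, l i = 0%N -> E i (vec l) = 0.
Hypothesis E_vec : forall i l, (0 < l i)%N -> E i (vec l) = coef i l *: vec (step i l).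
Hypothesis F_vec0 : forall i j l, i = j.+1 :> nat -> l j = 0%N -> F i (vec l) = 0.
Hypothesis F_vec : forall i l, (0 < l i)%N -> F i (vec (step i l)) = coef i l *: vec l.
Hypothesis coef0 : forall i l, i = 0%N :> nat -> quanta l = P.+1 -> coef i l = 0.

Lemma E_stable0 i : ket_stable (fun l => (quanta l <= P)%N) (E i).
Proof.
move=> l lP; have [li|li] := posnP (l i).
  by exists l => //; exists 0; rewrite scale0r E_vec0.
exists (step i l); last by exists (coef i l); rewrite E_vec.
have [i0|[j ij]] := ord_case i; last by rewrite (quanta_stepS ij).
by rewrite (leq_trans _ lP) // -(quanta_step0 i0 li).
Qed.

Lemma E_stable1 i : ket_stable (fun l => (P < quanta l)%N) (E i).
Proof.
move=> l lP; have [li|li] := posnP (l i).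
  by exists l => //; exists 0; rewrite scale0r E_vec0.
have [i0|[j ij]] := ord_case i; last first.
  by exists (step i l); [rewrite (quanta_stepS ij)|exists (coef i l); rewrite E_vec].
(* The only step that would leave F_1 is that of e_1 from the level P + 1, and its coefficient is
   0. *)
have [lP1|lP1] := eqVneq (quanta l) P.+1.
  by exists l => //; exists 0; rewrite E_vec // coef0 // !scale0r.
exists (step i l); last by exists (coef i l); rewrite E_vec.
by rewrite -ltnS (quanta_step0 i0 li) ltn_neqAle eq_sym lP1.
Qed.

Lemma F_stable0 i : ket_stable (fun l => (quanta l <= P)%N) (F i).
Proof.
move=> l lP; have [[l' li lE]|[j ij lj]] := stepP i l; last first.
  by exists l => //; exists 0; rewrite scale0r (F_vec0 ij).
have [i0|[j ij]] := ord_case i; last first.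
  exists l'; first by rewrite -(quanta_stepS ij li) -lE.
  by exists (coef i l'); rewrite lE F_vec.
(* The same coefficient prevents f_1 from leaving F_0 at the level P. *)
have [lP1|lP1] := eqVneq (quanta l') P.+1.
  by exists l => //; exists 0; rewrite lE F_vec // coef0 // !scale0r.
exists l'; last by exists (coef i l'); rewrite lE F_vec.
by rewrite -ltnS ltn_neqAle lP1 -(quanta_step0 i0 li) -lE ltnS.
Qed.

Lemma F_stable1 i : ket_stable (fun l => (P < quanta l)%N) (F i).
Proof.
move=> l lP; have [[l' li lE]|[j ij lj]] := stepP i l; last first.
  by exists l => //; exists 0; rewrite scale0r (F_vec0 ij).
exists l'; last by exists (coef i l'); rewrite lE F_vec.
have [i0|[j ij]] := ord_case i; last by rewrite -(quanta_stepS ij li) -lE.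
by rewrite -(quanta_step0 i0 li) -lE ltnW.
Qed.

End KetStability.

Section Boxes.
Variables (R : realType) (n P : nat).
Local Notation C := R[i].

Lemma fock0_sum (x : fock R n) : fock0 P x -> x = \sum_(l <- box n P) mcoeff l x *: ket R l.
Proof.
move=> xP; apply: (xP [set x | x = \sum_(l <- box n P) mcoeff l x *: ket R l]%classic) => [|v [l lP ->]].
  split=> [|c u v /= uE vE]; first by rewrite /= big1 // => l _; rewrite mcoeff0 scale0r.
  rewrite {1}uE {1}vE scaler_sumr -big_split; apply: eq_bigr => l _.
  by rewrite mcoeffD mcoeffZ scalerDl scalerA.
rewrite /= (bigD1_seq l) ?box_uniq ?mem_box //= big1 ?addr0 ?mcoeffUU ?scale1r //.
by move=> m ml; rewrite mcoeffU eq_sym (negPf ml) scale0r.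
Qed.

Lemma fock0_ket (l : occ n) : (quanta l <= P)%N -> @fock0 R n P (ket R l).
Proof. by move=> lP; apply: span_sub; exists l. Qed.

Lemma fock0_spanned : finitely_spanned (@fock0 R n P).
Proof.
exists [seq ket R l | l <- box n P]; congr Defs.span; apply/seteqP; split=> v /=.
  by move=> [l lP ->]; apply: map_f; rewrite mem_box.
by move=> /mapP[l]; rewrite mem_box => lP ->; exists l.
Qed.

Lemma h_ext_submodule (M : set (fock R n)) : submodule M -> submodule (h_ext M).
Proof.
move=> Ms; split=> [m|c x y Mx My m]; first exact: (submodule0 Ms).
apply: (submoduleD Ms); last exact: My.
apply: (submodule_sum Ms) => i _; apply: (submoduleZ _ Ms); exact: Mx.
Qed.

(** As F_0 has a finite basis, the coefficients of each ket in all powers of h can be gathered into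
    one series. *)
Lemma h_fock0_sum (v : fps (fock R n)) : h_ext (fock0 P) v ->
  exists c : occ n -> fps C, v = \sum_(l <- box n P) c l *: fpsC (ket R l).
Proof.
move=> v0; exists (fun l => Fps (fun m => mcoeff l (v m))); apply: fpsP => m.
rewrite fps_sumE {1}(fock0_sum (v0 m)); apply: eq_bigr => l _.
by rewrite fpsZC.
Qed.

Lemma h_fock0_ket (l : occ n) : (quanta l <= P)%N -> h_ext (@fock0 R n P) (fpsC (ket R l)).
Proof.
move=> lP m /=; case: eqP => _; first exact: fock0_ket.
exact: (submodule0 (span_submodule _)).
Qed.

Lemma h_fock0_spanned : finitely_spanned (h_ext (@fock0 R n P)).
Proof.
exists [seq fpsC (ket R l) | l <- box n P]; apply/seteqP; split=> v /=.
  move=> /h_fock0_sum[c ->]; apply: (submodule_sum (span_submodule _)) => l lb.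
  by apply: (submoduleZ _ (span_submodule _)); apply: span_sub; apply: map_f.
move=> vB; apply: (vB (h_ext (@fock0 R n P))); first exact/h_ext_submodule/span_submodule.
by move=> w /mapP[l]; rewrite mem_box => lP ->; apply: h_fock0_ket.
Qed.

Lemma n_ket_stable (Q : occ n -> Prop) (G : fock R n -> fock R n) :
  linear G -> ket_stable (@ket R n) Q G ->
  forall v, Defs.span [set v | exists2 l, Q l & v = ket R l]%classic v ->
    Defs.span [set v | exists2 l, Q l & v = ket R l]%classic (G v).
Proof.
move=> Glin QG; apply: span_stable => //; first exact: span_submodule.
move=> _ [l Ql ->]; have [m Qm [c ->]] := QG l Ql.
by apply: (submoduleZ _ (span_submodule _)); apply: span_sub; exists m.
Qed.

(** An element of M[[h]] need not be a finite combination of kets over C[[h]], since each power of h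
    may bring new ones. But the coefficient of index m of G v depends only on v modulo h^(m+1), as G
    is C[[h]]-linear. *)
Lemma h_ket_stable (Q : occ n -> Prop) (G : fps (fock R n) -> fps (fock R n)) :
  linear G -> ket_stable (fun l => fpsC (ket R l)) Q G ->
  forall v, h_ext (Defs.span [set v | exists2 l, Q l & v = ket R l]%classic) v ->
    h_ext (Defs.span [set v | exists2 l, Q l & v = ket R l]%classic) (G v).
Proof.
move=> Glin QG v; set B := [set _ | _]%classic => Mv m.
have hs := h_ext_submodule (span_submodule B).
have GC x : Defs.span B x -> h_ext (Defs.span B) (G (fpsC x)).
  move=> xB; apply: (xB [set x | h_ext (Defs.span B) (G (fpsC x))]%classic).
    split=> [|c u w /= hu hw]; first by rewrite /= raddf0 (lin0 Glin); apply: (submodule0 hs).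
    by rewrite raddfD /= fpsCZ Glin; apply: (submoduleD hs) => //; apply: (submoduleZ _ hs).
  move=> _ [l Ql ->] /=; have [k Qk [c ->]] := QG l Ql; apply: (submoduleZ _ hs).
  move=> j /=; case: eqP => _; first by apply: span_sub; exists k.
  exact: (submodule0 (span_submodule _)).
rewrite (@fps_split C _ m.+1 v) (linD Glin) (linZ Glin) fpsDE (@fpsXnZE C) ltnSn addr0.
rewrite (lin_sum Glin).
have : h_ext (Defs.span B) (\sum_(k < m.+1) G (fpsX C ^+ k *: fpsC (v k))).
  apply: (submodule_sum hs) => k _; rewrite (linZ Glin).
  by apply: (submoduleZ _ hs); apply: GC; apply: Mv.
exact.
Qed.

End Boxes.

(** * Zeros of the matrix coefficients *)

Section StepCoefficients.
Variables (R : realType) (n P : nat).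
Local Notation C := R[i].
Variables (K : comNzRingType) (iota : {rmorphism C -> K}) (alpha beta : C -> K).
Hypothesis Kint : integral K.
Hypothesis iota_nz : forall c, c != 0 -> iota c != 0.
Hypothesis alpha_nz : forall m : nat, alpha m.+1%:R != 0.
Hypothesis beta_nz : forall m : nat, beta m.+1%:R != 0.
Hypothesis beta0 : beta 0 = 0.

(* The factor beta(P - N) of e_1 vanishes on the level N = P that e_1 reaches from N = P + 1. *)
Lemma step_coef0 (i : 'I_n) (l : occ n) : i = 0%N :> nat -> quanta l = P.+1 ->
  step_coef iota P alpha beta i l = 0.
Proof.
by move=> i0 lP; rewrite /step_coef i0 lP -natr1 opprD addrA subrr add0r addNr beta0 mulr0 mul0r.
Qed.

(** On F_0 the argument P - quanta l + 1 of beta is a positive integer, and so are those of alpha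
    because l_i > 0. *)
Lemma step_coef_neq0 (i : 'I_n) (l : occ n) : (0 < l i)%N -> (quanta l <= P)%N ->
  step_coef iota P alpha beta i l != 0.
Proof.
move=> li lP; have sq (m : nat) : sqrtC (m.+1%:R : C) != 0 by rewrite sqrtC_eq0 pnatr_eq0.
rewrite /step_coef -(prednK li); case: ifP => _.
  rewrite -natrB // natr1.
  by do !apply: (integral_mul_neq0 Kint) => //; apply: iota_nz.
by do !apply: (integral_mul_neq0 Kint) => //; apply: iota_nz; rewrite mulf_neq0.
Qed.

End StepCoefficients.

Section StableAction.
Variables (K : comNzRingType) (A : lalgType K) (X : Type) (g : X -> A).
Hypothesis A_ind : forall Q : A -> Prop, Q 0 ->
  (forall c x y, Q x -> Q y -> Q (c *: x + y)) -> Q 1 -> (forall a x, Q x -> Q (g a * x)) ->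
  forall x, Q x.

Lemma quot_stable (I : ideal A) (V : lmodType K) (rho : quot_alg I -> V -> V) (S : set V) :
  (forall v, linear (rho^~ v)) -> (forall v, rho 1 v = v) ->
  (forall u w v, rho (u * w) v = rho u (rho w v)) ->
  submodule S -> (forall a v, S v -> S (rho (cl I (g a)) v)) -> is_invariant rho S.
Proof.
move=> rlin r1 rM Ss gS u; elim/cl_ind: u => x; move: x; apply: A_ind.
- by move=> v Sv; rewrite raddf0 (lin0 (rlin v)); apply: submodule0.
- move=> c x y Sx Sy v Sv; rewrite raddfD /= clZ rlin.
  by apply: (submoduleD Ss); [apply: (submoduleZ _ Ss); apply: Sx|apply: Sy].
- by move=> v Sv; rewrite rmorph1 r1.
- by move=> a x Sx v Sv; rewrite rmorphM rM; apply: gS; apply: Sx.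
Qed.

(** The generators control the polynomials in them, while u is the class of a series. Linearity in u
    over K[[h]] shows that the coefficient of index m of the result only involves u modulo
    h^(m+1). *)
Lemma series_quot_stable (I : ideal (fps A)) (V : lmodType K)
    (rho : quot_alg I -> fps V -> fps V) (M : set V) (S := [set v : fps V | forall m, M (v m)]%classic) :
  (forall v, linear (rho^~ v)) -> (forall v, rho 1 v = v) ->
  (forall u w v, rho (u * w) v = rho u (rho w v)) ->
  submodule S -> (forall a v, S v -> S (rho (cl I (fpsC (g a))) v)) -> is_invariant rho S.
Proof.
move=> rlin r1 rM Ss gS u v Sv m; elim/cl_ind: u => s.
have poly x : forall v, S v -> S (rho (cl I (fpsC x)) v).
  move: x; apply: A_ind.
  - by move=> w Sw; rewrite !raddf0 (lin0 (rlin w)); apply: submodule0.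
  - move=> c x y Sx Sy w Sw; rewrite !raddfD /= fpsCZ clZ rlin.
    by apply: (submoduleD Ss); [apply: (submoduleZ _ Ss); apply: Sx|apply: Sy].
  - by move=> w Sw; rewrite !rmorph1 r1.
  - by move=> a x Sx w Sw; rewrite !rmorphM rM; apply: gS; apply: Sx.
rewrite (@fps_split K A m.+1 s) (raddfD (cl I)) /= clZ (linD (rlin v)) (linZ (rlin v)).
rewrite fpsDE (@fpsXnZE K) ltnSn addr0 (raddf_sum (cl I)) (lin_sum (rlin v)).
have : S (\sum_(k < m.+1) rho (cl I (fpsX K ^+ k *: fpsC (s k))) v).
  apply: (submodule_sum Ss) => k _; rewrite clZ (linZ (rlin v)).
  by apply: (submoduleZ _ Ss); apply: poly.
exact.
Qed.

End StableAction.

(** * The representation over C[[h]] *)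

Section FormalRepresentation.
Variables (R : realType) (n P : nat) (alpha beta : R[i] -> fps R[i]).
Local Notation C := R[i].
Hypothesis alphaP : forall x, alpha x ^+ 2 = h_qratio x.
Hypothesis betaP : forall x, beta x ^+ 2 = h_qint x.
Variables (pi : hU R n -> hW R n) (act : hW R n -> fps (fock R n) -> fps (fock R n)).
Hypothesis piP : hHP P%:R alpha beta pi.
Hypothesis actP : h_fock_rep act.

Let relJ := @closed_ideal_gen_sub (free_alg C (Wgen n C (fps C))) (@hW_rel R n).
Let sys : weyl_system ((@fpsC C : {rmorphism C -> fps C}) : C -> fps C)
  (@hW_ap R n) (@hW_am R n) (@hW_fn R n) := quot_weyl_system relJ.
Let cst : forall c, hW_fn (fun=> c) = c *: (1 : hW R n) := quot_fn_cst relJ.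
Let iotaC : {rmorphism C -> fps C} := @fpsC C.
Let vec (l : occ n) : fps (fock R n) := fpsC (ket R l).
Let gensP : HP_on_generators (@hU_h R n) (@hU_e R n) (@hU_f R n) (@hW_ap R n) (@hW_am R n) (@hW_fn R n)
  P%:R (iotaC P%:R *: (1 : quot_alg (hW_ideal R n))) alpha beta pi := piP.2.
Let fockP : fock_representation iotaC vec (@hW_ap R n) (@hW_am R n) (@hW_fn R n) act := actP.

Let rho u v := act (pi u) v.

Let iota_nz (c : C) : c != 0 -> fpsC c != 0. Proof. exact: (@fpsC_nz C C^o). Qed.

Let nz_of_sq (a b : fps C) : a ^+ 2 = b -> b != 0 -> a != 0.
Proof. by move=> <-; apply: contra_neq => ->; rewrite expr0n. Qed.

Let alpha_nz (m : nat) : alpha m.+1%:R != 0.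
Proof.
apply: (nz_of_sq (alphaP _)); apply/eqP => /(congr1 (fun s : fps C => s 0%N)) /eqP.
by rewrite (negPf (h_qratio0 _)).
Qed.

Let beta_nz (m : nat) : beta m.+1%:R != 0.
Proof. by apply: (nz_of_sq (betaP _)); apply: h_qint_neq0; rewrite pnatr_eq0. Qed.

Let beta0 : beta 0 = 0.
Proof. by have := betaP 0; rewrite h_qint0 expr2 => /(@fps_integral R)[]. Qed.

Let coef := step_coef (n := n) (@fpsC C) P alpha beta.

Let rho_linl v : linear (rho^~ v).
Proof.
move=> c u w; rewrite /rho piP.1.1.
by have [[alin _ _ _] _ _ _] := actP; apply: alin.
Qed.

Let rho_linr u : linear (rho u).
Proof. by have [[_ alin _ _] _ _ _] := actP; apply: alin. Qed.

Let rho1 v : rho 1 v = v.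
Proof. by rewrite /rho piP.1.2.1; have [[_ _ a1 _] _ _ _] := actP; apply: a1. Qed.

Let rhoM u w v : rho (u * w) v = rho u (rho w v).
Proof. by rewrite /rho piP.1.2.2; have [[_ _ _ aM] _ _ _] := actP; apply: aM. Qed.

Let H_vec i l : rho (hU_h R i) (vec l) = fpsC (weight P%:R i (natfun R l)) *: vec l.
Proof. exact: (@act_h_vec R n (fps C) iotaC (fps (free_alg C (Wgen n C (fps C)))) (hW_ideal R n) (fps (fock R n)) vec
  (@hW_ap R n) (@hW_am R n) (@hW_fn R n) sys cst act fockP (hU R n) (@hU_h R n) (@hU_e R n) (@hU_f R n) pi P alpha beta gensP). Qed.
Let E_vec0 i (l : occ n) : l i = 0%N -> rho (hU_e R i) (vec l) = 0.
Proof. exact: (@act_e_vec0 R n (fps C) iotaC (fps (free_alg C (Wgen n C (fps C)))) (hW_ideal R n) (fps (fock R n)) vec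
  (@hW_ap R n) (@hW_am R n) (@hW_fn R n) sys act fockP (hU R n) (@hU_h R n) (@hU_e R n) (@hU_f R n) pi P alpha beta gensP). Qed.
Let E_vec i (l : occ n) : (0 < l i)%N -> rho (hU_e R i) (vec l) = coef i l *: vec (step i l).
Proof. exact: (@act_e_vec R n (fps C) iotaC (fps (free_alg C (Wgen n C (fps C)))) (hW_ideal R n) (fps (fock R n)) vec
  (@hW_ap R n) (@hW_am R n) (@hW_fn R n) sys act fockP (hU R n) (@hU_h R n) (@hU_e R n) (@hU_f R n) pi P alpha beta gensP). Qed.
Let F_vec0 (i j : 'I_n) (l : occ n) : i = j.+1 :> nat -> l j = 0%N -> rho (hU_f R i) (vec l) = 0.
Proof. exact: (@act_f_vec0 R n (fps C) iotaC (fps (free_alg C (Wgen n C (fps C)))) (hW_ideal R n) (fps (fock R n)) vec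
  (@hW_ap R n) (@hW_am R n) (@hW_fn R n) sys act fockP (hU R n) (@hU_h R n) (@hU_e R n) (@hU_f R n) pi P alpha beta gensP). Qed.
Let F_vec i (l : occ n) : (0 < l i)%N -> rho (hU_f R i) (vec (step i l)) = coef i l *: vec l.
Proof. exact: (@act_f_vec R n (fps C) iotaC (fps (free_alg C (Wgen n C (fps C)))) (hW_ideal R n) (fps (fock R n)) vec
  (@hW_ap R n) (@hW_am R n) (@hW_fn R n) sys act fockP (hU R n) (@hU_h R n) (@hU_e R n) (@hU_f R n) pi P alpha beta gensP). Qed.

Let coef0 (i : 'I_n) (l : occ n) : i = 0%N :> nat -> quanta l = P.+1 -> coef i l = 0.
Proof. exact: step_coef0. Qed.
Let coef_nz i (l : occ n) : (0 < l i)%N -> (quanta l <= P)%N -> coef i l != 0.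
Proof. by apply: step_coef_neq0 => //; exact: fps_integral. Qed.

Let stable Q : (forall i, ket_stable vec Q (rho (hU_e R i))) ->
  (forall i, ket_stable vec Q (rho (hU_f R i))) ->
  is_invariant rho (h_ext (Defs.span [set v | exists2 l, Q l & v = ket R l]%classic)).
Proof.
move=> QE QF; apply: (@series_quot_stable C (free_alg C (Ugen n)) (Ugen n) gen (@free_ind C _)
  (hU_ideal R n) (fock R n) rho) => //.
- exact/h_ext_submodule/span_submodule.
- case=> i v Sv; apply: h_ket_stable Sv; try exact: rho_linr.
  + exact: (diag_stable (H_vec i)).
  + exact: QE.
  + exact: QF.
Qed.

Lemma formal_representation :
  [/\ is_invariant rho (h_ext (@fock0 R n P)),
      is_invariant rho (h_ext (@fock1 R n P)),
      finitely_spanned (h_ext (@fock0 R n P)) &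
      h_irreducible rho (h_ext (@fock0 R n P))].
Proof.
split.
- apply: (@stable (fun l => (quanta l <= P)%N)) => i; [exact: (E_stable0 (E := fun i => rho (hU_e R i)) E_vec0 E_vec i)|exact: (F_stable0 (F := fun i => rho (hU_f R i)) F_vec0 F_vec coef0 i)].
- apply: (@stable (fun l => (P < quanta l)%N)) => i; [exact: (E_stable1 (E := fun i => rho (hU_e R i)) E_vec0 E_vec coef0 i)|exact: (F_stable1 (F := fun i => rho (hU_f R i)) F_vec0 F_vec i)].
- exact: h_fock0_spanned.
split.
  exists (vec [ffun=> 0%N]); last exact/fpsC_nz/ket_neq0.
  by apply: h_fock0_ket; rewrite /quanta big1 // => i _; rewrite ffunE.
move=> M Ms MS Minv Msat.
have [[v Mv v0]|M0] := pselect (exists2 v, M v & v != 0); [right|left]; last first.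
  apply/seteqP; split=> v /=; last by move=> ->; apply: (submodule0 Ms).
  by move=> Mv; apply: contrapT => /eqP v0; apply: M0; exists v.
have M_sub x : M x -> exists c : occ n -> fps C, x = \sum_(l <- box n P) c l *: vec l.
  by move=> Mx; apply: h_fock0_sum; apply: MS.
have M_sat c l : (quanta l <= P)%N -> c != 0 -> M (c *: vec l) -> M (vec l).
  by move=> lP; apply: Msat; apply: h_fock0_ket.
have M_vec l : (quanta l <= P)%N -> M (vec l).
  exact: (irreducible_vec (@fps_integral R) (iota_nz : forall c, c != 0 -> iotaC c != 0)
    (fun i => rho_linr (hU_h R i)) H_vec E_vec F_vec coef_nz Ms M_sub M_sat
    (fun i => Minv (hU_h R i)) (fun i => Minv (hU_e R i)) (fun i => Minv (hU_f R i)) Mv v0).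
apply/seteqP; split=> // w /h_fock0_sum[c ->].
rewrite big_seq; elim/big_rec: _ => [|l u lb Mu]; first exact: (submodule0 Ms).
apply: (submoduleD Ms) => //; apply: (submoduleZ _ Ms).
by apply: M_vec; rewrite -mem_box.
Qed.

End FormalRepresentation.

(** * Unitarity *)

Section ScalarProduct.
Variables (R : realType) (n : nat).
Local Notation C := R[i].
Implicit Types x y z : fock R n.

Lemma fock_dotEw (d : finSet (occ n)) x y : fsubset (msupp x) d ->
  fock_dot x y = \sum_(l <- d) (mcoeff l x)^* * mcoeff l y.
Proof.
move=> le; rewrite [LHS](big_fset_incl _ le) => //= l _ /mcoeff_outdom ->.
by rewrite rmorph0 mul0r.
Qed.

Lemma fock_dot_linl c x y z : fock_dot (c *: x + y) z = c^* * fock_dot x z + fock_dot y z.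
Proof.
pose d := fsetU (fsetU (msupp x) (msupp y)) (msupp (c *: x + y)).
have dx : fsubset (msupp x) d by rewrite /d -fsetUA fsubsetUl.
have dy : fsubset (msupp y) d by rewrite /d [fsetU (msupp x) _]fsetUC -fsetUA fsubsetUl.
rewrite (fock_dotEw _ dx) (fock_dotEw _ dy) (@fock_dotEw d) ?fsubsetUr //.
rewrite mulr_sumr -big_split; apply: eq_bigr => l _ /=.
by rewrite mcoeffD mcoeffZ rmorphD rmorphM mulrDl mulrA.
Qed.

Lemma fock_dot_linr c x y z : fock_dot x (c *: y + z) = c * fock_dot x y + fock_dot x z.
Proof.
rewrite /fock_dot mulr_sumr -big_split; apply: eq_bigr => l _ /=.
by rewrite mcoeffD mcoeffZ mulrDr mulrCA.
Qed.

Lemma fock_dotC x y : fock_dot y x = (fock_dot x y)^*.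
Proof.
pose d := fsetU (msupp x) (msupp y).
rewrite (@fock_dotEw d y x) ?fsubsetUr // (@fock_dotEw d x y) ?fsubsetUl // rmorph_sum.
by apply: eq_bigr => l _; rewrite rmorphM /= conjCK mulrC.
Qed.

Lemma fock_dot_ket (l m : occ n) : fock_dot (ket R l) (ket R m) = (l == m)%:R.
Proof.
rewrite (@fock_dotEw (fset1 l)) ?msuppU_le // big_seq_fset1 mcoeffUU mcoeffU.
by rewrite rmorph1 mul1r eq_sym.
Qed.

Lemma fock_dot0l z : fock_dot (0 : fock R n) z = 0.
Proof. by have := fock_dot_linl (-1) z z z; rewrite scaleN1r addNr rmorphN1 mulN1r addNr. Qed.

Lemma fock_dot0r z : fock_dot z (0 : fock R n) = 0.
Proof. by rewrite fock_dotC fock_dot0l rmorph0. Qed.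

Lemma fock_dotZl c x y : fock_dot (c *: x) y = c^* * fock_dot x y.
Proof. by rewrite -[_ *: _]addr0 fock_dot_linl fock_dot0l addr0. Qed.

Lemma fock_dotZr c x y : fock_dot x (c *: y) = c * fock_dot x y.
Proof. by rewrite -[_ *: _]addr0 fock_dot_linr fock_dot0r addr0. Qed.

Definition adjoint_on (S : set (fock R n)) (G G' : fock R n -> fock R n) :=
  forall x y, S x -> S y -> fock_dot (G x) y = fock_dot x (G' y).

Lemma adjoint_onC S G G' : adjoint_on S G G' -> adjoint_on S G' G.
Proof. by move=> GG' x y Sx Sy; rewrite fock_dotC -GG' // -fock_dotC. Qed.

Lemma adjoint_on_ket (P : nat) (G G' : fock R n -> fock R n) :
  linear G -> linear G' ->
  (forall l m, (quanta l <= P)%N -> (quanta m <= P)%N ->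
    fock_dot (G (ket R l)) (ket R m) = fock_dot (ket R l) (G' (ket R m))) ->
  adjoint_on (fock0 P) G G'.
Proof.
move=> Gl Gl' GG'; suff GGl l y : (quanta l <= P)%N -> fock0 P y ->
    fock_dot (G (ket R l)) y = fock_dot (ket R l) (G' y).
  move=> x y Sx Sy.
  apply: (Sx [set x | fock_dot (G x) y = fock_dot x (G' y)]%classic) => [|_ [l lP ->]]; last exact: GGl.
  split=> [|c u v /= Eu Ev]; first by rewrite /= (lin0 Gl) !fock_dot0l.
  by rewrite Gl !fock_dot_linl Eu Ev.
move=> lP Sy.
apply: (Sy [set y | fock_dot (G (ket R l)) y = fock_dot (ket R l) (G' y)]%classic) => [|_ [m mP ->]]; last exact: GG'.
split=> [|c u v /= Eu Ev]; first by rewrite /= (lin0 Gl') !fock_dot0r.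
by rewrite Gl' !fock_dot_linr Eu Ev.
Qed.

Lemma diag_adjoint P (G : fock R n -> fock R n) (w : occ n -> C) :
  linear G -> (forall l, G (ket R l) = w l *: ket R l) -> (forall l, (w l)^* = w l) ->
  adjoint_on (fock0 P) G G.
Proof.
move=> Gl Gw wr; apply: adjoint_on_ket => // l m lP mP.
rewrite !Gw fock_dotZl fock_dotZr fock_dot_ket wr.
by case: eqVneq => [->|]; rewrite ?mulr0.
Qed.

Lemma step_inj (i : 'I_n) (l m : occ n) : (0 < l i)%N -> (0 < m i)%N -> step i l = step i m -> l = m.
Proof.
move=> li mi; rewrite /step; case: ifP => _ E.
  by rewrite -(decrK li) E decrK.
by rewrite -(decrK li) -(decrK mi) -(incrK (ord_pred i) (decr i l)) E incrK.
Qed.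

(** As [step i] is injective, E and F have transposed matrices in an orthonormal basis; with real
    entries the transpose is the adjoint. *)
Lemma step_adjoint (P : nat) (i : 'I_n) (E F : fock R n -> fock R n) (coef : occ n -> C) :
  linear E -> linear F ->
  (forall l : occ n, l i = 0%N -> E (ket R l) = 0) ->
  (forall l : occ n, (0 < l i)%N -> E (ket R l) = coef l *: ket R (step i l)) ->
  (forall (j : 'I_n) (l : occ n), i = j.+1 :> nat -> l j = 0%N -> F (ket R l) = 0) ->
  (forall l : occ n, (0 < l i)%N -> F (ket R (step i l)) = coef l *: ket R l) ->
  (forall l : occ n, (0 < l i)%N -> (quanta l <= P)%N -> (coef l)^* = coef l) ->
  adjoint_on (fock0 P) E F.
Proof.
move=> El Fl E0 E1 F0 F1 cr; apply: adjoint_on_ket => // l m lP mP.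
have [[m' mi' ->]|[j ij mj]] := stepP i m.
  rewrite F1 // fock_dotZr fock_dot_ket; have [li|li] := posnP (l i).
    rewrite E0 // fock_dot0l; case: eqVneq => [lm|]; rewrite ?mulr0 //.
    by move: mi'; rewrite -lm li.
  rewrite E1 // fock_dotZl fock_dot_ket cr //.
  have [->|lm] := eqVneq l m'; first by rewrite eqxx.
  by case: eqVneq => [/(step_inj li mi') /eqP|]; rewrite ?(negPf lm) // !mulr0.
rewrite (F0 _ _ ij mj) fock_dot0r; have [li|li] := posnP (l i); first by rewrite E0 // fock_dot0l.
rewrite E1 // fock_dotZl fock_dot_ket; case: eqVneq => [lm|]; rewrite ?mulr0 //.
(* A state reached by a step has a quantum in the mode j, whereas m has none. *)
by move: mj; rewrite -lm /step ij (ord_predS ij) ffunE eqxx addn1.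
Qed.

End ScalarProduct.

(** For integral p the weights are integers, which makes them and the corresponding powers of q > 0
    real. *)
Lemma weight_int (R : realType) (n P : nat) (i : 'I_n) (l : occ n) :
  exists z : int, weight P%:R i (natfun R l) = z%:~R.
Proof.
have [i0|[j ij]] := ord_case i.
  exists (Posz P - Posz (quanta l) - Posz (l i)).
  by rewrite /weight ext0 // natfun_sum !rmorphB.
exists (Posz (l j) - Posz (l i)).
by rewrite /weight (extS _ _ ij) rmorphB.
Qed.

(** The factors of a product are moved across one at a time, which reverses their order as omega
    does. Each move happens at vectors produced by other factors, hence the invariance of S. *)
Lemma quot_adjoint (R : realType) (n : nat) (A : lalgType R[i]) (X : Type) (g : X -> A)
    (I : ideal A) (rho : quot_alg I -> fock R n -> fock R n) (omega : quot_alg I -> quot_alg I)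
    (S : set (fock R n)) :
  (forall Q : A -> Prop, Q 0 -> (forall c x y, Q x -> Q y -> Q (c *: x + y)) -> Q 1 ->
    (forall a x, Q x -> Q (g a * x)) -> forall x, Q x) ->
  (forall v, linear (rho^~ v)) -> (forall v, rho 1 v = v) ->
  (forall u w v, rho (u * w) v = rho u (rho w v)) -> is_invariant rho S ->
  (forall c u v, omega (c *: u + v) = c^* *: omega u + omega v) ->
  (forall u v, omega (u * v) = omega v * omega u) -> omega 1 = 1 ->
  (forall a, adjoint_on S (rho (cl I (g a))) (rho (omega (cl I (g a))))) ->
  forall u, adjoint_on S (rho u) (rho (omega u)).
Proof.
move=> A_ind rlin r1 rM inv oL oM o1 gA u; elim/cl_ind: u => s; move: s; apply: A_ind.
- have o0 : omega 0 = 0.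
    by have := oL (-1) 0 0; rewrite scaler0 addr0 rmorphN1 scaleN1r addNr.
  by move=> x y _ _; rewrite raddf0 o0 !(lin0 (rlin _)) fock_dot0l fock_dot0r.
- move=> c s t IHs IHt x y Sx Sy; rewrite raddfD /= clZ oL !rlin.
  by rewrite fock_dot_linl fock_dot_linr IHs // IHt.
- by move=> x y _ _; rewrite rmorph1 o1 !r1.
- move=> a s IH x y Sx Sy; rewrite (rmorphM (cl I)) oM !rM.
  by rewrite gA ?IH //; apply: inv.
Qed.

(** * The representation for numerical q *)

Section NumericRepresentation.
Variables (R : realType) (n P : nat) (h : R[i]) (alpha beta : R[i] -> R[i]).
Local Notation C := R[i].
Hypothesis qroot : forall m, (0 < m)%N -> n_q h ^+ m != 1.
Hypothesis alphaP : forall x, alpha x ^+ 2 = n_qratio h x.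
Hypothesis betaP : forall x, beta x ^+ 2 = n_qint h x.
Local Notation Uq := (nU n (n_q h)).
Variables (pi : Uq -> nW R n) (act : nW R n -> fock R n -> fock R n).
Hypothesis piP : nHP P%:R alpha beta pi.
Hypothesis actP : n_fock_rep act.

Let relJ := @ideal_gen_sub (free_alg C (Wgen n C C)) (@nW_rel R n).
Let iotaC : {rmorphism C -> C} := idfun.
Let sys : weyl_system (iotaC : C -> C) (@nW_ap R n) (@nW_am R n) (@nW_fn R n) :=
  quot_weyl_system relJ.
Let cst : forall c, nW_fn (fun=> c) = c *: (1 : nW R n) := quot_fn_cst relJ.
Let gensP : HP_on_generators (nU_h (n_q h)) (nU_e (n_q h)) (nU_f (n_q h))
  (@nW_ap R n) (@nW_am R n) (@nW_fn R n)
  P%:R (iotaC P%:R *: (1 : quot_alg (@nW_ideal R n))) alpha beta pi.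
Proof. by case: piP. Qed.
Let fockP : fock_representation iotaC (@ket R n) (@nW_ap R n) (@nW_am R n) (@nW_fn R n) act := actP.
Let rho u v := act (pi u) v.

Let nz_of_sq (a b : C) : a ^+ 2 = b -> b != 0 -> a != 0.
Proof. by move=> <-; apply: contra_neq => ->; rewrite expr0n. Qed.

Let alpha_nz (m : nat) : alpha m.+1%:R != 0.
Proof.
apply: (nz_of_sq (alphaP _)); have := n_qint_neq0 qroot m.
by rewrite -n_qratioP; apply: contra_neq => ->; rewrite mul0r.
Qed.

Let beta_nz (m : nat) : beta m.+1%:R != 0.
Proof. exact: nz_of_sq (betaP _) (n_qint_neq0 qroot m). Qed.

Let beta0 : beta 0 = 0.
Proof. by have /eqP := betaP 0; rewrite n_qint0 sqrf_eq0 => /eqP. Qed.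

Let coef := step_coef (n := n) iotaC P alpha beta.

Let rho_linl v : linear (rho^~ v).
Proof.
move=> c u w; have [[pl _] _ _ _] := piP; rewrite /rho pl.
by have [[alin _ _ _] _ _ _] := actP; apply: alin.
Qed.

Let rho_linr u : linear (rho u).
Proof. by have [[_ alin _ _] _ _ _] := actP; apply: alin. Qed.

Let rho1 v : rho 1 v = v.
Proof.
have [[_ [p1 _]] _ _ _] := piP; rewrite /rho p1.
by have [[_ _ a1 _] _ _ _] := actP; apply: a1.
Qed.

Let rhoM u w v : rho (u * w) v = rho u (rho w v).
Proof.
have [[_ [_ pM]] _ _ _] := piP; rewrite /rho pM.
by have [[_ _ _ aM] _ _ _] := actP; apply: aM.
Qed.

Let H_vec i (l : occ n) : rho (nU_h (n_q h) i) (ket R l) = weight P%:R i (natfun R l) *: ket R l.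
Proof. exact: (@act_h_vec R n C iotaC (free_alg C (Wgen n C C)) (@nW_ideal R n) (fock R n) (@ket R n)
  (@nW_ap R n) (@nW_am R n) (@nW_fn R n) sys cst act fockP Uq (nU_h (n_q h)) (nU_e (n_q h)) (nU_f (n_q h)) pi P alpha beta gensP). Qed.
Let E_vec0 i (l : occ n) : l i = 0%N -> rho (nU_e (n_q h) i) (ket R l) = 0.
Proof. exact: (@act_e_vec0 R n C iotaC (free_alg C (Wgen n C C)) (@nW_ideal R n) (fock R n) (@ket R n)
  (@nW_ap R n) (@nW_am R n) (@nW_fn R n) sys act fockP Uq (nU_h (n_q h)) (nU_e (n_q h)) (nU_f (n_q h)) pi P alpha beta gensP). Qed.
Let E_vec i (l : occ n) : (0 < l i)%N -> rho (nU_e (n_q h) i) (ket R l) = coef i l *: ket R (step i l).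
Proof. exact: (@act_e_vec R n C iotaC (free_alg C (Wgen n C C)) (@nW_ideal R n) (fock R n) (@ket R n)
  (@nW_ap R n) (@nW_am R n) (@nW_fn R n) sys act fockP Uq (nU_h (n_q h)) (nU_e (n_q h)) (nU_f (n_q h)) pi P alpha beta gensP). Qed.
Let F_vec0 (i j : 'I_n) (l : occ n) : i = j.+1 :> nat -> l j = 0%N -> rho (nU_f (n_q h) i) (ket R l) = 0.
Proof. exact: (@act_f_vec0 R n C iotaC (free_alg C (Wgen n C C)) (@nW_ideal R n) (fock R n) (@ket R n)
  (@nW_ap R n) (@nW_am R n) (@nW_fn R n) sys act fockP Uq (nU_h (n_q h)) (nU_e (n_q h)) (nU_f (n_q h)) pi P alpha beta gensP). Qed.
Let F_vec i (l : occ n) : (0 < l i)%N -> rho (nU_f (n_q h) i) (ket R (step i l)) = coef i l *: ket R l.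
Proof. exact: (@act_f_vec R n C iotaC (free_alg C (Wgen n C C)) (@nW_ideal R n) (fock R n) (@ket R n)
  (@nW_ap R n) (@nW_am R n) (@nW_fn R n) sys act fockP Uq (nU_h (n_q h)) (nU_e (n_q h)) (nU_f (n_q h)) pi P alpha beta gensP). Qed.

Let fn_ket F (l : occ n) : act (nW_fn F) (ket R l) = F (natfun R l) *: ket R l.
Proof. by have [_ _ _ aF] := actP; apply: aF. Qed.

Let K_vec i (l : occ n) : rho (nU_k (n_q h) i) (ket R l) = n_qpow h (weight P%:R i (natfun R l)) *: ket R l.
Proof.
have [_ _ k0 kS] := piP; rewrite /rho; have [i0|[j ij]] := ord_case i.
  by rewrite (k0 _ i0).1 fn_ket /weight ext0.
by rewrite (kS _ _ ij).1 fn_ket /weight (extS _ _ ij).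
Qed.

Let KV_vec i (l : occ n) : rho (nU_kV (n_q h) i) (ket R l) = n_qpow h (- weight P%:R i (natfun R l)) *: ket R l.
Proof.
have [_ _ k0 kS] := piP; rewrite /rho; have [i0|[j ij]] := ord_case i.
  by rewrite (k0 _ i0).2 fn_ket /weight ext0.
by rewrite (kS _ _ ij).2 fn_ket /weight (extS _ _ ij).
Qed.

Let coef0 (i : 'I_n) (l : occ n) : i = 0%N :> nat -> quanta l = P.+1 -> coef i l = 0.
Proof. exact: step_coef0. Qed.
Let coef_nz i (l : occ n) : (0 < l i)%N -> (quanta l <= P)%N -> coef i l != 0.
Proof. by apply: step_coef_neq0 => //; exact: field_integral. Qed.

Let stable Q : (forall i, ket_stable (@ket R n) Q (rho (nU_e (n_q h) i))) ->
  (forall i, ket_stable (@ket R n) Q (rho (nU_f (n_q h) i))) ->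
  is_invariant rho (Defs.span [set v | exists2 l, Q l & v = ket R l]%classic).
Proof.
move=> QE QF; apply: (@quot_stable C (free_alg C (nUgen n)) (nUgen n) gen (@free_ind C _)
  (nU_ideal n (n_q h)) (fock R n) rho) => //.
- exact/span_submodule.
- case=> [[i|i|i]|i|i] v Sv; apply: n_ket_stable Sv; try exact: rho_linr.
  + exact: (diag_stable (H_vec i)).
  + exact: QE.
  + exact: QF.
  + exact: (diag_stable (K_vec i)).
  + exact: (diag_stable (KV_vec i)).
Qed.

Let inv0 : is_invariant rho (@fock0 R n P).
Proof.
apply: (@stable (fun l => (quanta l <= P)%N)) => i;
  [exact: (E_stable0 (E := fun i => rho (nU_e (n_q h) i)) E_vec0 E_vec i)|
   exact: (F_stable0 (F := fun i => rho (nU_f (n_q h) i)) F_vec0 F_vec coef0 i)].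
Qed.

Lemma numeric_representation :
  [/\ is_invariant rho (@fock0 R n P), is_invariant rho (@fock1 R n P),
      finitely_spanned (@fock0 R n P) & is_irreducible rho (@fock0 R n P)].
Proof.
split.
- exact: inv0.
- apply: (@stable (fun l => (P < quanta l)%N)) => i;
  [exact: (E_stable1 (E := fun i => rho (nU_e (n_q h) i)) E_vec0 E_vec coef0 i)|
   exact: (F_stable1 (F := fun i => rho (nU_f (n_q h) i)) F_vec0 F_vec i)].
- exact: fock0_spanned.
split.
  exists (ket R [ffun=> 0%N]); last exact/ket_neq0.
  by apply: fock0_ket; rewrite /quanta big1 // => i _; rewrite ffunE.
move=> M Ms MS Minv.
have [[v Mv v0]|M0] := pselect (exists2 v, M v & v != 0); [right|left]; last first.
  apply/seteqP; split=> v /=; last by move=> ->; apply: (submodule0 Ms).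
  by move=> Mv; apply: contrapT => /eqP v0; apply: M0; exists v.
have M_sub x : M x -> exists c : occ n -> C, x = \sum_(l <- box n P) c l *: ket R l.
  by move=> Mx; exists (fun l => mcoeff l x); apply: fock0_sum; apply: MS.
have M_sat (c : C) (l : occ n) : (quanta l <= P)%N -> c != 0 -> M (c *: ket R l) -> M (ket R l).
  by move=> _ c0 /(submoduleZ c^-1 Ms); rewrite scalerA mulVf // scale1r.
have M_vec (l : occ n) : (quanta l <= P)%N -> M (ket R l).
  exact: (irreducible_vec (iota := iotaC) (@field_integral C) (fun c c0 => c0)
    (fun i => rho_linr (nU_h (n_q h) i)) H_vec E_vec F_vec coef_nz Ms M_sub M_sat
    (fun i => Minv (nU_h (n_q h) i)) (fun i => Minv (nU_e (n_q h) i)) (fun i => Minv (nU_f (n_q h) i)) Mv v0).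
apply/seteqP; split=> // w /fock0_sum ->.
rewrite big_seq; elim/big_rec: _ => [|l u lb Mu]; first exact: (submodule0 Ms).
apply: (submoduleD Ms) => //; apply: (submoduleZ _ Ms).
by apply: M_vec; rewrite -mem_box.
Qed.

Section Unitarity.
Hypothesis q_gt0 : 0 < n_q h.

(** A number with nonnegative square is real, whichever branch of the root has been chosen. *)
Let real_of_sq (a b : C) : a ^+ 2 = b -> 0 <= b -> a^* = a.
Proof. by move=> <- a2; apply: conj_Creal; rewrite realEsqr. Qed.

Let alpha_real (m : nat) : (alpha m.+1%:R)^* = alpha m.+1%:R.
Proof.
apply: (real_of_sq (alphaP _)).
have -> : n_qratio h m.+1%:R = n_qint h m.+1%:R / m.+1%:R.
  by rewrite -n_qratioP mulfK // pnatr_eq0.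
by rewrite divr_ge0 ?ler0n // n_qint_ge0.
Qed.

Let beta_real (m : nat) : (beta m%:R)^* = beta m%:R.
Proof. by apply: (real_of_sq (betaP _)); apply: n_qint_ge0. Qed.

Let sqrt_real (m : nat) : (sqrtC (m%:R : C))^* = sqrtC m%:R.
Proof. by apply: conj_Creal; apply: ger0_real; rewrite sqrtC_ge0 ler0n. Qed.

(** The bound by P keeps the argument of beta nonnegative; well above the level P, the q-number
    under the root is negative for q > 0 and beta is imaginary. *)
Let coef_real i (l : occ n) : (0 < l i)%N -> (quanta l <= P)%N -> (coef i l)^* = coef i l.
Proof.
move=> li lP; rewrite /coef /step_coef -(prednK li) /=; case: ifP => _.
  by rewrite -natrB // natr1 !rmorphM /= alpha_real beta_real sqrt_real.
by rewrite !rmorphM /= !alpha_real !sqrt_real.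
Qed.

Let weight_real i (l : occ n) : (weight P%:R i (natfun R l))^* = weight P%:R i (natfun R l).
Proof. by have [z ->] := weight_int R P i l; rewrite rmorph_int. Qed.

Let qpow_real (z : int) : (n_qpow h z%:~R)^* = n_qpow h z%:~R.
Proof. by rewrite n_qpow_int; apply: conj_Creal; apply: ger0_real; rewrite exprz_ge0 // ltW. Qed.

Let gen_adjoint (omega : Uq -> Uq) : is_omega omega -> forall a : nUgen n,
  adjoint_on (fock0 P) (rho (cl (nU_ideal n (n_q h)) (gen a)))
    (rho (omega (cl (nU_ideal n (n_q h)) (gen a)))).
Proof.
move=> [_ _ _ oK ogen]; have EF i : adjoint_on (fock0 P) (rho (nU_e (n_q h) i)) (rho (nU_f (n_q h) i)).
  exact: (step_adjoint (rho_linr _) (rho_linr _) (@E_vec0 i) (@E_vec i) (@F_vec0 i) (@F_vec i) (@coef_real i)).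
case=> [[i|i|i]|i|i]; have [oh oe ok okV] := ogen i.
- rewrite -[cl _ _]/(nU_h (n_q h) i) oh.
  exact: (diag_adjoint (rho_linr _) (H_vec i) (weight_real i)).
- by rewrite -[cl _ _]/(nU_e (n_q h) i) oe; exact: EF.
(* The value e_i of omega at f_i comes from the involutivity of omega. *)
- rewrite -[cl _ _]/(nU_f (n_q h) i) -oe oK oe.
  exact/adjoint_onC/EF.
- rewrite -[cl _ _]/(nU_k (n_q h) i) ok.
  apply: (diag_adjoint (rho_linr _) (K_vec i)) => l.
  by have [z ->] := weight_int R P i l; apply: qpow_real.
- rewrite -[cl _ _]/(nU_kV (n_q h) i) okV.
  apply: (diag_adjoint (rho_linr _) (KV_vec i)) => l.
  by have [z ->] := weight_int R P i l; rewrite -mulrNz; apply: qpow_real.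
Qed.

Lemma numeric_unitarizable (omega : Uq -> Uq) : is_omega omega ->
  unitarizable omega rho (@fock0 R n P).
Proof.
move=> oP; have [oL oM o1 _ _] := oP; rewrite /unitarizable.
exact: (quot_adjoint (@free_ind C (nUgen n)) rho_linl rho1 rhoM inv0 oL oM o1 (gen_adjoint oP)).
Qed.

End Unitarity.
End NumericRepresentation.

(** * The anti-involution *)

(* A sigma-linear anti-morphism into A is a morphism into the converse ring A^c. *)
Section AntiLift.
Variables (K : comNzRingType) (sigma : {rmorphism K -> K}) (X : choiceType) (A : algType K) (f : X -> A).

Let tau (c : K) : A^c := (sigma c)%:A.

Let tau_is_additive : additive tau.
Proof. by move=> c d; rewrite /tau rmorphB scalerBl. Qed.

Let tau_is_monoid_morphism : monoid_morphism tau.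
Proof.
split; first by rewrite /tau rmorph1 scale1r.
move=> c d; rewrite /tau -[RHS]/((sigma d)%:A * (sigma c)%:A : A).
by rewrite -scalerAl mul1r scalerA rmorphM mulrC.
Qed.

HB.instance Definition _ := GRing.isAdditive.Build K A^c tau tau_is_additive.
HB.instance Definition _ := GRing.isMonoidMorphism.Build K A^c tau tau_is_monoid_morphism.

Let tauC c (s : A^c) : GRing.comm (tau c) s.
Proof.
by rewrite /GRing.comm -[LHS]/((s : A) * (sigma c)%:A) -[RHS]/((sigma c)%:A * (s : A)) -scalerAl mul1r -scalerAr mulr1.
Qed.

Definition anti_lift : free_alg K X -> A := free_lift (S := A^c) tau f.

Lemma anti_lift_is_additive : additive anti_lift.
Proof. exact: (free_lift_is_additive (S := A^c) tau f). Qed.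
HB.instance Definition _ := GRing.isAdditive.Build (free_alg K X) A anti_lift anti_lift_is_additive.

Lemma anti_liftZ c x : anti_lift (c *: x) = sigma c *: anti_lift x.
Proof.
transitivity (anti_lift x * (sigma c)%:A); first exact: (free_liftZ (S := A^c) tau f).
by rewrite -scalerAr mulr1.
Qed.

Lemma anti_liftM x y : anti_lift (x * y) = anti_lift y * anti_lift x.
Proof. exact: (free_lift_is_monoid_morphism (S := A^c) f tauC).2. Qed.

Lemma anti_lift1 : anti_lift 1 = 1.
Proof. exact: (free_lift_is_monoid_morphism (S := A^c) f tauC).1. Qed.

Lemma anti_lift_gen x : anti_lift (gen x) = f x.
Proof. exact: (free_lift_gen (S := A^c) tau f). Qed.

End AntiLift.

(** The kernel of an anti-morphism is a two-sided ideal too. *)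
Lemma ideal_gen_antiker (A : nzRingType) (B : pzRingType) (F : A -> B) (r : set A) :
  additive F -> (forall x y, F (x * y) = F y * F x) -> (forall x, r x -> F x = 0) ->
  forall x, ideal_gen r x -> F x = 0.
Proof.
move=> FB FM Fr x xr; apply: (xr [set x | F x = 0]%classic) => //.
have F0 : F 0 = 0 by rewrite -(subrr 0) FB subrr.
split=> // [y z /= Fy Fz|a y /= Fy]; first by rewrite FB Fy Fz subrr.
by rewrite !FM Fy mulr0 mul0r.
Qed.

Section AntiRelations.
Variables (K : comNzRingType) (sigma : K -> K) (n : nat) (A : lalgType K) (I : ideal A).
Local Notation W := (quot_alg I).
Hypothesis W_scaleAr : forall c (x y : W), c *: (x * y) = x * (c *: y).
Variables (T : lalgType K) (F : {additive T -> W}).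
Hypothesis FZ : forall c x, F (c *: x) = sigma c *: F x.
Hypothesis FM : forall x y, F (x * y) = F y * F x.

Lemma cl_qrel c x y : I (x * y - c *: (y * x)) -> cl I x * cl I y = c *: (cl I y * cl I x).
Proof.
by move=> /cl0; rewrite (raddfB (cl I)) /= clZ !(rmorphM (cl I)) => /subr0_eq.
Qed.

Lemma cl_comm x y : I (comm x y) -> cl I x * cl I y = cl I y * cl I x.
Proof. by move=> /cl0; rewrite (raddfB (cl I)) /= !(rmorphM (cl I)) => /subr0_eq. Qed.

Lemma cl_inv x y : I (x * y - 1) -> cl I x * cl I y = 1.
Proof. by move=> /cl0; rewrite (raddfB (cl I)) /= (rmorphM (cl I)) (rmorph1 (cl I)) => /subr0_eq. Qed.

Lemma anti_inv x y : F 1 = 1 -> F y * F x = 1 -> F (x * y - 1) = 0.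
Proof. by move=> F1 yx; rewrite raddfB /= FM yx F1 subrr. Qed.

Lemma anti_comm x y : F x * F y = F y * F x -> F (comm x y) = 0.
Proof. by rewrite raddfB /= !FM => ->; rewrite subrr. Qed.

(** Reversal moves the scalar to the other side: the relation of q^{h_i} and e_j with factor c
    becomes that of q^{h_i} and f_j with the inverse factor d. *)
Lemma anti_qrel c d x y : sigma c = c -> c * d = 1 -> F x * F y = d *: (F y * F x) ->
  F (x * y - c *: (y * x)) = 0.
Proof.
move=> sc cd E; rewrite raddfB /= FZ !FM sc E scalerA cd scale1r subrr //.
Qed.

Variables (q qV : K) (h e f br : 'I_n -> A) (hT eT fT brT : 'I_n -> T).
Hypothesis qqV : q * qV = 1.
Hypothesis sq : sigma q = q.
Hypothesis sqV : sigma qV = qV.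
Hypothesis relI : forall x, Uq_rel q qV h e f br x -> I x.
Hypothesis Fh : forall i, F (hT i) = cl I (h i).
Hypothesis Fe : forall i, F (eT i) = cl I (f i).
Hypothesis Ff : forall i, F (fT i) = cl I (e i).
Hypothesis Fbr : forall i, F (brT i) = cl I (br i).

(** For c d = 1 the expansion u u v - (c + d) u v u + v u u reads the same backwards. *)
Let serre_converse c d (u v : W) : c * d = 1 ->
  (v * u - d *: (u * v)) * u - c *: (u * (v * u - d *: (u * v))) =
  u * (u * v - d *: (v * u)) - c *: ((u * v - d *: (v * u)) * u).
Proof.
move=> cd; rewrite !mulrBl !mulrBr !scalerBr -!quot_scaleAl -!W_scaleAr !scalerA cd !scale1r !mulrA.
by rewrite !opprB addrACA [RHS]addrACA [u * u * v + _]addrC.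
Qed.

Let anti_serre c d a b (x y : A) : sigma c = c -> sigma d = d -> c * d = 1 ->
  F a = cl I x -> F b = cl I y -> I (qcomm c x (qcomm d x y)) -> F (qcomm c a (qcomm d a b)) = 0.
Proof.
move=> sc sd cd Fa Fb /cl0 E.
have cl_qcomm k (z w : A) : cl I (qcomm k z w) = cl I z * cl I w - k *: (cl I w * cl I z).
  by rewrite (raddfB (cl I)) /= clZ !(rmorphM (cl I)).
have F_qcomm k z w : sigma k = k -> F (qcomm k z w) = F w * F z - k *: (F z * F w).
  by move=> sk; rewrite raddfB /= FZ !FM sk.
rewrite F_qcomm // F_qcomm // Fa Fb serre_converse // -E.
by rewrite cl_qcomm cl_qcomm.
Qed.

(** The relations are permuted: those of the e_i and of the f_i are exchanged, up to sign where a
    commutator with h_i is reversed, and [e_i, f_j] goes to [e_j, f_i]. *)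
Lemma anti_Uq_rel x : Uq_rel q qV hT eT fT brT x -> F x = 0.
Proof.
case=> {x}.
- by move=> i j; apply: anti_comm; rewrite !Fh; apply: cl_comm; apply: relI; apply: Uq_hh.
- move=> i j; rewrite raddfB /= raddfMz raddfB /= !FM Fh Fe.
  have /cl0 := relI (Uq_hf q qV h e f br i j).
  rewrite raddfD /= (raddfMz (cl I)) (raddfB (cl I)) /= !(rmorphM (cl I)) => E.
  by rewrite -[RHS]oppr0 -E opprD opprB.
- move=> i j; rewrite raddfD /= raddfMz raddfB /= !FM Fh Ff.
  have /cl0 := relI (Uq_he q qV h e f br i j).
  rewrite (raddfB (cl I)) /= (raddfMz (cl I)) (raddfB (cl I)) /= !(rmorphM (cl I)) => E.
  by rewrite -[RHS]oppr0 -E opprB opprB addrC.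
- move=> i j; rewrite raddfB /= raddfMn raddfB /= !FM Fe Ff Fbr.
  have /cl0 := relI (Uq_ef q qV h e f br j i).
  rewrite (raddfB (cl I)) /= (raddfMn (cl I)) (raddfB (cl I)) /= !(rmorphM (cl I)).
  by rewrite eq_sym; case: eqVneq => [->|].
- by move=> i j ij; apply: anti_comm; rewrite !Fe; apply: cl_comm; apply: relI; apply: Uq_ff.
- by move=> i j ij; apply: anti_comm; rewrite !Ff; apply: cl_comm; apply: relI; apply: Uq_ee.
- by move=> i j ij; apply: (anti_serre sq sqV qqV (Fe i) (Fe j)); apply: relI; apply: Uq_fff.
- by move=> i j ij; apply: (anti_serre sqV sq _ (Fe i) (Fe j)); [rewrite mulrC|apply: relI; apply: Uq_fff'].
- by move=> i j ij; apply: (anti_serre sq sqV qqV (Ff i) (Ff j)); apply: relI; apply: Uq_eee.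
- by move=> i j ij; apply: (anti_serre sqV sq _ (Ff i) (Ff j)); [rewrite mulrC|apply: relI; apply: Uq_eee'].
Qed.

End AntiRelations.

Section QuotientAnti.
Variables (K : comNzRingType) (sigma : {rmorphism K -> K}) (A : lalgType K) (I : ideal A).
Variable F : {additive A -> quot_alg I}.
Hypothesis FZ : forall c x, F (c *: x) = sigma c *: F x.
Hypothesis FM : forall x y, F (x * y) = F y * F x.
Hypothesis F1 : F 1 = 1.
Hypothesis FI : forall x, I x -> F x = 0.

Definition quot_anti : quot_alg I -> quot_alg I := quot_fact F.

Lemma quot_antiE x : quot_anti (cl I x) = F x.
Proof. exact: quot_factE. Qed.

Lemma quot_antiL c u v : quot_anti (c *: u + v) = sigma c *: quot_anti u + quot_anti v.
Proof.
elim/cl_ind: u => x; elim/cl_ind: v => y.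
by rewrite -clZ -(raddfD (cl I)) !quot_antiE raddfD FZ.
Qed.

Lemma quot_antiM u v : quot_anti (u * v) = quot_anti v * quot_anti u.
Proof.
elim/cl_ind: u => x; elim/cl_ind: v => y.
by rewrite -(rmorphM (cl I)) !quot_antiE FM.
Qed.

Lemma quot_anti1 : quot_anti 1 = 1.
Proof. by rewrite -{1}(rmorph1 (cl I)) quot_antiE F1. Qed.

(** The square of an anti-morphism is multiplicative, and linear as sigma is an involution; so the
    generators suffice. *)
Lemma quot_antiK (X : Type) (g g' : X -> A) : involutive sigma ->
  (forall Q : A -> Prop, Q 0 -> (forall c x y, Q x -> Q y -> Q (c *: x + y)) -> Q 1 ->
    (forall a x, Q x -> Q (g a * x)) -> forall x, Q x) ->
  (forall a, F (g a) = cl I (g' a)) -> (forall a, F (g' a) = cl I (g a)) ->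
  involutive quot_anti.
Proof.
move=> sK A_ind Fg Fg'; elim/cl_ind => x; move: x; apply: A_ind.
- by rewrite raddf0 -{1}(raddf0 (cl I)) quot_antiE raddf0 -{1}(raddf0 (cl I)) quot_antiE raddf0.
- by move=> c x y IHx IHy; rewrite raddfD /= clZ !quot_antiL IHx IHy sK.
- by rewrite rmorph1 !quot_anti1.
- move=> a x IH; rewrite (rmorphM (cl I)) !quot_antiM IH; congr (_ * _).
  by rewrite quot_antiE Fg quot_antiE Fg'.
Qed.

End QuotientAnti.

Section Omega.
Variables (R : realType) (n : nat) (q : R[i]).
Local Notation C := R[i].
Local Notation T := (free_alg C (nUgen n)).
Local Notation J := (nU_ideal n q).
Hypothesis q_gt0 : 0 < q.

Definition omega_gen (u : nUgen n) : T :=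
  match u with
  | GenU (GenH i) => gen (GenU (GenH i))
  | GenU (GenE i) => gen (GenU (GenF i))
  | GenU (GenF i) => gen (GenU (GenE i))
  | GenK i => gen (GenK i)
  | GenKV i => gen (GenKV i)
  end.

Let cnj : {rmorphism C -> C} := Num.conj.
Let F : {additive T -> nU n q} := cl J \o anti_lift cnj omega_gen.

Let FZ c x : F (c *: x) = cnj c *: F x.
Proof. by rewrite /= anti_liftZ clZ. Qed.

Let FM x y : F (x * y) = F y * F x.
Proof. by rewrite /= anti_liftM (rmorphM (cl J)). Qed.

Let Fgen u : F (gen u) = cl J (omega_gen u).
Proof. by rewrite /= anti_lift_gen. Qed.

Let F1 : F 1 = 1.
Proof. by rewrite /= anti_lift1 (rmorph1 (cl J)). Qed.

Let scaleAr c (x y : nU n q) : c *: (x * y) = x * (c *: y).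
Proof. exact: quot_scaleAr. Qed.

Let relJ x : @nU_rel R n q x -> J x. Proof. exact: ideal_gen_sub. Qed.

Let q_real (c : C) : 0 < c -> cnj c = c.
Proof. by move=> c0; apply: conj_Creal; apply: gtr0_real. Qed.

Let q_neq0 : q != 0. Proof. by rewrite gt_eqF. Qed.

Let br_real : cnj (q - q^-1)^-1 = (q - q^-1)^-1.
Proof. by rewrite !(rmorphB, fmorphV) !q_real. Qed.

Let pow_real z : cnj (q ^ z) = q ^ z.
Proof. by apply: q_real; rewrite exprz_gt0. Qed.

(** The coefficients of the relations, namely integral powers of q and (q - q^-1)^-1, are real for q
    > 0; hence an antilinear map can preserve the relations. *)
Let F_rel x : nU_rel q x -> F x = 0.
Proof.
case=> {x}.
- move=> x; apply: (anti_Uq_rel (sigma := cnj) scaleAr FZ FM (mulfV q_neq0) (q_real q_gt0) _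
    (fun x xr => relJ (nU_Uq xr)) (fun i => Fgen (GenU (GenH i))) (fun i => Fgen (GenU (GenE i)))
    (fun i => Fgen (GenU (GenF i)))).
  + by rewrite fmorphV q_real.
  + move=> i; rewrite FZ br_real raddfB !Fgen clZ (raddfB (cl J)) //.
- move=> i; apply: (anti_inv FM F1); rewrite (Fgen (GenK i)) (Fgen (GenKV i)).
  exact: (cl_inv (relJ (nU_kVk q i))).
- move=> i; apply: (anti_inv FM F1); rewrite (Fgen (GenK i)) (Fgen (GenKV i)).
  exact: (cl_inv (relJ (nU_kkV q i))).
- move=> i j; apply: (anti_comm FM); rewrite (Fgen (GenK i)) (Fgen (GenK j)).
  exact: (cl_comm (relJ (nU_kk q i j))).
- move=> i j; apply: (anti_comm FM); rewrite (Fgen (GenK i)) (Fgen (GenU (GenH j))).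
  exact: (cl_comm (relJ (nU_kh q i j))).
- move=> i j; apply: (anti_qrel FZ FM (pow_real _) (d := q ^ (- cartan i j))).
    by rewrite -invr_expz mulfV // expfz_neq0.
  rewrite (Fgen (GenK i)) (Fgen (GenU (GenE j))).
  exact: (cl_qrel (relJ (nU_kf q i j))).
- move=> i j; apply: (anti_qrel FZ FM (pow_real _) (d := q ^ cartan i j)).
    by rewrite -invr_expz mulVf // expfz_neq0.
  rewrite (Fgen (GenK i)) (Fgen (GenU (GenF j))).
  exact: (cl_qrel (relJ (nU_ke q i j))).
Qed.

Let F_ideal x : J x -> F x = 0.
Proof. exact: (ideal_gen_antiker (raddfB F) FM F_rel). Qed.

Lemma nU_omega_exists : exists omega : nU n q -> nU n q, is_omega omega.
Proof.
have omega_gens u : quot_anti F (cl J (gen u)) = cl J (omega_gen u).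
  by rewrite (quot_antiE F_ideal) Fgen.
exists (quot_anti F); split.
- exact: (quot_antiL FZ F_ideal).
- exact: (quot_antiM FM F_ideal).
- exact: (quot_anti1 F1 F_ideal).
- have cnjK : involutive cnj by exact: conjCK.
  have Fgen' u : F (omega_gen u) = cl J (gen u) by case: u => [[i|i|i]|i|i]; apply: Fgen.
  exact: (quot_antiK FZ FM F1 F_ideal cnjK (@free_ind _ _) Fgen Fgen').
- by move=> i; split; apply: omega_gens.
Qed.

End Omega.

Theorem proposition2 (R : realType) (n : nat) (p : R[i]) (hn : (0 < n)%N) :
  (forall alpha beta : R[i] -> fps R[i],
     (forall x, alpha x ^+ 2 = h_qratio x) ->
     (forall x, beta x ^+ 2 = h_qint x) ->
     (exists pi : hU R n -> hW R n, hHP p alpha beta pi) /\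
     (forall P : nat, (0 < P)%N -> p = P%:R ->
        (exists act, @h_fock_rep R n act) /\
        forall pi act, hHP p alpha beta pi -> @h_fock_rep R n act ->
          [/\ is_invariant (fun u => act (pi u)) (h_ext (@fock0 R n P)),
              is_invariant (fun u => act (pi u)) (h_ext (@fock1 R n P)),
              finitely_spanned (h_ext (@fock0 R n P)) &
              h_irreducible (fun u => act (pi u)) (h_ext (@fock0 R n P))]))
  /\
  (forall h : R[i], (forall m, (0 < m)%N -> n_q h ^+ m != 1) ->
   forall alpha beta : R[i] -> R[i],
     (forall x, alpha x ^+ 2 = n_qratio h x) ->
     (forall x, beta x ^+ 2 = n_qint h x) ->
     (exists pi : nU n (n_q h) -> nW R n, nHP p alpha beta pi) /\
     (forall P : nat, (0 < P)%N -> p = P%:R ->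
        (exists act, @n_fock_rep R n act) /\
        forall (pi : nU n (n_q h) -> nW R n) act,
          nHP p alpha beta pi -> @n_fock_rep R n act ->
          [/\ is_invariant (fun u => act (pi u)) (@fock0 R n P),
              is_invariant (fun u => act (pi u)) (@fock1 R n P),
              finitely_spanned (@fock0 R n P),
              is_irreducible (fun u => act (pi u)) (@fock0 R n P) &
              0 < n_q h ->
              exists2 omega : nU n (n_q h) -> nU n (n_q h),
                is_omega omega &
                unitarizable omega (fun u => act (pi u)) (@fock0 R n P)])).
Proof.
split=> [alpha beta alphaP betaP|h qroot alpha beta alphaP betaP]; split.
- exact: formal_pi_exists.
- move=> P _ pP; split=> [|pi act piP actP]; first exact: formal_fock_exists.
  rewrite {}pP in piP; exact: (formal_representation alphaP betaP piP actP).
- exact: numeric_pi_exists.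
- move=> P _ pP; split=> [|pi act piP actP]; first exact: numeric_fock_exists.
  rewrite {}pP in piP.
  have [inv0 inv1 fin irr] := numeric_representation qroot alphaP betaP piP actP.
  split=> // q_gt0; have [omega omegaP] := nU_omega_exists n q_gt0.
  by exists omega; last exact: (numeric_unitarizable qroot alphaP betaP piP actP q_gt0 omegaP).
Qed.
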